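(* Let $n\ge 1$, $\sigma>0$, $\mathcal{E}=\mathbb{R}^{n+1}_+=\{(t,x): t>0,\ x\in\mathbb{R}^n\}$, and let $$h_q(y)=\frac{c(n,\sigma)\,t^\sigma}{(t^2+|x-y|^2)^{(n+\sigma)/2}},\qquad q=(t,x)\in\mathcal{E},\ y\in\mathbb{R}^n,$$ be the parameterized fractional Poisson kernels, with associated reproducing kernel Hilbert space $H_K$, reproducing kernels $K_q$, and normalized dictionary $E_q=K_q/\|K_q\|_{H_K}$. Then this $\mathcal{H}$-$H_K$ structure satisfies the boundary vanishing condition (BVC): for every $u\in H_K$, $$\lim_{\mathcal{E}\ni q\to\partial^*\mathbb{R}^{n+1}_+}|\langle u,E_q\rangle_{H_K}|=0 .$$ As a consequence, the POAFD algorithm can be performed in this context to obtain sparse representations of functions in $L^2(\mathbb{R}^n)$. That is, for every $f\in L^2(\mathbb{R}^n)$ a POAFD maximal selection exists at every step $k=1,2,\dots$, and the resulting orthonormal system $(E_k)_{k\ge1}$ satisfies $$f=\sum_{k=1}^\infty\langle f,E_k\rangle E_k\quad\text{in } L^2(\mathbb{R}^n).$$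
   Context: $L^2(\mathbb{R}^n)$ is the space of complex-valued square-integrable functions with $\langle f,g\rangle=\int_{\mathbb{R}^n} f\overline{g}\,dx$. The constant is $c(n,\sigma)=\frac{\Gamma((n+\sigma)/2)}{\pi^{n/2}\Gamma(\sigma/2)}$, so that $\int_{\mathbb{R}^n}h_q(y)\,dy=1$. $\mathcal{H}$-$H_K$ formulation with $\mathcal{H}=L^2(\mathbb{R}^n)$: define $\mathscr{L}f(q)=\langle f,h_q\rangle$ for $q\in\mathcal{E}$, and let $N(\mathscr{L})$ be its (closed) null space. $H_K$ is the range of $\mathscr{L}$ with norm $\|\mathscr{L}f\|_{H_K}=\|f_+\|_{L^2}$, where $f_+$ is the orthogonal projection of $f$ onto $N(\mathscr{L})^\perp$, and with the corresponding inner product. It is a reproducing kernel Hilbert space with kernel $K(q,p)=\langle h_q,h_p\rangle$; write $K_q(p)=K(q,p)$ and $E_q=K_q/\|K_q\|_{H_K}$. Boundary: $\partial^*\mathbb{R}^{n+1}_+$ is the boundary of $\mathbb{R}^{n+1}_+$ in the one-point compactification of $\mathbb{R}^{n+1}$. Thus $q=(t,x)\to\partial^*\mathbb{R}^{n+1}_+$ means that $q$ eventually leaves every compact subset of $\mathbb{R}^{n+1}_+$ (that is, $t\to0^+$ or $|(t,x)|\to\infty$). POAFD (pre-orthogonal adaptive Fourier decomposition), written on the $L^2(\mathbb{R}^n)$ side: suppose $q_1,\dots,q_{k-1}\in\mathcal{E}$ and orthonormal $E_1,\dots,E_{k-1}$ have been chosen (nothing if $k=1$), and let $V_{k-1}$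 be their span. For $q\in\mathcal{E}$, let $E_k^q$ be the last vector of the Gram–Schmidt orthonormalization of $(\widetilde h_{q_1},\dots,\widetilde h_{q_{k-1}},\widetilde h_q)$, i.e. the normalized component of $\widetilde h_q$ orthogonal to $V_{k-1}$. Here $\widetilde h_q=h_q$ if $q\notin\{q_1,\dots,q_{k-1}\}$. If $q\in\{q_1,\dots,q_{k-1}\}$, then $\widetilde h_q\notin V_{k-1}$ is a multiple kernel, that is, a finite linear combination of partial derivatives, with respect to the parameter, of $q'\mapsto h_{q'}$ at $q'=q$, such that $E_k^q$ is the norm limit of $E_k^{q^{(j)}}$ along some sequence $q^{(j)}\to q$ of points different from $q_1,\dots,q_{k-1}$. A POAFD maximal selection at step $k$ for $f$ is a point $q_k\in\mathcal{E}$ (together with a choice of multiple kernel $\widetilde h_{q_k}$ if $q_k$ is a repetition) for which $|\langle f,E_k^{q_k}\rangle|=\sup_{q}|\langle f,E_k^q\rangle|$, the supremum being over all $q\in\mathcal{E}$ and all admissible $\widetilde h_q$. One then sets $E_k=E_k^{q_k}$. *)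

(* Defs.v *)
From HB Require Import structures.
From mathcomp Require Import all_boot all_order all_algebra.
From mathcomp Require Import complex.
From mathcomp Require Import all_classical all_reals all_analysis.

Set Implicit Arguments.
Unset Strict Implicit.
Unset Printing Implicit Defensive.

Import Order.TTheory GRing.Theory Num.Theory.
Import numFieldNormedType.Exports.

Local Open Scope classical_set_scope.
Local Open Scope complex_scope.
Local Open Scope ring_scope.

(* R^n is ['rV[R]_n], with the sigma-algebra generated by the coordinates
   (that is, the Borel one), as the library does for [n.-tuple]. *)

Definition rV_display : measure_display -> measure_display.
Proof. exact. Qed.

Section rV_measurable.
Context (R : realType) (n : nat).

Let coord (i : 'I_n) (x : 'rV[R]_n) : R := x ord0 i.

Let rV_set0 : g_sigma_preimage coord set0.
Proof. exact: sigma_algebra0. Qed.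

Let rV_setC A : g_sigma_preimage coord A -> g_sigma_preimage coord (~` A).
Proof. exact: sigma_algebraC. Qed.

Let rV_bigcup (F : _^nat) : (forall i, g_sigma_preimage coord (F i)) ->
  g_sigma_preimage coord (\bigcup_i (F i)).
Proof. exact: sigma_algebra_bigcup. Qed.

HB.instance Definition _ := @isMeasurable.Build (rV_display default_measure_display)
  'rV[R]_n (g_sigma_preimage coord) rV_set0 rV_setC rV_bigcup.

Lemma measurable_rV_coord (i : 'I_n) :
  measurable_fun [set: 'rV[R]_n] (fun x : 'rV[R]_n => x ord0 i).
Proof.
move=> _ Y mY; rewrite setTI; apply: sub_sigma_algebra => /=.
rewrite -bigcup_seq/=; exists i => /=; first by rewrite mem_index_enum.
by exists Y => //; rewrite setTI.
Qed.

Lemma measurable_fun_rV d (T : measurableType d) (f : T -> 'rV[R]_n) :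
  (forall i, measurable_fun setT (fun t => f t ord0 i)) ->
  measurable_fun setT f.
Proof.
move=> mf; apply: (measurability (\big[setU/set0]_(i < n)
  preimage_set_system setT (coord i) measurable)) => //.
move=> _ [B + <-]; rewrite -bigcup_seq/= => -[i _ [A mA <-]].
by rewrite !setTI; rewrite -[X in measurable X]setTI; exact: mf.
Qed.

End rV_measurable.

Section lebesgue_rV.
Context (R : realType).

Definition rV_cons n (p : measurableTypeR R * 'rV[R]_n) : 'rV[R]_n.+1 :=
  row_mx (p.1%:M : 'rV_1) p.2.

Definition rV_uncons n (x : 'rV[R]_n.+1) :
    measurableTypeR R * 'rV[R]_n :=
  (x ord0 ord0, \row_i x ord0 (lift ord0 i)).

Lemma rV_cons0 n (p : measurableTypeR R * 'rV[R]_n) : rV_cons p ord0 ord0 = p.1.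
Proof.
have <- : (p.1%:M : 'rV_1) ord0 ord0 = p.1 by rewrite mxE eqxx.
rewrite -(row_mxEl (p.1%:M : 'rV_1) p.2 ord0 ord0).
by congr (row_mx _ _ _ _); exact/val_inj.
Qed.

Lemma rV_consS n (p : measurableTypeR R * 'rV[R]_n) i :
  rV_cons p ord0 (lift ord0 i) = p.2 ord0 i.
Proof.
rewrite -(row_mxEr (p.1%:M : 'rV_1) p.2 ord0 i).
by congr (row_mx _ _ _ _); exact/val_inj.
Qed.

Lemma rV_unconsK n : cancel (@rV_uncons n) (@rV_cons n).
Proof.
move=> x; apply/rowP => i; have [j ->|->] := unliftP ord0 i.
  by rewrite rV_consS mxE.
by rewrite rV_cons0.
Qed.

Lemma rV_consK n : cancel (@rV_cons n) (@rV_uncons n).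
Proof.
move=> [r x]; rewrite /rV_uncons rV_cons0; congr pair.
by apply/rowP => i; rewrite mxE rV_consS.
Qed.

Lemma measurable_rV_cons n : measurable_fun setT (@rV_cons n).
Proof.
apply: measurable_fun_rV => i; have [j ->|->] := unliftP ord0 i.
  rewrite (_ : (fun _ => _) =
    (fun x : 'rV[R]_n => x ord0 j) \o (@snd (measurableTypeR R) 'rV[R]_n)); last first.
    by apply/funext => p /=; rewrite rV_consS.
  by apply: measurableT_comp => //; exact: measurable_rV_coord.
rewrite (_ : (fun _ => _) = (@fst (measurableTypeR R) 'rV[R]_n)) //.
by apply/funext => p /=; rewrite rV_cons0.
Qed.

Lemma measurable_rV_uncons n : measurable_fun setT (@rV_uncons n).
Proof.
apply/measurable_fun_pairP; split; first exact: measurable_rV_coord.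
apply: measurable_fun_rV => i /=.
rewrite (_ : (fun _ => _) = fun x : 'rV[R]_n.+1 => x ord0 (lift ord0 i)).
  exact: measurable_rV_coord.
by apply/funext => x; rewrite mxE.
Qed.

Section lebesgue_cons.
Context (n : nat) (mu : {sigma_finite_measure set 'rV[R]_n -> \bar R}).

Definition lebesgue_cons : set 'rV[R]_n.+1 -> \bar R :=
  pushforward (@lebesgue_measure R \x mu)%E (@rV_cons n).

Let lebesgue_cons0 : lebesgue_cons set0 = 0%E.
Proof. by rewrite /lebesgue_cons /pushforward preimage_set0 measure0. Qed.

Let lebesgue_cons_ge0 A : (0 <= lebesgue_cons A)%E.
Proof. by apply: measure_ge0; exact: measurable_rV_cons. Qed.

Let lebesgue_cons_sigma_additive : semi_sigma_additive lebesgue_cons.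
Proof.
move=> F mF tF mUF; have mf := @measurable_rV_cons n.
rewrite /lebesgue_cons /pushforward preimage_bigcup.
apply: measure_semi_sigma_additive.
- by move=> k; rewrite -[X in measurable X]setTI; exact: mf.
- apply/trivIsetP => /= i j _ _ ij; rewrite -preimage_setI.
  by move/trivIsetP : tF => /(_ _ _ _ _ ij) ->//; rewrite preimage_set0.
- by rewrite -preimage_bigcup -[X in measurable X]setTI; exact: mf.
Qed.

HB.instance Definition _ := isMeasure.Build _ _ _ lebesgue_cons
  lebesgue_cons0 lebesgue_cons_ge0 lebesgue_cons_sigma_additive.

Lemma lebesgue_cons_sigma_finite : sigma_finite setT lebesgue_cons.
Proof.
have /sigma_finiteP[F [FT ndF Foo]] := sigma_finiteT (@lebesgue_measure R).
have /sigma_finiteP[G [GT ndG Goo]] := sigma_finiteT mu.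
exists (fun k => @rV_uncons n @^-1` (F k `*` G k)).
  apply/seteqP; split=> // x _.
  have [k _ Fk] : (\bigcup_k F k) (rV_uncons x).1 by rewrite -FT.
  have [l _ Gl] : (\bigcup_k G k) (rV_uncons x).2 by rewrite -GT.
  exists (maxn k l) => //; split.
  - by move: Fk; exact/subsetPset/ndF/leq_maxl.
  - by move: Gl; exact/subsetPset/ndG/leq_maxr.
move=> k; have [mF Fkoo] := Foo k; have [mG Gkoo] := Goo k.
split.
  rewrite -[X in measurable X]setTI; apply: measurable_rV_uncons => //.
  exact: measurableX.
rewrite /lebesgue_cons /pushforward -comp_preimage.
rewrite (_ : _ \o _ = id); last by apply/funext => p /=; rewrite rV_consK.
by rewrite preimage_id product_measure1E// lte_mul_pinfty// ge0_fin_numE.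
Qed.

HB.instance Definition _ := Measure_isSigmaFinite.Build _ _ _ lebesgue_cons
  lebesgue_cons_sigma_finite.

End lebesgue_cons.

(* Iterated product of the one-dimensional Lebesgue measure; the measure on
   the one-point space R^0 is the unit mass. *)
Fixpoint lebesgue_rV n : {sigma_finite_measure set 'rV[R]_n -> \bar R} :=
  match n with
  | 0 => \d_(0 : 'rV[R]_0)
  | m.+1 => lebesgue_cons (lebesgue_rV m)
  end.

Lemma lebesgue_rV_prod n (A : 'I_n -> set R) : (forall i, measurable (A i)) ->
  lebesgue_rV n [set x | forall i, A i (x ord0 i)] =
  (\prod_(i < n) lebesgue_measure (A i))%E.
Proof.
elim: n => [|n IHn] in A * => mA.
  by rewrite big_ord0 /= diracE mem_set// => -[].
rewrite big_ord_recl -(IHn (fun i => A (lift ord0 i))) => [|i]; last exact: mA.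
set B := [set x : 'rV_n | forall i, A (lift ord0 i) (x ord0 i)].
have mB : measurable B.
  rewrite (_ : B = \bigcap_(i in [set: 'I_n])
    ((fun x : 'rV[R]_n => x ord0 i) @^-1` A (lift ord0 i))).
    apply: fin_bigcap_measurable => // i _.
    by rewrite -[X in measurable X]setTI; exact: measurable_rV_coord.
  by apply/seteqP; split=> [x Bx i _|x Bx i]; exact: Bx.
rewrite -(@product_measure1E _ _ _ _ _ (@lebesgue_measure R) (lebesgue_rV n))//;
  last exact: mA.
rewrite /= /lebesgue_cons /pushforward; congr (_ _).
apply/seteqP; split=> [[r x] /= Ax|[r x] /= [Ar Bx] i].
  split; first by have := Ax ord0; rewrite rV_cons0.
  by move=> i; have := Ax (lift ord0 i); rewrite rV_consS.
have [j ->|->] := unliftP ord0 i; last by rewrite rV_cons0.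
by rewrite rV_consS; exact: Bx.
Qed.

End lebesgue_rV.

(* Elements of L^2(R^n) are represented by complex-valued Borel functions,
   equality being equality almost everywhere. *)

Section L2.
Context {R : realType} {n : nat}.
Implicit Types f g e w : 'rV[R]_n -> R[i].

Local Notation leb := (lebesgue_rV R n).

Definition cintegral f : R[i] :=
  (\int[leb]_y complex.Re (f y)) +i* (\int[leb]_y complex.Im (f y)).

Definition l2dot f g : R[i] := cintegral (fun y => f y * (g y)^*).

Definition l2norm f : \bar R :=
  Lnorm leb 2%:E (fun y => (Normc.normc (f y))%:E).

Definition is_L2 f : Prop :=
  [/\ measurable_fun setT (fun y => complex.Re (f y)),
      measurable_fun setT (fun y => complex.Im (f y)) &
      (l2norm f < +oo)%E].

Definition in_span (s : seq ('rV[R]_n -> R[i])) w : Prop :=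
  exists c : 'I_(size s) -> R[i],
    {ae leb, forall y, w y = \sum_(i < size s) c i * nth (fun=> 0) s i y}.

(* The component of [w] orthogonal to the span of [s], for [s] orthonormal. *)
Definition gs_residual (s : seq ('rV[R]_n -> R[i])) w : 'rV[R]_n -> R[i] :=
  fun y => w y - \sum_(e <- s) l2dot w e * e y.

Definition gs_step (s : seq ('rV[R]_n -> R[i])) w : 'rV[R]_n -> R[i] :=
  fun y => ((fine (l2norm (gs_residual s w)))^-1)%:C * gs_residual s w y.

Fixpoint gram_schmidt (w : nat -> 'rV[R]_n -> R[i]) (k : nat) :
    seq ('rV[R]_n -> R[i]) :=
  if k is j.+1 then
    rcons (gram_schmidt w j) (gs_step (gram_schmidt w j) (w j))
  else [::].

End L2.

Section Poisson.
Context {R : realType}.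

Definition Gamma (s : R) : R :=
  \int[@lebesgue_measure R]_(x in `]0%R, +oo[) (x `^ (s - 1) * expR (- x)).

Definition halfspace n : set (R * 'rV[R]_n) := [set q | 0 < q.1].
Arguments halfspace : clear implicits.

(* The filter of q -> boundary of the half-space in the one-point
   compactification: q eventually leaves every compact subset. *)
Definition to_boundary n : set_system (R * 'rV[R]_n) :=
  filter_from [set K | compact K /\ K `<=` halfspace n]
              (fun K => halfspace n `\` K).
Arguments to_boundary : clear implicits.

#[global] Instance to_boundary_filter n : Filter (to_boundary n).
Proof.
apply: filter_from_filter; first by exists set0; split; [exact: compact0|].
move=> K L [cK KH] [cL LH]; exists (K `|` L).
  by split; [exact: compactU | rewrite subUset].
by move=> q [Hq /not_orP[nK nL]].
Qed.

Definition poisson_const n (sigma : R) : R :=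
  Gamma ((n%:R + sigma) / 2) / (pi `^ (n%:R / 2) * Gamma (sigma / 2)).

Definition sqnorm n (x : 'rV[R]_n) : R := \sum_(i < n) x ord0 i ^+ 2.

Definition poisson n (sigma : R) (q : R * 'rV[R]_n) (y : 'rV[R]_n) : R :=
  poisson_const n sigma * q.1 `^ sigma /
    (q.1 ^+ 2 + sqnorm (q.2 - y)) `^ ((n%:R + sigma) / 2).

Definition cpoisson n (sigma : R) (q : R * 'rV[R]_n) : 'rV[R]_n -> R[i] :=
  fun y => (poisson sigma q y)%:C.

End Poisson.
Arguments halfspace {R} n.
Arguments to_boundary R n : clear implicits.

(* Elements of H_K are functions on the half-space; they are represented by
   functions on R * R^n whose values outside the half-space are irrelevant. *)

Section HK.
Context {R : realType} (n : nat) (sigma : R).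
Implicit Types (f g : 'rV[R]_n -> R[i]) (u v : R * 'rV[R]_n -> R[i]).

Definition poisson_op f : R * 'rV[R]_n -> R[i] :=
  fun q => l2dot f (cpoisson sigma q).

Definition in_nullspace f : Prop :=
  is_L2 f /\ forall q, halfspace n q -> poisson_op f q = 0.

Definition in_nullspace_perp g : Prop :=
  is_L2 g /\ forall f, in_nullspace f -> l2dot g f = 0.

(* [g] is (a representative of) the orthogonal projection of [f] onto the
   orthogonal complement of the null space. *)
Definition is_plus_part f g : Prop :=
  in_nullspace_perp g /\ in_nullspace (f \- g).

Definition represents f u : Prop :=
  is_L2 f /\ forall q, halfspace n q -> poisson_op f q = u q.

Definition in_HK u : Prop := exists f, represents f u.

(* f_+ for any f represented by u; it is unique up to a null set *)
Definition plus_part u : 'rV[R]_n -> R[i] :=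
  xget (fun=> 0) [set g | exists2 f, represents f u & is_plus_part f g].

Definition HKdot u v : R[i] := l2dot (plus_part u) (plus_part v).

Definition HKnorm u : R := fine (l2norm (plus_part u)).

Definition rkernel (q p : R * 'rV[R]_n) : R[i] :=
  l2dot (cpoisson sigma q) (cpoisson sigma p).

Definition normalized_kernel (q : R * 'rV[R]_n) : R * 'rV[R]_n -> R[i] :=
  fun p => ((HKnorm (rkernel q))^-1)%:C * rkernel q p.

End HK.

Section POAFD.
Context {R : realType} (n : nat) (sigma : R).

(* Coordinate directions of the parameter (t, x): [None] is t. *)
Definition param_dir (i : option 'I_n) : R * 'rV[R]_n :=
  if i is Some j then (0, delta_mx ord0 j) else (1, 0).

Definition iter_partial (s : seq (option 'I_n)) (F : R * 'rV[R]_n -> R) :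
    R * 'rV[R]_n -> R :=
  foldr (fun i G => 'D_(param_dir i) G) F s.

(* The empty list in [s j] gives the derivative of order zero, that is [h_q]
   itself; at a repeated point [h_q] lies in the span of the previous vectors,
   so this does not change the normalized orthogonal component. *)
Definition multiple_kernel (q : R * 'rV[R]_n) (w : 'rV[R]_n -> R[i]) : Prop :=
  exists (m : nat) (c : 'I_m -> R[i]) (s : 'I_m -> seq (option 'I_n)),
    w = fun y =>
      \sum_(j < m) c j * (iter_partial (s j) (fun p => poisson sigma p y) q)%:C.

(* [w] may be used as the kernel \tilde h_q, after the points [qs] and the
   orthonormal functions [es] have been selected. *)
Definition admissible_kernel (qs : seq (R * 'rV[R]_n))
    (es : seq ('rV[R]_n -> R[i])) (q : R * 'rV[R]_n) (w : 'rV[R]_n -> R[i]) :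
    Prop :=
  if q \notin qs then w = cpoisson sigma q
  else [/\ multiple_kernel q w, ~ in_span es w &
    exists p : nat -> R * 'rV[R]_n,
      [/\ forall j, halfspace n (p j) /\ p j \notin qs,
          p @ \oo --> q &
          (fun j => l2norm (gs_step es w \- gs_step es (cpoisson sigma (p j))))
            @ \oo --> 0%E]].

Definition is_maximal_selection (f : 'rV[R]_n -> R[i])
    (qs : seq (R * 'rV[R]_n)) (es : seq ('rV[R]_n -> R[i]))
    (q : R * 'rV[R]_n) (w : 'rV[R]_n -> R[i]) : Prop :=
  [/\ halfspace n q, admissible_kernel qs es q w &
    (Normc.normc (l2dot f (gs_step es w)))%:E =
    ereal_sup [set r | exists q' w',
      [/\ halfspace n q', admissible_kernel qs es q' w' &
          r = (Normc.normc (l2dot f (gs_step es w')))%:E]]].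

(* The selections [q k], [w k] (counted from k = 0) are maximal at step k, given
   the previous ones. *)
Definition maximal_at (f : 'rV[R]_n -> R[i]) (q : nat -> R * 'rV[R]_n)
    (w : nat -> 'rV[R]_n -> R[i]) (k : nat) : Prop :=
  is_maximal_selection f (mkseq q k) (gram_schmidt w k) (q k) (w k).

(* The system produced by the algorithm, counted from 0. *)
Definition poafd_system (w : nat -> 'rV[R]_n -> R[i]) (k : nat) :
    'rV[R]_n -> R[i] :=
  gs_step (gram_schmidt w k) (w k).

End POAFD.

(* Main.v *)
Require Import Defs.
From mathcomp Require Import all_boot all_order all_algebra.
From mathcomp Require Import complex.
From mathcomp Require Import all_classical all_reals all_analysis.
From mathcomp Require Import measurable_realfun ring lra.

(** Write [quad (t, x) y = t ^+ 2 + |x - y| ^+ 2], so that the kernel [h_q] at [q]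
    is a positive multiple of [quad q `^ (- s)] with [s = (n + sigma) / 2].

    Density. A closed subspace of L2 containing all kernels is L2
    ([poisson_dense]). Indeed [quad q] is affine in suitable coordinates of [q], so
    that the Taylor coefficients of the kernels at a point [p], which the subspace
    contains, are [r ^+ m * quad p `^ (- s)], where [r] is any linear combination
    of the bounded functions obtained from the coordinates by inversion in a
    sphere. Exponential series in [r] and limits of them give [quad p `^ (- s)]
    times indicators of cylinders, then of all Borel sets. Consequently the null
    space of the transform is trivial, [HKdot] is the L2 product of
    representatives, and a bounded family in L2 tends weakly to zero as soon as it
    does so against the kernels ([weak_vanishes]).

    Boundary vanishing. The normalized kernels have norm 1, so that it suffices to
    test them on indicators of bounded sets, which generate L2; there the kernel
    is compared directly with a lower bound of its norm ([bvc]).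

    Existence of maximal selections. The vectors [E_k^q] are normalized residuals
    of kernels. Near the boundary the residual of [h_q] is comparable to [h_q], so
    that [<f, E_k^q>] tends to 0 and a maximizing family of new points has, unless
    the supremum is 0, a limit point [p] in the half-space; ultrafilters avoid
    passing to subsequences. If [p] is new, continuity suffices, the residual of
    [h_p] being nonzero. If [p] was selected before, the limit of the normalized
    residuals is read off the Taylor polynomials of the kernel at [p] and is a
    multiple kernel ([gs_step_repeat_cvg]). Both cases rest on the independence of
    the kernels and their parameter derivatives ([jets_independent]): on a complex
    line [quad p] has a zero where the kernels at other points are regular, and
    repeated differentiation kills the regular terms of a linear relation
    ([no_relation]).

    Convergence. Let [r_N] be the part of [f] orthogonal to the first [N] selected
    vectors. A kernel that is never selected has, by maximality, product with
    [r_N] at most [|h_q| * |<f, E_N>|], which tends to 0 by Bessel's inequality; a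
    selected one lies in the span, so that the product is eventually 0. Hence
    [r_N] tends weakly to zero, and [|r_N| ^+ 2 = <r_N, f>] tends to 0
    ([poafd_converges]). *)

Import Order.TTheory GRing.Theory Num.Theory.
Import numFieldNormedType.Exports.

Local Open Scope classical_set_scope.
Local Open Scope ring_scope.

Set Implicit Arguments.
Unset Strict Implicit.
Unset Printing Implicit Defensive.


(** * Square integrable functions *)

Section SquareIntegrable.
Context d (T : measurableType d) (R : realType) (mu : {measure set T -> \bar R}).
Implicit Types a b : T -> R.

Definition sqint a :=
  measurable_fun setT a /\ mu.-integrable setT (fun y => (a y ^+ 2)%:E).

Lemma integrable_le_norm a b : measurable_fun setT a ->
  mu.-integrable setT (EFin \o b) -> (forall y, `|a y| <= `|b y|) ->
  mu.-integrable setT (EFin \o a).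
Proof.
move=> ma ib ab; apply: (le_integrable measurableT _ _ ib).
  exact/measurable_EFinP.
by move=> y _ /=; rewrite lee_fin.
Qed.

Lemma sqintM a b : sqint a -> sqint b ->
  mu.-integrable setT (EFin \o (fun y => a y * b y)).
Proof.
move=> [ma ia] [mb ib].
have iab := integrableD measurableT ia ib.
apply: (@integrable_le_norm _ (fun y => a y ^+ 2 + b y ^+ 2)).
- exact: measurable_funM.
- by move: iab; apply: eq_integrable.
- move=> y; rewrite normrM [leRHS]ger0_norm ?addr_ge0 ?sqr_ge0//.
  rewrite -(real_normK (num_real (a y))) -(real_normK (num_real (b y))).
  by have := sqr_ge0 (`|a y| - `|b y|); have := normr_ge0 (a y);
    have := normr_ge0 (b y); nra.
Qed.

Lemma sqintD a b : sqint a -> sqint b -> sqint (fun y => a y + b y).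
Proof.
move=> sa sb; have [ma ia] := sa; have [mb ib] := sb; split.
  exact: measurable_funD.
have i2 := integrableD measurableT (integrableZl measurableT 2 ia)
  (integrableZl measurableT 2 ib).
apply: (@integrable_le_norm _ (fun y => 2 * a y ^+ 2 + 2 * b y ^+ 2)).
- by apply: measurable_funX; exact: measurable_funD.
- by apply: eq_integrable i2.
- move=> y; rewrite ger0_norm ?sqr_ge0// [leRHS]ger0_norm; last first.
    by have := sqr_ge0 (a y); have := sqr_ge0 (b y); lra.
  by have := sqr_ge0 (a y - b y); nra.
Qed.

Lemma sqintZ k a : sqint a -> sqint (fun y => k * a y).
Proof.
move=> [ma ia]; split; first exact: measurable_funM.
have := integrableZl measurableT (k ^+ 2) ia; apply: eq_integrable => //.
by move=> y _ /=; rewrite -EFinM exprMn.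
Qed.

Lemma sqint0 : sqint (fun=> 0).
Proof.
split=> //; rewrite (_ : (fun _ => _) = cst 0%E); first exact: integrable0.
by apply/funext => y; rewrite expr0n.
Qed.

Lemma le_sqint a b : measurable_fun setT a -> sqint b ->
  (forall y, `|a y| <= `|b y|) -> sqint a.
Proof.
move=> ma [mb ib] ab; split=> //.
apply: (@integrable_le_norm _ (fun y => b y ^+ 2)) => //.
  exact: measurable_funX.
by move=> y; rewrite !normrX lerXn2r// nnegrE.
Qed.

Lemma sqintN a : sqint a -> sqint (fun y => - a y).
Proof. by move=> /(sqintZ (-1)); under eq_fun do rewrite mulN1r. Qed.

End SquareIntegrable.

Section L2basics.
Context {R : realType} {n : nat}.
Local Notation leb := (lebesgue_rV R n).
Local Notation fn := ('rV[R]_n -> R[i]).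
Implicit Types (f g h : fn) (c : R[i]).

Local Notation Re := complex.Re.
Local Notation Im := complex.Im.
Local Notation sqint := (sqint leb).

Lemma normc_sqr (z : R[i]) : Normc.normc z ^+ 2 = Re z ^+ 2 + Im z ^+ 2.
Proof. by case: z => a b /=; rewrite sqr_sqrtr// addr_ge0 ?sqr_ge0. Qed.

Lemma normc_ge0 (z : R[i]) : 0 <= Normc.normc z.
Proof. by case: z => a b /=; rewrite sqrtr_ge0. Qed.

Lemma l2norm_sqr f :
  (l2norm f `^ 2 = \int[leb]_y ((Re (f y)) ^+ 2 + (Im (f y)) ^+ 2)%:E)%E.
Proof.
rewrite /l2norm powR_Lnorm ?pnatr_eq0//; apply: eq_integral => y _ /=.
rewrite ger0_norm ?normc_ge0// powR_mulrn ?normc_ge0// normc_sqr//.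
Qed.

Lemma is_L2P f : is_L2 f <-> sqint (fun y => Re (f y)) /\ sqint (fun y => Im (f y)).
Proof.
split.
- move=> [mr mi fin].
  have fin2 : (l2norm f `^ 2 < +oo)%E by apply: poweR_lty.
  rewrite l2norm_sqr in fin2.
  have i2 : leb.-integrable setT
      (EFin \o (fun y => (Re (f y)) ^+ 2 + (Im (f y)) ^+ 2)).
    apply/integrableP; split.
      by apply/measurable_EFinP; apply: measurable_funD; apply: measurable_funX.
    apply: le_lt_trans fin2; apply: ge0_le_integral => //.
    + by apply/measurable_EFinP; apply: measurableT_comp => //;
        apply: measurable_funD; apply: measurable_funX.
    + by apply/measurable_EFinP; apply: measurable_funD; apply: measurable_funX.
    + by move=> y _ /=; rewrite lee_fin ger0_norm// addr_ge0 ?sqr_ge0.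
  split; split=> //; apply: (integrable_le_norm _ i2); try by apply: measurable_funX.
  + by move=> y; rewrite !ger0_norm ?addr_ge0 ?sqr_ge0// lerDl sqr_ge0.
  + by move=> y; rewrite !ger0_norm ?addr_ge0 ?sqr_ge0// lerDr sqr_ge0.
- move=> [[mr ir] [mi ii]]; split=> //.
  apply: (@lty_poweRy _ _ 2); first by rewrite pnatr_eq0.
  rewrite l2norm_sqr.
  exact: (integrable_lty measurableT (integrableD measurableT ir ii)).
Qed.

Lemma l2dotE f g : is_L2 f -> is_L2 g -> l2dot f g = Complex
  (\int[leb]_y (Re (f y) * Re (g y)) + \int[leb]_y (Im (f y) * Im (g y)))
  (\int[leb]_y (Im (f y) * Re (g y)) - \int[leb]_y (Re (f y) * Im (g y))).
Proof.
move=> /is_L2P[fr fi] /is_L2P[gr gi]; rewrite /l2dot /cintegral; congr Complex.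
- rewrite -RintegralD//; [|exact: sqintM|exact: sqintM].
  apply: eq_Rintegral => y _; case: (f y) (g y) => [a b] [a' b'] /=; ring.
- rewrite -RintegralB//; [|exact: sqintM|exact: sqintM].
  apply: eq_Rintegral => y _; case: (f y) (g y) => [a b] [a' b'] /=; ring.
Qed.

(** The norm as a real number; [fine] sends an infinite [l2norm] to 0, so it is
    the norm on square integrable functions only. *)
Definition hnorm f : R := fine (l2norm f).

Lemma hnorm_ge0 f : 0 <= hnorm f.
Proof. by rewrite fine_ge0// Lnorm_ge0. Qed.

Lemma l2norm_fin f : is_L2 f -> l2norm f = (hnorm f)%:E.
Proof.
by move=> [_ _ fin]; rewrite /hnorm fineK// ge0_fin_numE// Lnorm_ge0.
Qed.

Lemma hnorm_sqr f : is_L2 f -> hnorm f ^+ 2 = Re (l2dot f f).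
Proof.
move=> f2; have /is_L2P[fr fi] := f2.
rewrite l2dotE//= -RintegralD//; [|exact: sqintM|exact: sqintM].
have := l2norm_sqr f; rewrite l2norm_fin// poweR_EFin powR_mulrn ?hnorm_ge0//.
move=> E; rewrite /Rintegral.
under eq_integral do rewrite -!expr2.
by rewrite -E.
Qed.

Lemma is_L2D f g : is_L2 f -> is_L2 g -> is_L2 (f + g).
Proof.
move=> /is_L2P[fr fi] /is_L2P[gr gi]; apply/is_L2P; split.
- rewrite (_ : (fun y => _) = fun y => Re (f y) + Re (g y)); first exact: sqintD.
  by apply/funext => y; rewrite !fctE; case: (f y) (g y) => [? ?] [? ?].
- rewrite (_ : (fun y => _) = fun y => Im (f y) + Im (g y)); first exact: sqintD.
  by apply/funext => y; rewrite !fctE; case: (f y) (g y) => [? ?] [? ?].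
Qed.

Lemma is_L2Z c f : is_L2 f -> is_L2 (c *: f).
Proof.
move=> /is_L2P[fr fi]; apply/is_L2P; split.
- rewrite (_ : (fun y => _) = fun y => Re c * Re (f y) + - (Im c * Im (f y))).
    by apply: sqintD; [exact: sqintZ|apply: sqintN; exact: sqintZ].
  by apply/funext => y; rewrite !fctE; case: (f y) c => [? ?] [? ?].
- rewrite (_ : (fun y => _) = fun y => Re c * Im (f y) + Im c * Re (f y)).
    by apply: sqintD; exact: sqintZ.
  by apply/funext => y; rewrite !fctE; case: (f y) c => [? ?] [? ?].
Qed.

Lemma is_L20 : is_L2 (0 : fn).
Proof. by apply/is_L2P; split; exact: sqint0. Qed.

Lemma is_L2N f : is_L2 f -> is_L2 (- f).
Proof. by rewrite -scaleN1r => /(is_L2Z (-1)). Qed.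

Lemma is_L2B f g : is_L2 f -> is_L2 g -> is_L2 (f - g).
Proof. by move=> f2 /is_L2N; exact: is_L2D. Qed.

Lemma is_L2_sum I (s : seq I) (P : pred I) (F : I -> fn) :
  (forall i, P i -> is_L2 (F i)) -> is_L2 (\sum_(i <- s | P i) F i).
Proof. by move=> HF; elim/big_ind: _ => //; [exact: is_L20|exact: is_L2D]. Qed.

Lemma l2dotC f g : is_L2 f -> is_L2 g -> l2dot g f = (l2dot f g)^*%C.
Proof.
move=> f2 g2; rewrite !l2dotE//=; congr Complex.
- by congr (_ + _); apply: eq_Rintegral => y _; rewrite mulrC.
- by rewrite opprB; congr (_ - _); apply: eq_Rintegral => y _; rewrite mulrC.
Qed.

Lemma l2dotDl f g h : is_L2 f -> is_L2 g -> is_L2 h ->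
  l2dot (f + g) h = l2dot f h + l2dot g h.
Proof.
move=> f2 g2 h2; rewrite !l2dotE//; last exact: is_L2D.
move: f2 g2 h2 => /is_L2P[fr fi] /is_L2P[gr gi] /is_L2P[hr hi].
have D (a b c : 'rV[R]_n -> R) : sqint a -> sqint b -> sqint c ->
    \int[leb]_y ((a y + b y) * c y) =
    \int[leb]_y (a y * c y) + \int[leb]_y (b y * c y).
  move=> sa sb sc; rewrite -RintegralD//; [|exact: sqintM|exact: sqintM].
  by apply: eq_Rintegral => y _; rewrite mulrDl.
rewrite [LHS](_ : _ = Complex
  (\int[leb]_y ((Re (f y) + Re (g y)) * Re (h y)) +
   \int[leb]_y ((Im (f y) + Im (g y)) * Im (h y)))
  (\int[leb]_y ((Im (f y) + Im (g y)) * Re (h y)) -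
   \int[leb]_y ((Re (f y) + Re (g y)) * Im (h y)))); last first.
  by congr (Complex (_ + _) (_ - _)); apply: eq_Rintegral => y _;
    rewrite !fctE; case: (f y) (g y) => [? ?] [? ?].
rewrite !D//; apply/eqP; rewrite eq_complex/=; apply/andP; split; apply/eqP; ring.
Qed.

Lemma l2dotZl c f h : is_L2 f -> is_L2 h -> l2dot (c *: f) h = c * l2dot f h.
Proof.
move=> f2 h2; rewrite !l2dotE//; last exact: is_L2Z.
move: f2 h2 => /is_L2P[fr fi] /is_L2P[hr hi].
have Z (a b : 'rV[R]_n -> R) k : sqint a -> sqint b ->
    \int[leb]_y (k * a y * b y) = k * \int[leb]_y (a y * b y).
  move=> sa sb; rewrite -RintegralZl//; last exact: sqintM.
  by apply: eq_Rintegral => y _; rewrite mulrA.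
case: c => p q.
have E k l (a b c : 'rV[R]_n -> R) : sqint a -> sqint b -> sqint c ->
    \int[leb]_y ((k * a y + l * b y) * c y) =
    k * \int[leb]_y (a y * c y) + l * \int[leb]_y (b y * c y).
  move=> sa sb sc; rewrite -!Z// -RintegralD//;
    [|by apply: sqintM => //; exact: sqintZ|by apply: sqintM => //; exact: sqintZ].
  by apply: eq_Rintegral => y _; rewrite mulrDl.
rewrite [LHS](_ : _ = Complex
  (\int[leb]_y ((p * Re (f y) + (- q) * Im (f y)) * Re (h y)) +
   \int[leb]_y ((p * Im (f y) + q * Re (f y)) * Im (h y)))
  (\int[leb]_y ((p * Im (f y) + q * Re (f y)) * Re (h y)) -
   \int[leb]_y ((p * Re (f y) + (- q) * Im (f y)) * Im (h y)))); last first.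
  by congr (Complex (_ + _) (_ - _)); apply: eq_Rintegral => y _;
    rewrite !fctE; case: (f y) => [? ?] /=; rewrite ?mulNr.
rewrite !E//; apply/eqP; rewrite eq_complex/=; apply/andP; split; apply/eqP; ring.
Qed.

End L2basics.

(** * Orthonormal families in L2 *)

Section Hilbert.
Context {R : realType} {n : nat}.
Local Notation leb := (lebesgue_rV R n).
Local Notation fn := ('rV[R]_n -> R[i]).
Local Notation Re := complex.Re.
Local Notation Im := complex.Im.
Local Notation normc := Normc.normc.
Implicit Types (f g h w e : fn) (c : R[i]) (s bs : seq fn).

Lemma conjcM (a b : R[i]) : conjc (a * b) = conjc a * conjc b.
Proof. exact: rmorphM. Qed.

Lemma conjcD (a b : R[i]) : conjc (a + b) = conjc a + conjc b.
Proof. exact: rmorphD. Qed.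

Lemma conjcB (a b : R[i]) : conjc (a - b) = conjc a - conjc b.
Proof. exact: rmorphB. Qed.

Lemma normcJ (a : R[i]) : normc a^*%C = normc a.
Proof. by case: a => a b /=; rewrite sqrrN. Qed.

Lemma mulcJ (a : R[i]) : a * a^*%C = (normc a ^+ 2)%:C%C.
Proof.
rewrite normc_sqr; case: a => a b; apply/eqP; rewrite eq_complex/=.
by apply/andP; split; apply/eqP; ring.
Qed.

Lemma normcR (a : R) : normc a%:C%C = `|a|.
Proof. by rewrite /= expr0n/= addr0 sqrtr_sqr. Qed.

Lemma normc_eq0 (a : R[i]) : (normc a == 0) = (a == 0).
Proof.
apply/eqP/eqP => [|->]; last by rewrite /= expr0n/= addr0 sqrtr0.
exact: Normc.eq0_normc.
Qed.

Lemma normc_ReIm (z : R[i]) : normc z <= `|Re z| + `|Im z|.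
Proof.
rewrite -(@ler_pXn2r _ 2)// ?nnegrE ?normc_ge0 ?addr_ge0// normc_sqr.
rewrite -(real_normK (num_real (Re z))) -(real_normK (num_real (Im z))).
have := normr_ge0 (Re z); have := normr_ge0 (Im z); nra.
Qed.

Lemma Re_le_normc (z : R[i]) : `|Re z| <= normc z.
Proof.
rewrite -(@ler_pXn2r _ 2)// ?nnegrE ?normc_ge0// normc_sqr.
by rewrite -(real_normK (num_real (Re z))) lerDl sqr_ge0.
Qed.

Lemma Im_le_normc (z : R[i]) : `|Im z| <= normc z.
Proof.
rewrite -(@ler_pXn2r _ 2)// ?nnegrE ?normc_ge0// normc_sqr.
by rewrite -(real_normK (num_real (Im z))) lerDr sqr_ge0.
Qed.

Lemma l2dotDr f g h : is_L2 f -> is_L2 g -> is_L2 h ->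
  l2dot h (f + g) = l2dot h f + l2dot h g.
Proof.
move=> f2 g2 h2; rewrite (l2dotC _ h2) ?l2dotDl//; last exact: is_L2D.
by rewrite conjcD -!l2dotC.
Qed.

Lemma l2dotZr c f h : is_L2 f -> is_L2 h ->
  l2dot h (c *: f) = c^*%C * l2dot h f.
Proof.
move=> f2 h2; rewrite (l2dotC _ h2) ?l2dotZl//; last exact: is_L2Z.
by rewrite conjcM -l2dotC.
Qed.

Lemma l2dotNl f h : is_L2 f -> is_L2 h -> l2dot (- f) h = - l2dot f h.
Proof. by move=> f2 h2; rewrite -scaleN1r l2dotZl// mulN1r. Qed.

Lemma l2dotBl f g h : is_L2 f -> is_L2 g -> is_L2 h ->
  l2dot (f - g) h = l2dot f h - l2dot g h.
Proof. by move=> f2 g2 h2; rewrite l2dotDl ?l2dotNl//; exact: is_L2N. Qed.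

Lemma l2dotBr f g h : is_L2 f -> is_L2 g -> is_L2 h ->
  l2dot h (f - g) = l2dot h f - l2dot h g.
Proof.
move=> f2 g2 h2; rewrite (l2dotC _ h2) ?l2dotBl//; last exact: is_L2B.
by rewrite conjcB -!l2dotC.
Qed.

Lemma l2dot0l h : is_L2 h -> l2dot 0 h = 0.
Proof. by move=> h2; rewrite -(scale0r (0 : fn)) l2dotZl ?mul0r//; exact: is_L20. Qed.

Lemma l2dot0r h : is_L2 h -> l2dot h 0 = 0.
Proof. by move=> h2; rewrite -(scale0r (0 : fn)) l2dotZr ?conjc0 ?mul0r//; exact: is_L20. Qed.

Lemma l2dot_suml I (r : seq I) (P : pred I) (F : I -> fn) h :
  (forall i, P i -> is_L2 (F i)) -> is_L2 h ->
  l2dot (\sum_(i <- r | P i) F i) h = \sum_(i <- r | P i) l2dot (F i) h.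
Proof.
move=> HF h2.
suff : is_L2 (\sum_(i <- r | P i) F i) /\
  l2dot (\sum_(i <- r | P i) F i) h = \sum_(i <- r | P i) l2dot (F i) h by case.
apply: (big_rec2 (fun (u : fn) v => is_L2 u /\ l2dot u h = v)).
  by split; [exact: is_L20|exact: l2dot0l].
move=> i u v Pi [u2 <-]; split; first by apply: is_L2D => //; exact: HF.
by rewrite l2dotDl//; exact: HF.
Qed.

Lemma l2dotff f : is_L2 f -> l2dot f f = (hnorm f ^+ 2)%:C%C.
Proof.
move=> f2; rewrite hnorm_sqr//.
have : (l2dot f f)^*%C = l2dot f f by rewrite -l2dotC.
case: (l2dot f f) => a b /= -[] b0; congr Complex; lra.
Qed.

Lemma hnorm_subZ c f g : is_L2 f -> is_L2 g ->
  hnorm (f - c *: g) ^+ 2 =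
  hnorm f ^+ 2 - 2 * Re (c^*%C * l2dot f g) + normc c ^+ 2 * hnorm g ^+ 2.
Proof.
move=> f2 g2; have cg2 := is_L2Z c g2; rewrite hnorm_sqr; last exact: is_L2B.
rewrite l2dotBl ?l2dotBr//; try exact: is_L2B.
rewrite !l2dotZr// !l2dotZl// !l2dotff// (l2dotC f2 g2).
have := mulcJ c; case: c cg2 => p q _ /=.
case: (l2dot f g) => a b /= -[]; set N := Num.sqrt _ => E _.
by rewrite -E; ring.
Qed.

Lemma hnorm0 : hnorm (0 : fn) = 0.
Proof.
apply/eqP; rewrite -sqrf_eq0 hnorm_sqr; last exact: is_L20.
by rewrite l2dot0l//; exact: is_L20.
Qed.

Lemma hnormZ c f : is_L2 f -> hnorm (c *: f) = normc c * hnorm f.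
Proof.
move=> f2; have := hnorm_subZ (- c) is_L20 f2.
rewrite sub0r scaleNr opprK hnorm0 l2dot0l// mulr0/= mulr0 expr0n/= subr0 add0r.
rewrite -exprMn => /eqP; rewrite eqrXn2 ?mulr_ge0 ?hnorm_ge0 ?normc_ge0//.
by rewrite normcN => /eqP.
Qed.

Lemma hnormN f : is_L2 f -> hnorm (- f) = hnorm f.
Proof.
move=> f2; rewrite -scaleN1r hnormZ//.
by rewrite normcN Normc.normc1 mul1r.
Qed.

Lemma cauchy_schwarz f g : is_L2 f -> is_L2 g ->
  normc (l2dot f g) <= hnorm f * hnorm g.
Proof.
move=> f2 g2; set c := l2dot f g; set N := normc c.
(* the squared norm of f - k c g; its minimum is at k = 1 / |g|^2, and any large
   k will do when g has norm 0 *)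
have key (k : R) : 0 <= hnorm f ^+ 2 - 2 * k * N ^+ 2 + k ^+ 2 * N ^+ 2 * hnorm g ^+ 2.
  have := hnorm_subZ (k%:C%C * c) f2 g2.
  rewrite Normc.normcM normcR exprMn real_normK ?num_real//.
  rewrite conjcM conjc_real -mulrA [_^*%C * _]mulrC -/c mulcJ -/N.
  rewrite -rmorphM/= => E; rewrite -mulrA -E; exact: sqr_ge0.
have N0 : 0 <= N := normc_ge0 _.
have [g0|g0] := eqVneq (hnorm g) 0.
  rewrite g0 mulr0; have [-> //|Nn0] := eqVneq N 0.
  have := key ((hnorm f ^+ 2 + 1) / N ^+ 2); rewrite g0 expr0n/= mulr0 addr0.
  rewrite -mulrA mulfVK ?expf_neq0//; have := sqr_ge0 (hnorm f); lra.
rewrite -(@ler_pXn2r _ 2)// ?nnegrE ?mulr_ge0 ?hnorm_ge0//.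
have := key (hnorm g ^- 2); rewrite exprMn.
have : 0 < hnorm g ^+ 2 by rewrite exprn_even_gt0.
move: (hnorm f ^+ 2) (hnorm g ^+ 2) (N ^+ 2) => A G B G0 H.
have E : A - 2 * G^-1 * B + G^-1 ^+ 2 * B * G = A - B / G.
  by field; rewrite gt_eqF.
by move: H; rewrite E subr_ge0 ler_pdivrMr.
Qed.

Lemma hnormD f g : is_L2 f -> is_L2 g -> hnorm (f + g) <= hnorm f + hnorm g.
Proof.
move=> f2 g2.
rewrite -(@ler_pXn2r _ 2)// ?nnegrE ?addr_ge0 ?hnorm_ge0//.
have := hnorm_subZ (-1) f2 g2; rewrite scaleN1r opprK => ->.
rewrite normcN Normc.normc1.
have := cauchy_schwarz f2 g2; have := Re_le_normc (l2dot f g).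
have -> : Re ((-1)^*%C * l2dot f g) = - Re (l2dot f g).
  rewrite (_ : conjc (-1) = -1 :> R[i]); last exact: rmorphN1.
  by rewrite mulN1r; case: (l2dot f g).
have := ler_norm (Re (l2dot f g)); nra.
Qed.

Lemma hnormB f g : is_L2 f -> is_L2 g -> hnorm (f - g) <= hnorm f + hnorm g.
Proof.
by move=> f2 g2; rewrite (le_trans (hnormD _ _)) ?hnormN//; exact: is_L2N.
Qed.

Lemma hnormBC f g : is_L2 f -> is_L2 g -> hnorm (f - g) = hnorm (g - f).
Proof. by move=> f2 g2; rewrite -hnormN ?opprB//; exact: is_L2B. Qed.

Lemma hnorm_tri f g h : is_L2 f -> is_L2 g -> is_L2 h ->
  hnorm (f - h) <= hnorm (f - g) + hnorm (g - h).
Proof.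
move=> f2 g2 h2; rewrite -[f - h](_ : (f - g) + (g - h) = _).
  by apply: hnormD; exact: is_L2B.
by rewrite addrA subrK.
Qed.

Lemma hnorm_dist f g : is_L2 f -> is_L2 g ->
  `|hnorm f - hnorm g| <= hnorm (f - g).
Proof.
move=> f2 g2; rewrite ler_norml; apply/andP; split.
  rewrite lerNl opprB lerBlDr hnormBC// -[X in hnorm X <= _](subrK f) .
  by apply: hnormD => //; exact: is_L2B.
rewrite lerBlDr -[X in hnorm X <= _](subrK g).
by apply: hnormD => //; exact: is_L2B.
Qed.

Lemma hnorm_sum I (r : seq I) (P : pred I) (F : I -> fn) :
  (forall i, P i -> is_L2 (F i)) ->
  hnorm (\sum_(i <- r | P i) F i) <= \sum_(i <- r | P i) hnorm (F i).
Proof.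
move=> HF.
suff : is_L2 (\sum_(i <- r | P i) F i) /\
  hnorm (\sum_(i <- r | P i) F i) <= \sum_(i <- r | P i) hnorm (F i) by case.
apply: (big_rec2 (fun (u : fn) v => is_L2 u /\ hnorm u <= v)).
  by split; [exact: is_L20|rewrite hnorm0].
move=> i u v Pi [u2 uv]; split; first by apply: is_L2D => //; exact: HF.
by rewrite (le_trans (hnormD _ _)) ?lerD//; exact: HF.
Qed.

Lemma l2dot_dist f g h : is_L2 f -> is_L2 g -> is_L2 h ->
  `|normc (l2dot h f) - normc (l2dot h g)| <= hnorm h * hnorm (f - g).
Proof.
move=> f2 g2 h2.
have D (a b : R[i]) : normc a - normc b <= normc (a - b).
  by rewrite lerBlDr -{1}(subrK b a) le_normcD.
have H u v : is_L2 u -> is_L2 v ->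
    normc (l2dot h u) - normc (l2dot h v) <= hnorm h * hnorm (u - v).
  move=> u2 v2; apply: (le_trans (D _ _)); rewrite -l2dotBr//.
  by apply: cauchy_schwarz => //; exact: is_L2B.
rewrite ler_norml; apply/andP; split; last exact: H.
by rewrite lerNl opprB hnormBC// H.
Qed.

Lemma hnorm_eq0 f : is_L2 f -> hnorm f = 0 <-> {ae leb, forall y, f y = 0}.
Proof.
move=> f2; have /is_L2P[[mr ir] [mi ii]] := f2.
have me : measurable_fun setT (fun y => ((Re (f y)) ^+ 2 + (Im (f y)) ^+ 2)%:E).
  by apply/measurable_EFinP; apply: measurable_funD; apply: measurable_funX.
have e : ((hnorm f ^+ 2)%:E =
    \int[leb]_y `|((Re (f y)) ^+ 2 + (Im (f y)) ^+ 2)%:E|)%E.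
  have := l2norm_sqr f; rewrite l2norm_fin// poweR_EFin powR_mulrn ?hnorm_ge0// => ->.
  by apply: eq_integral => y _; rewrite gee0_abs// lee_fin addr_ge0 ?sqr_ge0.
have z y : ((Re (f y)) ^+ 2 + (Im (f y)) ^+ 2)%:E = 0%E :> \bar R <-> f y = 0.
  split=> [[] /eqP|->]; last by rewrite /= expr0n addr0.
  rewrite paddr_eq0 ?sqr_ge0// !sqrf_eq0 => /andP[/eqP a /eqP b].
  by apply/eqP; rewrite eq_complex a b/= eqxx.
rewrite [X in _ <-> X](_ : _ = ae_eq leb setT
  (fun y => ((Re (f y)) ^+ 2 + (Im (f y)) ^+ 2)%:E) (cst 0%E)); last first.
  rewrite /ae_eq; congr (\forall y \ae _, _); apply/funext => y.
  by apply/propext; split=> [/z ?|/(_ I) /z]//.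
rewrite -ae_eq_integral_abs// -e; split=> [->|[] /eqP].
  by rewrite expr0n.
by rewrite sqrf_eq0 => /eqP.
Qed.

(** ** Orthonormal lists and residuals *)

Definition orthonormal s := (forall i, (i < size s)%N -> is_L2 (nth 0 s i)) /\
  forall i j, (i < size s)%N -> (j < size s)%N ->
    l2dot (nth 0 s i) (nth 0 s j) = (i == j)%:R.

Definition proj s w : fn := \sum_(i < size s) l2dot w (nth 0 s i) *: nth 0 s i.

Lemma gs_residualE s w : gs_residual s w = w - proj s w.
Proof.
apply/funext => y; rewrite /gs_residual /proj.
rewrite (big_nth 0) big_mkord.
by rewrite !fctE fct_sumE.
Qed.

Section onb.
Variables (s : seq fn) (os : orthonormal s).

Let s2 (i : 'I_(size s)) : is_L2 (nth 0 s i). Proof. exact: os.1. Qed.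

Lemma proj_L2 w : is_L2 (proj s w).
Proof. by apply: is_L2_sum => i _; exact: is_L2Z. Qed.

Lemma res_L2 w : is_L2 w -> is_L2 (gs_residual s w).
Proof. by move=> w2; rewrite gs_residualE; apply: is_L2B => //; exact: proj_L2. Qed.

Lemma dot_comb (a : 'I_(size s) -> R[i]) (j : 'I_(size s)) :
  l2dot (\sum_i a i *: nth 0 s i) (nth 0 s j) = a j.
Proof.
rewrite l2dot_suml//; last by move=> i _; exact: is_L2Z.
rewrite (bigD1 j)//= big1 ?addr0; last first.
  move=> i ij; rewrite l2dotZl// os.2//.
  by rewrite (_ : (i == j :> nat) = false) ?mulr0//; exact/negbTE.
by rewrite l2dotZl// os.2// eqxx mulr1.
Qed.

Lemma dot_res w (j : 'I_(size s)) : is_L2 w ->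
  l2dot (gs_residual s w) (nth 0 s j) = 0.
Proof.
move=> w2; rewrite gs_residualE l2dotBl//; last exact: proj_L2.
by rewrite /proj dot_comb subrr.
Qed.

Lemma res_comb (a : 'I_(size s) -> R[i]) :
  gs_residual s (\sum_i a i *: nth 0 s i) = 0.
Proof.
rewrite gs_residualE; apply/eqP; rewrite subr_eq0; apply/eqP.
by apply: eq_bigr => i _; rewrite dot_comb.
Qed.

Lemma resD f g : is_L2 f -> is_L2 g ->
  gs_residual s (f + g) = gs_residual s f + gs_residual s g.
Proof.
move=> f2 g2; rewrite !gs_residualE addrACA -opprD; congr (_ - _).
rewrite /proj -big_split/=; apply: eq_bigr => i _.
by rewrite l2dotDl// scalerDl.
Qed.

Lemma resZ c f : is_L2 f -> gs_residual s (c *: f) = c *: gs_residual s f.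
Proof.
move=> f2; rewrite !gs_residualE scalerBr; congr (_ - _).
by rewrite /proj scaler_sumr; apply: eq_bigr => i _; rewrite l2dotZl// scalerA.
Qed.

Lemma resB f g : is_L2 f -> is_L2 g ->
  gs_residual s (f - g) = gs_residual s f - gs_residual s g.
Proof.
move=> f2 g2; rewrite resD//; last exact: is_L2N.
by rewrite -scaleN1r resZ// scaleN1r.
Qed.

Lemma dot_res_comb w (a : 'I_(size s) -> R[i]) : is_L2 w ->
  l2dot (gs_residual s w) (\sum_i a i *: nth 0 s i) = 0.
Proof.
move=> w2; rewrite l2dotC ?l2dot_suml//; last exact: res_L2.
- rewrite big1 ?conjc0// => i _; have r2 := res_L2 w2.
  by rewrite l2dotZl// (l2dotC r2)// dot_res// conjc0 mulr0.
- by move=> i _; exact: is_L2Z.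
- exact: res_L2.
- by apply: is_L2_sum => i _; exact: is_L2Z.
Qed.

Lemma dot_resl f g : is_L2 f -> is_L2 g ->
  l2dot (gs_residual s f) (gs_residual s g) = l2dot (gs_residual s f) g.
Proof.
move=> f2 g2; rewrite [X in l2dot _ X]gs_residualE l2dotBr//;
  [|exact: proj_L2|exact: res_L2].
by rewrite dot_res_comb// subr0.
Qed.

Lemma dot_resC f g : is_L2 f -> is_L2 g ->
  l2dot (gs_residual s f) g = l2dot f (gs_residual s g).
Proof.
move=> f2 g2; rewrite -dot_resl//.
have rf := res_L2 f2; have rg := res_L2 g2.
by rewrite (l2dotC rg)// dot_resl// -(l2dotC rg).
Qed.

Lemma hnorm_comb (a : 'I_(size s) -> R[i]) :
  hnorm (\sum_i a i *: nth 0 s i) ^+ 2 = \sum_i normc (a i) ^+ 2.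
Proof.
have L : is_L2 (\sum_i a i *: nth 0 s i).
  by apply: is_L2_sum => i _; exact: is_L2Z.
apply: complexI; rewrite -l2dotff// {1}l2dot_suml//; last by move=> i _; exact: is_L2Z.
rewrite rmorph_sum/=; apply: eq_bigr => i _.
by rewrite l2dotZl// (l2dotC L)// dot_comb mulcJ.
Qed.

Lemma hnorm_res w : is_L2 w -> hnorm w ^+ 2 =
  hnorm (gs_residual s w) ^+ 2 + \sum_(i < size s) normc (l2dot w (nth 0 s i)) ^+ 2.
Proof.
move=> w2; rewrite -hnorm_comb -/(proj s w).
have p2 := proj_L2 w; have r2 := res_L2 w2.
have := @hnorm_subZ (-1) _ _ r2 p2; rewrite scaleN1r opprK.
rewrite {1}gs_residualE subrK => ->.
by rewrite normcN Normc.normc1 expr1n mul1r dot_res_comb// mulr0/= mulr0 subr0.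
Qed.

Lemma hnorm_res_le w : is_L2 w -> hnorm (gs_residual s w) <= hnorm w.
Proof.
move=> w2; rewrite -(@ler_pXn2r _ 2)// ?nnegrE ?hnorm_ge0//.
by rewrite (hnorm_res w2) lerDl sumr_ge0// => i _; exact: sqr_ge0.
Qed.

Lemma res_in_span w : is_L2 w -> hnorm (gs_residual s w) = 0 <-> in_span s w.
Proof.
move=> w2; split.
  move=> /(hnorm_eq0 (res_L2 w2)) r0; exists (fun i => l2dot w (nth 0 s i)).
  apply: filterS r0 => y; rewrite gs_residualE /proj !fctE fct_sumE => /eqP.
  by rewrite subr_eq0 => /eqP.
move=> [a wa]; pose g : fn := \sum_i a i *: nth 0 s i.
have g2 : is_L2 g by apply: is_L2_sum => i _; exact: is_L2Z.
have wg : hnorm (w - g) = 0.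
  apply/hnorm_eq0; first exact: is_L2B.
  apply: filterS wa => y; rewrite /g !fctE fct_sumE => ->.
  by rewrite subrr.
have -> : gs_residual s w = gs_residual s (w - g).
  by rewrite resB// /g res_comb subr0.
apply/eqP; rewrite eq_le hnorm_ge0 andbT -wg.
by apply: hnorm_res_le; exact: is_L2B.
Qed.

Lemma gs_stepE w : gs_step s w =
  ((hnorm (gs_residual s w))^-1)%:C%C *: gs_residual s w.
Proof. by []. Qed.

Lemma gs_step_L2 w : is_L2 w -> is_L2 (gs_step s w).
Proof. by move=> w2; rewrite gs_stepE; apply: is_L2Z; exact: res_L2. Qed.

Lemma hnorm_gs_step w : is_L2 w -> hnorm (gs_residual s w) != 0 ->
  hnorm (gs_step s w) = 1.
Proof.
move=> w2 r0; rewrite gs_stepE hnormZ; last exact: res_L2.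
by rewrite normcR ger0_norm ?invr_ge0 ?hnorm_ge0// mulVf.
Qed.

Lemma hnorm_gs_step_le w : is_L2 w -> hnorm (gs_step s w) <= 1.
Proof.
move=> w2; have [r0|r0] := eqVneq (hnorm (gs_residual s w)) 0.
  by rewrite gs_stepE r0 invr0 hnormZ ?r0 ?mulr0//; exact: res_L2.
by rewrite hnorm_gs_step.
Qed.

Lemma dot_gs_step w (j : 'I_(size s)) : is_L2 w ->
  l2dot (gs_step s w) (nth 0 s j) = 0.
Proof.
by move=> w2; rewrite gs_stepE l2dotZl ?dot_res ?mulr0//; exact: res_L2.
Qed.

Lemma orthonormal_rcons w : is_L2 w -> hnorm (gs_residual s w) != 0 ->
  orthonormal (rcons s (gs_step s w)).
Proof.
move=> w2 r0; have st2 := gs_step_L2 w2; split.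
  move=> i; rewrite size_rcons ltnS nth_rcons; case: ltngtP => // il _.
  by apply: (s2 (Ordinal il)).
have d0 i : (i < size s)%N -> l2dot (gs_step s w) (nth 0 s i) = 0.
  by move=> il; exact: (dot_gs_step (Ordinal il)).
move=> i j; rewrite size_rcons !ltnS !nth_rcons => + +.
case: ltngtP => // il _; case: ltngtP => // jl _.
- exact: os.2.
- rewrite l2dotC//; last exact: (s2 (Ordinal il)).
  by rewrite d0// conjc0 jl ltn_eqF.
- by rewrite d0// il gtn_eqF.
- by rewrite l2dotff// hnorm_gs_step// expr1n il jl eqxx.
Qed.

End onb.

(** Enlarging an orthonormal list shrinks residuals. *)
Lemma hnorm_res_cat s s' w : orthonormal (s ++ s') -> is_L2 w ->
  hnorm (gs_residual (s ++ s') w) <= hnorm (gs_residual s w).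
Proof.
move=> o w2.
have os : orthonormal s.
  split=> [i il|i j il jl].
    by have := o.1 i; rewrite nth_cat il size_cat; apply; rewrite ltn_addr.
  by have := o.2 i j; rewrite !nth_cat il jl size_cat; apply; rewrite ltn_addr.
rewrite -(@ler_pXn2r _ 2)// ?nnegrE ?hnorm_ge0//.
have := hnorm_res os w2; rewrite (hnorm_res o w2) size_cat big_split_ord/=.
under eq_bigr do rewrite nth_cat ltn_ord.
set A := \sum_i _; set B := \sum_i _.
have : 0 <= B by apply: sumr_ge0 => i _; exact: sqr_ge0.
lra.
Qed.

(** ** Linear span *)

(** Spans of functions, not of their classes modulo null sets: the multiple
    kernels are prescribed functions. *)
Inductive lspan (P : fn -> Prop) : fn -> Prop :=
| lspan0 : lspan P 0
| lspanDZ c f g : P f -> lspan P g -> lspan P (c *: f + g).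

Lemma lspan_gen P f : P f -> lspan P f.
Proof. by move=> Pf; rewrite -[f]scale1r -[_ *: f]addr0; exact/lspanDZ/lspan0. Qed.

Lemma lspanD P f g : lspan P f -> lspan P g -> lspan P (f + g).
Proof.
elim=> [|c u v Pu _ IH] Pg; first by rewrite add0r.
by rewrite -addrA; exact/lspanDZ/IH.
Qed.

Lemma lspanZ P c f : lspan P f -> lspan P (c *: f).
Proof.
elim=> [|a u v Pu _ IH]; first by rewrite scaler0; exact: lspan0.
by rewrite scalerDr scalerA; exact: lspanDZ.
Qed.

Lemma lspanB P f g : lspan P f -> lspan P g -> lspan P (f - g).
Proof. by move=> Pf Pg; rewrite -scaleN1r; apply: lspanD => //; exact: lspanZ. Qed.

Lemma lspan_sum P I (r : seq I) (Q : pred I) (F : I -> fn) :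
  (forall i, Q i -> lspan P (F i)) -> lspan P (\sum_(i <- r | Q i) F i).
Proof. by move=> H; elim/big_ind: _ => //; [exact: lspan0|exact: lspanD]. Qed.

Lemma lspan_sub P Q f : (forall g, P g -> lspan Q g) -> lspan P f -> lspan Q f.
Proof.
move=> PQ; elim=> [|a u v Pu _ IH]; first exact: lspan0.
by apply: lspanD => //; apply: lspanZ; exact: PQ.
Qed.

(** Membership by position, as equality of functions is not decidable. *)
Definition ins s f := exists2 i, (i < size s)%N & nth 0 s i = f.

Lemma lspan_gs_step (P : fn -> Prop) s w :
  (forall e, ins s e -> lspan P e) -> lspan P w -> lspan P (gs_step s w).
Proof.
move=> sP wP; rewrite gs_stepE gs_residualE; apply: lspanZ; apply: lspanB => //.
by apply: lspan_sum => i _; apply: lspanZ; apply: sP; exists i.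
Qed.

(** Gram-Schmidt: any finite family can be absorbed by enlarging an
    orthonormal list within the span. *)
Lemma orthonormal_extend s bs : orthonormal s ->
  (forall b, ins bs b -> is_L2 b) ->
  exists s', [/\ orthonormal (s ++ s'),
    forall b, ins bs b -> hnorm (gs_residual (s ++ s') b) = 0 &
    forall e, ins s' e -> lspan (fun g => ins s g \/ ins bs g) e].
Proof.
move=> os; elim/last_ind: bs => [|bs b IH] b2.
  by exists [::]; rewrite cats0; split=> [//|b [i ] //|e [i ] //].
have [|s' [os' rs' ss']] := IH.
  move=> c [i il ci]; apply: b2.
  by exists i; rewrite ?size_rcons ?nth_rcons ?il// ltnW.
have Lb : is_L2 b.
  by apply: b2; exists (size bs); rewrite ?size_rcons// nth_rcons ltnn eqxx.
have insb (c : fn) : ins (rcons bs b) c -> ins bs c \/ c = b.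
  move=> [i ]; rewrite size_rcons ltnS nth_rcons; case: ltngtP => // il _ <-.
    by left; exists i.
  by right.
have [r0|r0] := eqVneq (hnorm (gs_residual (s ++ s') b)) 0.
  exists s'; split=> [//|c /insb[/rs'|->]//|e /ss'].
  apply: lspan_sub => g [|[i il gi]]; first by move=> ?; apply: lspan_gen; left.
  apply: lspan_gen; right; exists i; first by rewrite size_rcons ltnW.
  by rewrite nth_rcons il.
have oe := orthonormal_rcons os' Lb r0.
exists (rcons s' (gs_step (s ++ s') b)); rewrite -rcons_cat; split => //.
- move=> c; have cc := oe; move: cc; rewrite -cats1 => cc /insb[cbs|->].
    have c2 : is_L2 c.
      by case: cbs => i il ci; apply: b2; exists i; rewrite ?size_rcons ?nth_rcons ?il// ltnW.
    apply/eqP; rewrite eq_le hnorm_ge0 andbT -(rs' _ cbs).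
    exact: hnorm_res_cat.
  apply/(res_in_span cc Lb).
  pose S := s ++ s'; rewrite -/S in cc r0 *.
  pose N := hnorm (gs_residual S b); rewrite -/N in r0.
  pose a i := if (i < size S)%N then l2dot b (nth 0 S i)
              else N%:C%C.
  exists (fun i => a i); apply: aeW => y; rewrite size_cat big_split_ord/= big_ord1/=.
  under eq_bigr => i _ do rewrite /a ltn_ord nth_cat ltn_ord.
  rewrite /a addn0 ltnn nth_cat ltnn subnn/= gs_stepE -/N gs_residualE /proj.
  rewrite !fctE fct_sumE mulrA -rmorphM/= mulfV// rmorph1 mul1r.
  by rewrite addrC subrK.
- have sub g : ins s g \/ ins bs g -> lspan (fun g => ins s g \/ ins (rcons bs b) g) g.
    move=> [|[i il gi]]; first by move=> ?; apply: lspan_gen; left.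
    apply: lspan_gen; right; exists i; first by rewrite size_rcons ltnW.
    by rewrite nth_rcons il.
  move=> e [i ]; rewrite size_rcons ltnS nth_rcons; case: ltngtP => // il _ <-.
    by apply: lspan_sub (ss' _ _); [exact: sub|exists i].
  apply: lspan_gs_step; last first.
    apply: lspan_gen; right; exists (size bs); first by rewrite size_rcons.
    by rewrite nth_rcons ltnn eqxx.
  move=> u [j]; rewrite size_cat nth_cat; case: (ltnP j (size s)) => [js _ <-|sj jl <-].
    by apply: lspan_gen; left; exists j.
  apply: lspan_sub (ss' _ _); first exact: sub.
  by exists (j - size s)%N => //; rewrite ltn_subLR.
Qed.

End Hilbert.

(** * The Gamma function is positive *)

Section GammaPositive.
Context {R : realType}.
Local Notation mu := (@lebesgue_measure R).
Variable s : R.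
Hypothesis s0 : 0 < s.

Let integrand (x : R) := x `^ (s - 1) * expR (- x).
(** A comparison function with an explicit primitive: it is of order
    [x `^ (s - 1)] near 0, like the integrand, and decays like a power at
    infinity. *)
Let dom (x : R) := x `^ (s - 1) / (1 + x `^ s) ^+ 2.
Let prim (x : R) := - (s * (1 + x `^ s))^-1.

Let den_gt0 x : 0 < 1 + x `^ s.
Proof. by rewrite ltr_pwDl// powR_ge0. Qed.

Let integrand_ge0 x : 0 <= integrand x.
Proof. by rewrite mulr_ge0 ?powR_ge0 ?expR_ge0. Qed.

Let m_integrand : measurable_fun setT integrand.
Proof.
apply: measurable_funM; first exact: measurable_powR.
by apply: measurableT_comp => //; exact: measurable_funN.
Qed.

Let is_derive_prim (x : R) : 0 < x -> is_derive x 1 prim (dom x).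
Proof.
move=> x0; have dx := is_derive1_powR s x0.
have den0 : s * (1 + x `^ s) != 0 by rewrite mulf_neq0// gt_eqF.
rewrite /prim /dom; apply: is_derive_eq.
rewrite /GRing.scale/=.
have := den_gt0 x; move=> /gt_eqF/negbT d0; have := s0 => /gt_eqF/negbT sn0.
by field; rewrite d0 sn0.
Qed.

Let dom_continuous (x : R) : 0 < x -> {for x, continuous dom}.
Proof.
move=> x0; have dx := is_derive1_powR s x0.
have dx1 := is_derive1_powR (s - 1) x0.
have den0 : (1 + x `^ s) ^+ 2 != 0 by rewrite sqrf_eq0 gt_eqF.
have : derivable dom x 1 by rewrite /dom; apply: ex_derive.
by move=> /derivable1_diffP/differentiable_continuous.
Qed.

Let integral_dom (a b : R) : 0 < a -> a < b ->
  (\int[mu]_(x in `[a, b]) (dom x)%:E <= s^-1%:E)%E.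
Proof.
move=> a0 ab; have b0 := lt_trans a0 ab.
have cprim x : 0 < x -> {for x, continuous prim}.
  move=> x0; have := is_derive_prim x0 => -[+ _].
  by move=> /derivable1_diffP/differentiable_continuous.
rewrite (@continuous_FTC2 _ dom prim)//.
- rewrite -EFinB lee_fin /prim opprK.
  rewrite (@le_trans _ _ ((s * (1 + a `^ s))^-1))//.
    by rewrite gerDr oppr_le0 invr_ge0 mulr_ge0// ltW.
  rewrite lef_pV2 ?posrE ?mulr_gt0// ler_peMr//; first exact: ltW.
  by rewrite lerDl powR_ge0.
- apply: continuous_in_subspaceT => x; rewrite inE/= in_itv/= => /andP[ax _].
  by apply: dom_continuous; exact: lt_le_trans ax.
- split.
  + move=> x; rewrite in_itv/= => /andP[ax _].
    by have [] := is_derive_prim (lt_trans a0 ax).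
  + by apply: cvg_at_right_filter; exact: cprim.
  + by apply: cvg_at_left_filter; exact: cprim.
- move=> x; rewrite in_itv/= => /andP[ax _]; rewrite derive1E.
  by have [_ ->] := is_derive_prim (lt_trans a0 ax).
Qed.

Let C := 2 * (1 + (2 * s) `^ (2 * s)).

(** The exponential dominates [x `^ (2 * s)], because [ln u <= u] at
    [u = x / (2 * s)]. *)
Let integrand_le_dom (x : R) : 0 < x -> integrand x <= C * dom x.
Proof.
move=> x0.
have s20 : 0 < 2 * s by rewrite mulr_gt0.
have xs : x `^ s ^+ 2 <= expR x * (2 * s) `^ (2 * s).
  rewrite -powR_mulrn ?powR_ge0// -powRrM mulrC /powR gt_eqF// gt_eqF//.
  rewrite -expRD ler_expR; have xe : x = x / (2 * s) * (2 * s).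
    by rewrite mulfVK// gt_eqF.
  rewrite {1}xe lnM ?posrE ?divr_gt0// mulrDr lerD2r.
  rewrite [leRHS]xe [leRHS]mulrC ler_pM2l//.
  by apply/ltW/ln_sublinear; rewrite divr_gt0.
have key : expR (- x) <= C / (1 + x `^ s) ^+ 2.
  rewrite ler_pdivlMr ?exprn_gt0// expRN ler_pdivrMl ?expR_gt0//.
  have : 1 <= expR x by rewrite -expR0 ler_expR ltW.
  rewrite /C; have := sqr_ge0 (1 - x `^ s); nra.
rewrite /integrand /dom; have := powR_ge0 x (s - 1); nra.
Qed.

Let F (k : nat) : set R := `[(k.+1%:R)^-1, k.+2%:R].

Let F_gt0 k : 0 < (k.+1%:R)^-1 :> R. Proof. by rewrite invr_gt0. Qed.

Let integral_F k : (\int[mu]_(x in F k) (integrand x)%:E <= (C * s^-1)%:E)%E.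
Proof.
have F1 : (k.+1%:R)^-1 < k.+2%:R :> R.
  by rewrite (@le_lt_trans _ _ 1)// ?invf_le1 ?ler1n ?ltr1n.
have C0 : 0 <= C by rewrite mulr_ge0// addr_ge0// powR_ge0.
rewrite EFinM; apply: le_trans (lee_wpmul2l _ (integral_dom (F_gt0 k) F1)); last first.
  by rewrite lee_fin.
have dom0 x : 0 <= dom x by rewrite divr_ge0 ?powR_ge0 ?sqr_ge0.
have mdom : measurable_fun (F k) dom.
  apply: subspace_continuous_measurable_fun; first exact: measurable_itv.
  apply: continuous_in_subspaceT => x; rewrite inE /F/= in_itv/= => /andP[ax _].
  by apply: dom_continuous; exact: lt_le_trans ax.
rewrite -ge0_integralZl//; last 2 first.
- exact/measurable_EFinP.
- by move=> x _; rewrite lee_fin.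
apply: ge0_le_integral.
- exact: measurable_itv.
- by move=> x _; rewrite lee_fin.
- by apply/measurable_EFinP; exact: measurable_funTS.
- by apply/measurable_EFinP; exact: measurable_funM.
- move=> x; rewrite /F/= in_itv/= => /andP[ax _]; rewrite -EFinM lee_fin.
  by apply: integrand_le_dom; exact: lt_le_trans ax.
Qed.

(** Finiteness matters as much as positivity: a real-valued integral that
    diverges is 0. *)
Lemma Gamma_gt0 : 0 < Gamma s.
Proof.
have fin : (\int[mu]_(x in `]0%R, +oo[) (integrand x)%:E <= (C * s^-1)%:E)%E.
  have -> : `]0%R, +oo[%classic = \bigcup_k F k.
    apply/seteqP; split=> x /=; rewrite in_itv/= andbT.
      move=> x0; have [k kx] : exists k : nat, x <= k%:R /\ x^-1 <= k%:R.
        exists (maxn (Num.trunc x).+1 (Num.trunc x^-1).+1); split.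
        - by rewrite (le_trans (ltW (truncnS_gt x)))// ler_nat leq_maxl.
        - by rewrite (le_trans (ltW (truncnS_gt x^-1)))// ler_nat leq_maxr.
      exists k => //; rewrite /F/= in_itv/=; apply/andP; split.
        rewrite -[leRHS]invrK lef_pV2 ?posrE ?invr_gt0 ?ltr0n//.
        by rewrite (le_trans kx.2)// ler_nat.
      by rewrite (le_trans kx.1)// ler_nat ltnW.
    by move=> [k _]; rewrite /F/= in_itv/= => /andP[kx _]; exact: lt_le_trans kx.
  have cv : (\int[mu]_(x in F k) (integrand x)%:E @[k --> \oo] -->
      \int[mu]_(x in \bigcup_k F k) (integrand x)%:E)%E.
    apply: ge0_nondecreasing_set_cvg_integral.
    - apply/nondecreasing_seqP => k; rewrite subsetEset /F => x /=.
      rewrite !in_itv/= => /andP[a b]; apply/andP; split.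
        by rewrite (le_trans _ a)// lef_pV2 ?posrE ?ltr0n// ler_nat.
      by rewrite (le_trans b)// ler_nat.
    - by move=> k; exact: measurable_itv.
    - by move=> k; apply/measurable_EFinP; exact: measurable_funTS.
    - by move=> k x _; rewrite lee_fin.
  rewrite -(cvg_lim _ cv)//; apply: lime_le; first by apply/cvg_ex; eexists; exact: cv.
  by apply: nearW => k; exact: integral_F.
have pos : ((2^-1 * expR (- 2))%:E <= \int[mu]_(x in `]0%R, +oo[) (integrand x)%:E)%E.
  have i1 : (\int[mu]_(x in `[1%R, 2%R]) (2^-1 * expR (- 2))%:E)%E = (2^-1 * expR (- 2))%:E.
    rewrite integral_cst//= lebesgue_measure_itv/= lte_fin ltr1n -EFinB -EFinM.
    by rewrite (_ : 2 - 1 = 1 :> R) ?mulr1//; lra.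
  have i2 : (\int[mu]_(x in `[1%R, 2%R]) (2^-1 * expR (- 2))%:E <=
             \int[mu]_(x in `[1%R, 2%R]) (integrand x)%:E)%E.
    apply: ge0_le_integral.
    - exact: measurable_itv.
    - by move=> x _; rewrite lee_fin mulr_ge0 ?expR_ge0// invr_ge0.
    - exact: measurable_cst.
    - by apply/measurable_EFinP; exact: measurable_funTS.
    - move=> x; rewrite /= in_itv/= => /andP[x1 x2]; rewrite lee_fin.
      apply: ler_pM; rewrite ?expR_ge0 ?invr_ge0 ?ler_expR ?lerN2//.
      rewrite (@le_trans _ _ (x `^ (- 1)))//; last first.
        by apply: ler_powR => //; rewrite -subr_ge0 opprK subrK ltW.
      have x0 : 0 < x by lra.
      by rewrite powR_inv1 ?(ltW x0)// lef_pV2 ?posrE.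
  rewrite -i1; apply: (le_trans i2); apply: ge0_subset_integral.
  - exact: measurable_itv.
  - exact: measurable_itv.
  - by apply/measurable_EFinP; exact: measurable_funTS.
  - by move=> x _; rewrite lee_fin.
  - move=> x; rewrite /= !in_itv/= => /andP[x1 _]; rewrite andbT.
    exact: lt_le_trans x1.
rewrite /Gamma /Rintegral fine_gt0//; apply/andP; split.
  by apply: lt_le_trans pos; rewrite lte_fin mulr_gt0 ?invr_gt0 ?expR_gt0.
by apply: le_lt_trans fin _; rewrite ltry.
Qed.

End GammaPositive.

Lemma poisson_const_gt0 {R : realType} n (sigma : R) : 0 < sigma ->
  0 < poisson_const n sigma.
Proof.
move=> s0; rewrite /poisson_const divr_gt0 ?mulr_gt0 ?powR_gt0 ?pi_gt0//.
- by apply: Gamma_gt0; rewrite divr_gt0// ltr_wpDl.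
- by apply: Gamma_gt0; rewrite divr_gt0.
Qed.

(** * The fractional Poisson kernels are square integrable *)

Section KernelL2.
Context {R : realType}.

Lemma integral_oneDsqrV_lty :
  (\int[@lebesgue_measure R]_x ((oneDsqr x)^-1)%:E < +oo)%E.
Proof.
rewrite (@ge0_symfun_integralT R (fun x => (oneDsqr x)^-1)).
- rewrite [X in (2%:E * X)%E](_ : _ = (pi / 2)%:E); first by rewrite -EFinM ltry.
  by rewrite -integral0y_oneDsqr set_itvcy.
- by move=> x; rewrite invr_ge0.
- exact: continuous_oneDsqrV.
- by move=> x /=; rewrite /oneDsqr sqrrN.
Qed.

Lemma measurable_oneDsqrV_coord n (i : 'I_n) :
  measurable_fun setT (fun y : 'rV[R]_n => (oneDsqr (y ord0 i))^-1).
Proof.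
apply: (@measurableT_comp _ _ _ _ _ _ (fun x : R => (oneDsqr x)^-1)).
  by apply: continuous_measurable_fun; exact: continuous_oneDsqrV.
exact: measurable_rV_coord.
Qed.

(** Tonelli, one coordinate at a time. *)
Lemma integral_prod_oneDsqrV_lty n :
  (\int[lebesgue_rV R n]_y (\prod_(i < n) (oneDsqr (y ord0 i))^-1)%:E < +oo)%E.
Proof.
elim: n => [|n IH].
  under eq_integral do rewrite big_ord0.
  by rewrite integral_cst//= mul1e diracT ltry.
pose G m (y : 'rV[R]_m) := (\prod_(i < m) (oneDsqr (y ord0 i))^-1)%:E.
have mG m : measurable_fun setT (@G m).
  apply/measurable_EFinP; apply: measurable_prod => i _.
  exact: measurable_oneDsqrV_coord.
have G0 m y : (0 <= @G m y)%E.
  by rewrite lee_fin; apply: prodr_ge0 => i _; rewrite invr_ge0.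
pose f (x : R) := ((oneDsqr x)^-1)%:E.
have mf : measurable_fun setT f.
  by apply/measurable_EFinP; apply: continuous_measurable_fun;
    exact: continuous_oneDsqrV.
have f0 x : (0 <= f x)%E by rewrite lee_fin invr_ge0.
have mfG : measurable_fun setT
    (fun p : measurableTypeR R * 'rV[R]_n => (f p.1 * G n p.2)%E).
  apply: emeasurable_funM.
    exact: (measurableT_comp mf measurable_fst).
  exact: (measurableT_comp (mG n) measurable_snd).
have E := ge0_integral_pushforward (@measurable_rV_cons R n)
  (@lebesgue_measure R \x lebesgue_rV R n)%E measurableT (mG n.+1)
  (fun y _ => G0 n.+1 y).
have E3 : (\int[lebesgue_rV R n.+1]_y G n.+1 y =
    (\int[@lebesgue_measure R]_x f x) * \int[lebesgue_rV R n]_y G n y)%E.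
  transitivity (\int[(@lebesgue_measure R \x lebesgue_rV R n)%E]_x
      (G n.+1 \o rV_cons (n:=n)) x)%E.
    rewrite -[in RHS](preimage_setT (@rV_cons R n)) -E; apply: eq_measure_integral;
      [exact: measurable_rV_cons|by move=> A mA _].
  transitivity (\int[(@lebesgue_measure R \x lebesgue_rV R n)%E]_p
      (f p.1 * G n p.2))%E.
    apply: eq_integral => p _; rewrite /G/= big_ord_recl rV_cons0 EFinM.
    by congr (_ * (_)%:E)%E; apply: eq_bigr => i _; rewrite rV_consS.
  rewrite fubini_tonelli1//=; last by move=> p; exact: mule_ge0.
  rewrite /fubini_F/=.
  transitivity (\int[@lebesgue_measure R]_x (f x * \int[lebesgue_rV R n]_y G n y))%E.
    apply: eq_integral => x _; apply: ge0_integralZl => //; exact: mG.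
  by apply: ge0_integralZr => //; apply: integral_ge0.
rewrite -/(G n.+1) E3.
have i1 : (0 <= \int[@lebesgue_measure R]_x f x)%E by apply: integral_ge0.
apply: lte_mul_pinfty => //.
by rewrite ge0_fin_numE//; exact: integral_oneDsqrV_lty.
Qed.

Section quadratic.
Context {n : nat}.
Implicit Types (q : R * 'rV[R]_n) (y x : 'rV[R]_n).

Definition quad q y : R := q.1 ^+ 2 + sqnorm (q.2 - y).

Lemma sqnorm_ge0 x : 0 <= sqnorm x.
Proof. by apply: sumr_ge0 => i _; exact: sqr_ge0. Qed.

Lemma sqnorm_ge_coord x i : x ord0 i ^+ 2 <= sqnorm x.
Proof.
by rewrite /sqnorm (bigD1 i)//= lerDl sumr_ge0// => j _; exact: sqr_ge0.
Qed.

Lemma quad_ge_sqr q y : q.1 ^+ 2 <= quad q y.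
Proof. by rewrite lerDl sqnorm_ge0. Qed.

Lemma quad_gt0 q y : 0 < q.1 -> 0 < quad q y.
Proof. by move=> q0; rewrite (lt_le_trans _ (quad_ge_sqr q y))// exprn_gt0. Qed.

Lemma measurable_quad q : measurable_fun setT (quad q).
Proof.
apply: measurable_funD => //; apply: measurable_sum => i.
apply: measurable_funX.
rewrite (_ : (fun y => _) = fun y : 'rV[R]_n => q.2 ord0 i - y ord0 i).
  by apply: measurable_funB => //; exact: measurable_rV_coord.
by apply/funext => y; rewrite !mxE.
Qed.

Lemma oneDsqr_le_quad q y i : 0 < q.1 ->
  oneDsqr (y ord0 i) <= ((1 + 2 * sqnorm q.2) / q.1 ^+ 2 + 2) * quad q y.
Proof.
move=> q0; rewrite /oneDsqr.
have := sqnorm_ge_coord q.2 i; have := sqnorm_ge_coord (q.2 - y) i.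
rewrite !mxE; set a := q.2 ord0 i; set b := y ord0 i => ab aa.
have t2 : 0 < q.1 ^+ 2 by rewrite exprn_gt0.
have S0 := sqnorm_ge0 q.2.
have -> : ((1 + 2 * sqnorm q.2) / q.1 ^+ 2 + 2) * quad q y =
   (1 + 2 * sqnorm q.2) * (quad q y / q.1 ^+ 2) + 2 * quad q y.
  by rewrite mulrDl mulrA mulrAC -mulrA.
have : 1 <= quad q y / q.1 ^+ 2 by rewrite ler_pdivlMr// mul1r quad_ge_sqr.
move: (quad q y / _) => k k1; rewrite /quad.
have := sqr_ge0 (2 * a - b); nra.
Qed.

Variable sigma : R.
Hypothesis sigma0 : 0 < sigma.
Let s : R := (n%:R + sigma) / 2.

(** The square of the kernel is [quad q y] to the power [- n - sigma]. Each of
    the [n] factors [(quad q y)^-1] is dominated by [(1 + y_i ^+ 2)^-1] for one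
    coordinate of [y], and the last one by a constant. *)
Lemma sqint_quad_powR q : 0 < q.1 ->
  sqint (lebesgue_rV R n) (fun y => quad q y `^ (- s)).
Proof.
move=> q0.
have mQ : measurable_fun setT (fun y => quad q y `^ (- s)).
  by apply: (measurableT_comp (measurable_powR (- s))); exact: measurable_quad.
split=> //.
pose C := (1 + 2 * sqnorm q.2) / q.1 ^+ 2 + 2.
have C0 : 0 < C.
  by rewrite ltr_wpDl// divr_ge0 ?sqr_ge0// addr_ge0// mulr_ge0// sqnorm_ge0.
pose G (y : 'rV[R]_n) := \prod_(i < n) (oneDsqr (y ord0 i))^-1.
have mG : measurable_fun setT G.
  by apply: measurable_prod => i _; exact: measurable_oneDsqrV_coord.
have G0 y : 0 <= G y by apply: prodr_ge0 => i _; rewrite invr_ge0.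
have iG : (lebesgue_rV R n).-integrable setT (EFin \o G).
  apply/integrableP; split; first exact/measurable_EFinP.
  rewrite (le_lt_trans _ (integral_prod_oneDsqrV_lty n))//.
  apply: ge0_le_integral => //.
  - by apply: measurableT_comp => //; exact/measurable_EFinP.
  - exact/measurable_EFinP.
  - by move=> y _ /=; rewrite lee_fin ger0_norm.
have iKG := integrableZl measurableT (C ^+ n * (q.1 ^+ 2) `^ (- sigma)) iG.
apply: (@integrable_le_norm _ _ _ _ _
    (fun y => C ^+ n * (q.1 ^+ 2) `^ (- sigma) * G y)) => //.
  exact: measurable_funX.
move=> y; have Q0 := quad_gt0 y q0.
rewrite ger0_norm ?sqr_ge0// ger0_norm; last first.
  by rewrite !mulr_ge0// ?exprn_ge0 ?powR_ge0// ltW.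
rewrite -powR_mulrn ?powR_ge0// -powRrM.
have -> : - s * 2 = - n%:R + - sigma by rewrite /s; field.
rewrite powRD; last by apply/implyP => _; rewrite gt_eqF.
rewrite -[leRHS]mulrA [leRHS]mulrCA mulrC; apply: ler_pM; rewrite ?powR_ge0//.
  rewrite !powRN lef_pV2 ?posrE ?powR_gt0 ?exprn_gt0//.
  by apply: ge0_ler_powR; rewrite ?nnegrE ?quad_ge_sqr ?sqr_ge0// ltW.
rewrite powR_invn; last exact: ltW.
have -> : quad q y ^- n = \prod_(i < n) (quad q y)^-1.
  by rewrite prodr_const card_ord exprVn.
have -> : C ^+ n * G y = \prod_(i < n) (C * (oneDsqr (y ord0 i))^-1).
  by rewrite big_split/= prodr_const card_ord.
apply: ler_prod => i _; rewrite invr_ge0 ltW//=.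
have o0 : 0 < oneDsqr (y ord0 i) by rewrite (lt_le_trans ltr01)// oneDsqr_ge1.
rewrite ler_pdivlMr// mulrC ler_pdivrMr//.
exact: oneDsqr_le_quad.
Qed.

Lemma poissonE q y : poisson sigma q y =
  poisson_const n sigma * q.1 `^ sigma * quad q y `^ (- s).
Proof. by rewrite /poisson powRN. Qed.

End quadratic.
End KernelL2.

(** * Closed subspaces of L2 and functions that generate it *)

Section ClosedSubspace.
Context {R : realType} {n : nat}.
Local Notation leb := (lebesgue_rV R n).
Local Notation fn := ('rV[R]_n -> R[i]).
Implicit Types (f g : fn) (a b rho : 'rV[R]_n -> R) (A : set 'rV[R]_n).

Definition rcplx a : fn := fun y => (a y)%:C%C.

Lemma is_L2_rcplx a : sqint leb a -> is_L2 (rcplx a).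
Proof. by move=> sa; apply/is_L2P; split => //=; exact: sqint0. Qed.

Lemma hnorm_rcplx a : sqint leb a -> hnorm (rcplx a) ^+ 2 = \int[leb]_y (a y ^+ 2).
Proof.
move=> sa; have r2 := is_L2_rcplx sa.
rewrite hnorm_sqr// l2dotE//=.
rewrite [X in _ + X](_ : _ = 0) ?addr0.
  by apply: eq_Rintegral => y _; rewrite expr2.
rewrite (_ : (fun _ => _) = cst 0); last by apply/funext => y; rewrite mulr0.
by rewrite /Rintegral integral0.
Qed.

Lemma rcplxDZ k a b : rcplx (fun y => k * a y + b y) = k%:C%C *: rcplx a + rcplx b.
Proof. by apply/funext => y; rewrite /rcplx !fctE rmorphD rmorphM. Qed.

Lemma rcplxB a b : rcplx (fun y => a y - b y) = rcplx a - rcplx b.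
Proof. by apply/funext => y; rewrite /rcplx !fctE rmorphB. Qed.

Lemma rcplx_sum I (r : seq I) (P : pred I) (F : I -> 'rV[R]_n -> R) :
  rcplx (fun y => \sum_(i <- r | P i) F i y) = \sum_(i <- r | P i) rcplx (F i).
Proof. by apply/funext => y; rewrite /rcplx fct_sumE rmorph_sum. Qed.

Lemma hnorm_dct (a_ : nat -> 'rV[R]_n -> R) a b :
  (forall k, measurable_fun setT (a_ k)) -> measurable_fun setT a ->
  (forall y, a_ k y @[k --> \oo] --> a y) ->
  (forall k y, `|a_ k y| <= b y) -> sqint leb b ->
  [/\ forall k, sqint leb (a_ k), sqint leb a &
      hnorm (rcplx (a_ k) - rcplx a) @[k --> \oo] --> 0].
Proof.
move=> ma_ ma aa ab sb.
have b0 y : 0 <= b y := le_trans (normr_ge0 _) (ab 0%N y).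
have ab' y : `|a y| <= b y.
  have cn : `|a_ k y| @[k --> \oo] --> `|a y| by apply: cvg_norm.
  rewrite -(cvg_lim _ cn)//; apply: limr_le; first by apply/cvg_ex; eexists; exact: cn.
  by apply: nearW => k; exact: ab.
have sa_ k : sqint leb (a_ k).
  by apply: (le_sqint _ sb) => // y; rewrite (ger0_norm (b0 y)).
have sa : sqint leb a by apply: (le_sqint _ sb) => // y; rewrite (ger0_norm (b0 y)).
split=> //.
have sD k : sqint leb (fun y => a_ k y - a y) by apply: sqintD => //; exact: sqintN.
have i4 := integrableZl measurableT 4 sb.2.
pose F k y := ((a_ k y - a y) ^+ 2)%:E.
have mF k : measurable_fun setT (F k).
  by apply/measurable_EFinP; apply: measurable_funX; exact: (sD k).1.
have F0 : {ae leb, forall y, setT y -> F ^~ y @ \oo --> (cst 0 y : \bar R)}.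
  apply: aeW => y _.
  have H : (a_ k y - a y) ^+ 2 @[k --> \oo] --> (0 : R).
    have H1 : a_ k y - a y @[k --> \oo] --> (0 : R).
      by rewrite -(subrr (a y)); apply: cvgB; [exact: aa|exact: cvg_cst].
    by have := cvgM H1 H1; rewrite mulr0; apply.
  by apply/fine_cvgP; split; [exact: nearW|exact: H].
have Fb : {ae leb, forall y k, setT y -> (`|F k y| <= 4%:E * (b y ^+ 2)%:E)%E}.
  apply: aeW => y k _; rewrite /F/= -EFinM lee_fin ger0_norm ?sqr_ge0//.
  have := ab k y; have := ab' y; rewrite !ler_norml => /andP[] + + /andP[].
  have := b0 y; nra.
have [_ _ cv] := @dominated_convergence _ _ R leb setT measurableT F (cst 0%E) _
  mF (@measurable_cst _ _ _ _ _ _) F0 i4 Fb.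
rewrite integral0 in cv.
have {}cv : hnorm (rcplx (a_ k) - rcplx a) ^+ 2 @[k --> \oo] --> 0.
  move/fine_cvg : cv; apply: cvg_trans; apply: near_eq_cvg; apply: nearW => k.
  by rewrite -rcplxB hnorm_rcplx.
have := cvg_comp _ _ cv (@sqrt_continuous R 0); rewrite sqrtr0.
apply: cvg_trans; apply: near_eq_cvg; apply: nearW => k.
by rewrite /= sqrtr_sqr ger0_norm// hnorm_ge0.
Qed.

(** Closed subspaces; [l2closed_near] also makes them invariant under equality
    almost everywhere. *)
Record l2closed (G : fn -> Prop) : Prop := L2Closed {
  l2closed0 : G 0 ;
  l2closedDZ : forall (c : R[i]) f g, G f -> G g -> G (c *: f + g) ;
  l2closedL : forall f, G f -> is_L2 f ;
  l2closed_near : forall f, is_L2 f ->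
    (forall e, 0 < e -> exists2 g, G g & hnorm (f - g) < e) -> G f }.

Import HBNNSimple.

Section closed.
Variables (G : fn -> Prop) (cG : l2closed G).

Lemma l2closedZ c f : G f -> G (c *: f).
Proof. by move=> Gf; rewrite -[_ *: f]addr0; apply: (l2closedDZ cG) => //; exact: (l2closed0 cG). Qed.

Lemma l2closedD f g : G f -> G g -> G (f + g).
Proof. by move=> Gf Gg; rewrite -[f]scale1r; exact: (l2closedDZ cG). Qed.

Lemma l2closedB f g : G f -> G g -> G (f - g).
Proof. by move=> Gf Gg; rewrite -scaleN1r; apply: l2closedD => //; exact: l2closedZ. Qed.

Lemma l2closed_sum I (r : seq I) (P : pred I) (F : I -> fn) :
  (forall i, P i -> G (F i)) -> G (\sum_(i <- r | P i) F i).
Proof. by move=> H; elim/big_ind: _ => //; [exact: (l2closed0 cG)|exact: l2closedD]. Qed.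

Lemma l2closed_cvg (f_ : nat -> fn) f : (forall k, G (f_ k)) -> is_L2 f ->
  hnorm (f_ k - f) @[k --> \oo] --> (0 : R) -> G f.
Proof.
move=> Gf f2 cv; apply: (l2closed_near cG) => // e e0.
have /cvgrPdist_lt/(_ _ e0)[k _ /(_ k (leqnn k))/=] := cv.
rewrite sub0r normrN ger0_norm ?hnorm_ge0// => ke; exists (f_ k) => //.
by rewrite hnormBC//; exact: (l2closedL cG).
Qed.

Lemma l2closed_dct (a_ : nat -> 'rV[R]_n -> R) a b :
  (forall k, G (rcplx (a_ k))) ->
  (forall k, measurable_fun setT (a_ k)) -> measurable_fun setT a ->
  (forall y, a_ k y @[k --> \oo] --> a y) ->
  (forall k y, `|a_ k y| <= b y) -> sqint leb b -> G (rcplx a).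
Proof.
move=> Ga ma_ ma aa ab sb; have [_ sa cv] := hnorm_dct ma_ ma aa ab sb.
by apply: (@l2closed_cvg (fun k => rcplx (a_ k))) => //; exact: is_L2_rcplx.
Qed.

(** Divide a nonnegative function by [rho] and approximate the quotient from
    below by simple functions. *)
Lemma l2closed_simple rho (D : nat -> set 'rV[R]_n) :
  measurable_fun setT rho -> (forall y, 0 < rho y) ->
  (forall m, measurable (D m)) -> (forall y, \forall m \near \oo, D m y) ->
  (forall m A, measurable A -> A `<=` D m -> G (rcplx (fun y => rho y * \1_A y))) ->
  forall f, is_L2 f -> G f.
Proof.
move=> mrho rho0 mD Dy GA.
have pos a : sqint leb a -> (forall y, 0 <= a y) -> G (rcplx a).
  move=> sa a0; have [ma ia] := sa.
  pose b y := (a y / rho y)%:E.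
  have mb : measurable_fun setT b.
    apply/measurable_EFinP; apply: measurable_funM => //.
    rewrite (_ : (fun x => (rho x)^-1) = (fun x => rho x `^ (-1))).
      by apply: (measurableT_comp (measurable_powR (-1))).
    by apply/funext => y; rewrite powR_inv1// ltW.
  have b0 y : setT y -> (0 <= b y)%E by move=> _; rewrite lee_fin divr_ge0// ltW.
  pose g := nnsfun_approx measurableT mb.
  have gb y : g k y @[k --> \oo] --> a y / rho y.
    by have /fine_cvgP[_] := cvg_nnsfun_approx measurableT mb b0 (I : setT y).
  have nd y : nondecreasing_seq (fun k => g k y).
    by move=> k l kl; have /lefP := nd_nnsfun_approx measurableT mb kl; apply.
  have gle k y : g k y <= a y / rho y.
    rewrite -(cvg_lim _ (gb y))//; apply: nondecreasing_cvgn_le => //.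
    by apply/cvg_ex; eexists; exact: gb.
  pose a_ k y := rho y * (g k y * \1_(D k) y).
  have ma_ k : measurable_fun setT (a_ k).
    apply: measurable_funM => //; apply: measurable_funM.
      exact: measurable_funPT.
    exact: measurable_indic.
  apply: (@l2closed_dct a_ a a) => //.
  - move=> k; rewrite /a_.
    have [r gE] : exists r : seq R, forall y,
        g k y = \sum_(x <- r) x * \1_(g k @^-1` [set x]) y.
      eexists=> y; rewrite fimfunE fsbig_finite//=; exact: fimfunP.
    have -> : (fun y => rho y * (g k y * \1_(D k) y)) = fun y =>
       \sum_(x <- r) x * (rho y * \1_(g k @^-1` [set x] `&` D k) y).
      apply/funext => y; rewrite gE mulr_suml mulr_sumr; apply: eq_bigr => x _.
      by rewrite indicI/=; ring.
    rewrite rcplx_sum; apply: l2closed_sum => x _.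
    rewrite (_ : rcplx _ = x%:C%C *:
        rcplx (fun y => rho y * \1_(g k @^-1` [set x] `&` D k) y)).
      apply/l2closedZ/(GA k); last exact: subIsetr.
      exact: measurableI.
    by apply/funext => y; rewrite /rcplx !fctE rmorphM.
  - move=> y; have : rho y * (g k y * 1) @[k --> \oo] --> rho y * ((a y / rho y) * 1).
      by apply: cvgMr; apply: cvgMl; exact: gb.
    rewrite mulr1 mulrC mulfVK ?gt_eqF//; apply: cvg_trans.
    apply: near_eq_cvg; near=> k; rewrite /a_ indicE mem_set//.
    by near: k; exact: Dy.
  - move=> k y; rewrite ger0_norm; last first.
      by rewrite !mulr_ge0// ltW.
    rewrite /a_ -[leRHS](mulfVK (lt0r_neq0 (rho0 y))) mulrC ler_pM2r//.
    by rewrite -[leRHS]mulr1 ler_pM// indicE; case: (_ \in _).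
have real a : sqint leb a -> G (rcplx a).
  move=> sa; rewrite -(funrposBneg a).
  rewrite (_ : rcplx _ = rcplx a^\+ - rcplx a^\-).
    apply: l2closedB; apply: pos => //.
    - apply: (le_sqint _ sa); first exact: measurable_funrpos sa.1.
      move=> y; rewrite ger0_norm ?funrpos_ge0//.
      by rewrite /funrpos ge_max ler_norm normr_ge0.
    - apply: (le_sqint _ sa); first exact: measurable_funrneg sa.1.
      move=> y; rewrite ger0_norm ?funrneg_ge0//.
      by rewrite /funrneg ge_max -normrN ler_norm normr_ge0.
  by rewrite -rcplxB.
move=> f /is_L2P[fr fi].
rewrite (_ : f = rcplx (fun y => complex.Re (f y)) +
    'i%C *: rcplx (fun y => complex.Im (f y))).
  by apply: l2closedD; [exact: real|apply: l2closedZ; exact: real].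
by apply/funext => y; rewrite !fctE; exact: complexE.
Unshelve. all: by end_near. Qed.

End closed.
End ClosedSubspace.

(** * Taylor expansion of the kernels in their parameter *)

Section BinomialTaylor.
Context {R : realType}.
Implicit Types (s e : R).

(** The generalized binomial coefficient of [-s] over [m]. *)
Fixpoint bcoef s (m : nat) : R :=
  if m is m'.+1 then - s / m'.+1%:R * bcoef (s + 1) m' else 1.

Lemma bcoef_neq0 s m : 0 < s -> bcoef s m != 0.
Proof.
elim: m s => [|m IH] s s0 /=; first exact: oner_neq0.
rewrite mulf_neq0 ?IH ?addr_gt0// mulf_neq0 ?oppr_eq0 ?invr_eq0 ?gt_eqF//.
Qed.

Definition btaylor s (N : nat) e := \sum_(m < N) bcoef s m * e ^+ m.

Lemma btaylorS s N e : btaylor s N.+1 e = btaylor s N e + bcoef s N * e ^+ N.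
Proof. by rewrite /btaylor big_ord_recr. Qed.

Lemma is_derive_btaylor s N e :
  is_derive e 1 (btaylor s N.+1) (- s * btaylor (s + 1) N e).
Proof.
elim: N => [|N IH].
  rewrite (_ : btaylor s 1 = cst 1); last first.
    by apply/funext => x; rewrite /btaylor big_ord1 expr0 mulr1.
  by rewrite /btaylor big_ord0 mulr0; exact: is_derive_cst.
have d2 : is_derive e 1 (fun x : R => bcoef s N.+1 * x ^+ N.+1)
    (bcoef s N.+1 * (N.+1%:R * e ^+ N)).
  have := is_deriveZ (bcoef s N.+1) (is_deriveX N.+1 (is_derive_id e (1 : R))).
  rewrite (_ : _ \*: _ = fun x => bcoef s N.+1 * x ^+ N.+1).
    by move/is_derive_eq; apply; rewrite /GRing.scale/= mulr1.
  by apply/funext => x; rewrite !fctE.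
have := is_deriveD IH d2; rewrite (_ : _ + (fun _ => _) = btaylor s N.+2); last first.
  by apply/funext => x; rewrite btaylorS.
move/is_derive_eq; apply; rewrite btaylorS mulrDr; congr (_ + _).
have N0 : N.+1%:R != 0 :> R by rewrite pnatr_eq0.
by rewrite /=; field.
Qed.

Lemma btaylor0 s N : btaylor s N.+1 0 = 1.
Proof.
rewrite /btaylor big_ord_recl/= expr0 mulr1 big1 ?addr0// => i _.
by rewrite /bump/= expr0n mulr0.
Qed.

(** The remainder of order [N.+1] for the exponent [- s] has derivative [- s]
    times the remainder of order [N] for [- (s + 1)], so that the mean value
    theorem gives the bound by induction. *)
Lemma btaylor_bound N : forall s, 0 < s -> exists2 C, 0 <= C &
  forall e, `|e| <= 2^-1 -> `|(1 + e) `^ (- s) - btaylor s N e| <= C * `|e| ^+ N.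
Proof.
elim: N => [|N IH] s s0.
  exists (2^-1 `^ (- s)); first exact: powR_ge0.
  move=> e; rewrite ler_norml => /andP[e1 e2].
  rewrite /btaylor big_ord0 subr0 expr0 mulr1 ger0_norm ?powR_ge0//.
  rewrite !powRN lef_pV2 ?posrE ?powR_gt0 ?invr_gt0//; last by lra.
  by apply: ge0_ler_powR; [exact: ltW|rewrite nnegrE|rewrite nnegrE|]; lra.
have [C C0 HC] := IH (s + 1) (addr_gt0 s0 ltr01).
exists (s * C); first by rewrite mulr_ge0// ltW.
pose g (e : R) := (1 + e) `^ (- s) - btaylor s N.+1 e.
pose dg (e : R) := - s * ((1 + e) `^ (- (s + 1)) - btaylor (s + 1) N e).
have g0 : g 0 = 0 by rewrite /g addr0 powR1 btaylor0 subrr.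
have dgE (e : R) : -1 < e -> is_derive e 1 g (dg e).
  move=> e1; have e10 : 0 < 1 + e by rewrite -ltrBlDl sub0r.
  have d1 : is_derive e 1 (fun x : R => (1 + x) `^ (- s))
      (- s * (1 + e) `^ (- s - 1)).
    have i1 := is_derive1_powR (- s) e10.
    have i2 : is_derive e 1 (fun x : R => 1 + x) 1.
      by have := is_deriveD (is_derive_cst (1 : R) e 1) (is_derive_id e (1 : R));
        rewrite add0r; apply.
    by have := is_derive1_comp i1 i2; rewrite mulr1.
  have d2 := is_derive_btaylor s N e.
  by apply: is_derive_eq; rewrite /dg mulrBr opprD.
have bnd (e c : R) : `|e| <= 2^-1 -> `|c| <= `|e| -> `|dg c| <= s * C * `|e| ^+ N.
  move=> e1 ce; have sn : `|- s| = s by rewrite normrN gtr0_norm.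
  rewrite /dg normrM sn -[leRHS]mulrA ler_pM2l//.
  rewrite (le_trans (HC _ (le_trans ce e1)))// ler_wpM2l// lerXn2r ?nnegrE//.
have cg (a b : R) : -1 < a -> {within `[a, b], continuous g}.
  move=> a1; apply: continuous_in_subspaceT => x; rewrite inE/= in_itv/= => /andP[ax _].
  have [dx _] := dgE _ (lt_le_trans a1 ax).
  by move/derivable1_diffP : dx => /differentiable_continuous.
move=> e; rewrite -/(g e) => ee.
have := ee; rewrite ler_norml => /andP[e1 e2].
have [e0|e0|->] := ltgtP e 0; last by rewrite g0 normr0 mulr_ge0 ?mulr_ge0 ?exprn_ge0// ltW.
- have [||c] := @MVT R g dg e 0 e0.
  + by move=> x; rewrite in_itv/= => /andP[ex _]; apply: dgE; lra.
  + by apply: cg; lra.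
  + rewrite in_itv/= => /andP[ec c0]; rewrite g0 !sub0r => /eqP.
    rewrite eqr_oppLR => /eqP ->; rewrite mulrN opprK normrM exprSr mulrA.
    rewrite ler_wpM2r// bnd// !ltr0_norm//; lra.
- have [||c] := @MVT R g dg 0 e e0.
  + by move=> x; rewrite in_itv/= => /andP[ex _]; apply: dgE; lra.
  + by apply: cg; lra.
  + rewrite in_itv/= => /andP[ec c0]; rewrite g0 !subr0 => ->.
    rewrite normrM exprSr mulrA.
    rewrite ler_wpM2r// bnd// !gtr0_norm//; lra.
Qed.

End BinomialTaylor.

Section KernelTaylor.
Context {R : realType} {n : nat}.
Local Notation leb := (lebesgue_rV R n).
Implicit Types (p q : R * 'rV[R]_n) (y : 'rV[R]_n) (i : option 'I_n).
Implicit Types (lam : option 'I_n -> R).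

(** Half the derivative of the quadratic form [quad p y] in the parameter
    directions; the affine functions of [y] are their linear combinations. *)
Definition dirf p i y : R := if i is Some j then p.2 ord0 j - y ord0 j else p.1.

Definition lin p lam y : R := \sum_i lam i * dirf p i y.

(** Displacement from [p] to [q], in the coordinates in which [quad] is affine. *)
Definition disp p q i : R :=
  if i is Some j then 2 * (q.2 ord0 j - p.2 ord0 j)
  else (q.1 ^+ 2 - p.1 ^+ 2 + sqnorm (q.2 - p.2)) / p.1.

Definition l1 lam : R := \sum_i `|lam i|.

Lemma l1_ge0 lam : 0 <= l1 lam.
Proof. by apply: sumr_ge0. Qed.

Lemma big_option (F : option 'I_n -> R) :
  \sum_i F i = F None + \sum_(j < n) F (Some j).
Proof.
rewrite (bigD1 None)//=; congr (_ + _).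
rewrite (reindex_omap (fun j : 'I_n => Some j) id) => [|[j|]//].
by apply: eq_bigl => j; rewrite eqxx.
Qed.

Lemma quad_disp p q y : p.1 != 0 -> quad q y = quad p y + lin p (disp p q) y.
Proof.
move=> p0; rewrite /quad /lin big_option /= mulfVK//.
suff : sqnorm (q.2 - y) = sqnorm (q.2 - p.2) + sqnorm (p.2 - y) +
    \sum_(j < n) 2 * (q.2 ord0 j - p.2 ord0 j) * (p.2 ord0 j - y ord0 j).
  by move=> ->; ring.
rewrite /sqnorm -!big_split/=; apply: eq_bigr => j _; rewrite !mxE; ring.
Qed.

Lemma sqr_dirf_le p i y : dirf p i y ^+ 2 <= quad p y.
Proof.
case: i => [j|] /=; last exact: quad_ge_sqr.
by have := sqnorm_ge_coord (p.2 - y) j; rewrite !mxE /quad; have := sqr_ge0 p.1; lra.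
Qed.

Lemma norm_dirf_le p i y : 0 < p.1 -> `|dirf p i y| <= quad p y / p.1.
Proof.
move=> p0; rewrite ler_pdivlMr//.
have := sqr_dirf_le p i y; have := quad_ge_sqr p y.
rewrite -(real_normK (num_real (dirf p i y))).
have := normr_ge0 (dirf p i y); have := sqr_ge0 (`|dirf p i y| - p.1); nra.
Qed.

Lemma norm_lin_le p lam y : 0 < p.1 -> `|lin p lam y| <= l1 lam / p.1 * quad p y.
Proof.
move=> p0; rewrite (le_trans (ler_norm_sum _ _ _))// /l1 mulrAC -mulrA mulr_suml.
apply: ler_sum => i _; rewrite normrM ler_wpM2l//.
by rewrite norm_dirf_le.
Qed.

Lemma measurable_dirf p i : measurable_fun setT (dirf p i).
Proof.
case: i => [j|]; last exact: measurable_cst.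
rewrite (_ : dirf p (Some j) = fun y : 'rV[R]_n => p.2 ord0 j - y ord0 j)//.
by apply: measurable_funB => //; exact: measurable_rV_coord.
Qed.

Lemma measurable_lin p lam : measurable_fun setT (lin p lam).
Proof.
apply: measurable_sum => i; apply: measurable_funM => //; exact: measurable_dirf.
Qed.

Lemma linZ p k lam y : lin p (fun i => k * lam i) y = k * lin p lam y.
Proof. by rewrite /lin mulr_sumr; apply: eq_bigr => i _; rewrite mulrA. Qed.

Lemma l1Z k lam : l1 (fun i => k * lam i) = `|k| * l1 lam.
Proof. by rewrite /l1 mulr_sumr; apply: eq_bigr => i _; rewrite normrM. Qed.

Lemma norm_coef_le lam i : `|lam i| <= l1 lam.
Proof. by rewrite /l1 (bigD1 i)//= lerDl sumr_ge0. Qed.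

(** Small displacements are realized by points of the half-space. *)
Lemma disp_surj p lam : 0 < p.1 -> l1 lam <= p.1 / 2 ->
  exists2 q, 0 < q.1 & disp p q = lam.
Proof.
move=> p0 l2.
pose x : 'rV[R]_n := \row_j (p.2 ord0 j + lam (Some j) / 2).
have sx : sqnorm (x - p.2) <= l1 lam * l1 lam / 4.
  rewrite [X in X * _ / _]/l1 big_option mulrDl [leRHS]mulrDl -[leLHS]add0r lerD//.
    by rewrite divr_ge0// mulr_ge0// l1_ge0.
  rewrite /sqnorm !mulr_suml; apply: ler_sum => j _; rewrite !mxE addrC addKr.
  rewrite -(real_normK (num_real _)) normrM (ger0_norm (_ : 0 <= 2^-1))//.
  have := norm_coef_le lam (Some j); have := normr_ge0 (lam (Some j)); nra.
(* the square of the first coordinate of the point, forced by [lam None] *)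
pose T := p.1 ^+ 2 + p.1 * lam None - sqnorm (x - p.2).
have T0 : 0 < T.
  rewrite /T; have := norm_coef_le lam None; rewrite ler_norml => /andP[l0 _].
  have := l1_ge0 lam; nra.
exists (Num.sqrt T, x); rewrite /= ?sqrtr_gt0//.
apply/funext => -[j|] /=; first by rewrite mxE addrC addKr mulrC mulfVK.
by rewrite sqr_sqrtr ?(ltW T0)// /T; field; rewrite gt_eqF.
Qed.

Variable s : R.
Hypothesis s0 : 0 < s.

(** The [m]-th term of the expansion, up to its binomial coefficient. *)
Definition tterm p lam m y := (lin p lam y / quad p y) ^+ m * quad p y `^ (- s).

Lemma norm_ratio_le p lam y : 0 < p.1 -> `|lin p lam y / quad p y| <= l1 lam / p.1.
Proof.
move=> p0; have Q0 := quad_gt0 y p0.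
by rewrite normrM normfV (gtr0_norm Q0) ler_pdivrMr// norm_lin_le.
Qed.

(** [quad q y = quad p y * (1 + r)] with [r = lin p (disp p q) y / quad p y], and
    [r] is bounded by [1 / 2] and by [l1 (disp p q) / p.1] whatever [y]: the
    binomial expansion in [r] is uniform in [y]. *)
Lemma kernel_taylor N p : 0 < p.1 -> exists2 C, 0 <= C &
  forall q y, 0 < q.1 -> l1 (disp p q) <= p.1 / 2 ->
  `|quad q y `^ (- s) - \sum_(m < N) bcoef s m * tterm p (disp p q) m y| <=
  C * l1 (disp p q) ^+ N * quad p y `^ (- s).
Proof.
move=> p0; have [C C0 HC] := btaylor_bound N s0.
exists (C / p.1 ^+ N) => [|q y q0 l2]; first by rewrite divr_ge0// exprn_ge0// ltW.
have Q0 := quad_gt0 y p0; set r := lin p (disp p q) y / quad p y.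
have rl : `|r| <= l1 (disp p q) / p.1 by exact: norm_ratio_le.
have r2 : `|r| <= 2^-1.
  by rewrite (le_trans rl)// ler_pdivrMr// mulrC.
have -> : quad q y = quad p y * (1 + r).
  by rewrite mulrDr mulr1 mulrC divfK ?gt_eqF// -quad_disp// gt_eqF.
have r1 : 0 <= 1 + r by move: r2; rewrite ler_norml => /andP[]; lra.
rewrite powRM// ?(ltW Q0)//.
have -> : \sum_(m < N) bcoef s m * tterm p (disp p q) m y =
    quad p y `^ (- s) * btaylor s N r.
  by rewrite /btaylor mulr_sumr; apply: eq_bigr => m _; rewrite /tterm -/r; ring.
rewrite -mulrBr normrM ger0_norm ?powR_ge0// mulrC ler_wpM2r ?powR_ge0//.
rewrite (le_trans (HC _ r2))// -mulrA ler_wpM2l//.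
rewrite mulrC -expr_div_n; apply: lerXn2r => //; rewrite nnegrE//.
by rewrite divr_ge0 ?l1_ge0// ltW.
Qed.

Lemma measurable_tterm p lam m : 0 < p.1 -> measurable_fun setT (tterm p lam m).
Proof.
move=> p0; apply: measurable_funM.
  apply: measurable_funX; apply: measurable_funM; first exact: measurable_lin.
  rewrite (_ : (fun y => (quad p y)^-1) = (fun y => quad p y `^ (-1))).
    by apply: (measurableT_comp (measurable_powR (-1))); exact: measurable_quad.
  by apply/funext => y; rewrite powR_inv1// ltW// quad_gt0.
by apply: (measurableT_comp (measurable_powR (- s))); exact: measurable_quad.
Qed.

Lemma norm_tterm_le p lam m y : 0 < p.1 ->
  `|tterm p lam m y| <= (l1 lam / p.1) ^+ m * quad p y `^ (- s).
Proof.
move=> p0; rewrite /tterm normrM (ger0_norm (powR_ge0 _ _)) ler_wpM2r ?powR_ge0//.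
rewrite normrX; apply: lerXn2r; rewrite ?nnegrE//; last exact: norm_ratio_le.
by rewrite divr_ge0 ?l1_ge0// ltW.
Qed.

Lemma ttermZ p k lam m y :
  tterm p (fun i => k * lam i) m y = k ^+ m * tterm p lam m y.
Proof. by rewrite /tterm linZ -[k * _ / _]mulrA exprMn -mulrA. Qed.

End KernelTaylor.

(** * The Poisson kernels span a dense subspace *)

Section Density.
Context {R : realType} {n : nat}.
Local Notation leb := (lebesgue_rV R n).
Local Notation fn := ('rV[R]_n -> R[i]).
Implicit Types (p q : R * 'rV[R]_n) (y : 'rV[R]_n) (i : option 'I_n).
Implicit Types (lam : option 'I_n -> R) (a b : 'rV[R]_n -> R).

Lemma hnorm_le_rcplx a b k : measurable_fun setT a -> sqint leb b -> 0 <= k ->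
  (forall y, `|a y| <= k * b y) ->
  sqint leb a /\ hnorm (rcplx a) <= k * hnorm (rcplx b).
Proof.
move=> ma sb k0 ab.
have skb : sqint leb (fun y => k * b y) by exact: sqintZ.
have sa : sqint leb a.
  by apply: (le_sqint ma skb) => y; rewrite (le_trans (ab y))// ler_norm.
split=> //.
have -> : k * hnorm (rcplx b) = hnorm (rcplx (fun y => k * b y)).
  rewrite (_ : rcplx (fun y => k * b y) = k%:C%C *: rcplx b).
    by rewrite hnormZ ?normcR ?ger0_norm//; exact: is_L2_rcplx.
  by apply/funext => y; rewrite /rcplx !fctE rmorphM.
rewrite -(@ler_pXn2r _ 2)// ?nnegrE ?hnorm_ge0// !hnorm_rcplx//.
apply: le_Rintegral => //; [exact: sa.2|exact: skb.2|] => y _.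
rewrite -(real_normK (num_real (a y))); apply: lerXn2r => //.
by rewrite nnegrE (le_trans _ (ab y)).
Qed.

Variable sigma : R.
Hypothesis sigma0 : 0 < sigma.
Let s : R := (n%:R + sigma) / 2.

Let s0 : 0 < s.
Proof. by rewrite divr_gt0// ltr_wpDl. Qed.

Lemma cpoissonE q : cpoisson sigma q =
  (poisson_const n sigma * q.1 `^ sigma)%:C%C *: rcplx (fun y => quad q y `^ (- s)).
Proof. by apply/funext => y; rewrite /cpoisson poissonE rmorphM. Qed.

Lemma poisson_coef_gt0 q : 0 < q.1 -> 0 < poisson_const n sigma * q.1 `^ sigma.
Proof. by move=> q0; rewrite mulr_gt0 ?poisson_const_gt0// powR_gt0. Qed.

Lemma is_L2_cpoisson q : 0 < q.1 -> is_L2 (cpoisson sigma q).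
Proof.
by move=> q0; rewrite cpoissonE; apply/is_L2Z/is_L2_rcplx; exact: sqint_quad_powR.
Qed.

Lemma sqint_tterm p lam m : 0 < p.1 -> sqint leb (tterm s p lam m).
Proof.
move=> p0.
have c0 : 0 <= (l1 lam / p.1) ^+ m.
  by rewrite exprn_ge0// divr_ge0 ?l1_ge0// ltW.
have [] // := @hnorm_le_rcplx (tterm s p lam m) _ _ _ (sqint_quad_powR sigma0 p0) c0.
  exact: measurable_tterm.
by move=> y; exact: norm_tterm_le.
Qed.

Section closed.
Variables (G : fn -> Prop) (cG : l2closed G).
Hypothesis GP : forall q, 0 < q.1 -> G (cpoisson sigma q).

Let GK q : 0 < q.1 -> G (rcplx (fun y => quad q y `^ (- s))).
Proof.
move=> q0; have c0 := poisson_coef_gt0 q0.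
have := l2closedZ cG ((poisson_const n sigma * q.1 `^ sigma)^-1)%:C%C (GP q0).
rewrite cpoissonE scalerA -rmorphM/= mulVf ?gt_eqF//.
by rewrite rmorph1 scale1r.
Qed.

(** Moving the parameter by a small multiple [eps] of [lam], subtracting the
    lower Taylor terms and dividing by [eps ^+ m] leaves the [m]-th term up to
    an error of order [eps]. *)
Let Gtterm p lam m : 0 < p.1 -> G (rcplx (tterm s p lam m)).
Proof.
move=> p0; elim/ltn_ind: m => m IH.
have [C C0 HC] := kernel_taylor s0 m.+1 p0.
have L2t := is_L2_rcplx (sqint_tterm lam m p0).
apply: (l2closed_near cG) => // e e0.
pose b := bcoef s m; have b0 : b != 0 := bcoef_neq0 m s0.
pose B := hnorm (rcplx (fun y => quad p y `^ (- s))).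
pose X := `|b|^-1 * C * l1 lam ^+ m.+1 * B.
have X0 : 0 <= X by rewrite !mulr_ge0// ?invr_ge0// ?exprn_ge0 ?l1_ge0// hnorm_ge0.
(* small enough for the Taylor bound to apply and for its error to be below [e] *)
pose eps := (1 + 2 * l1 lam / p.1 + X / e)^-1.
have den0 : 0 < 1 + 2 * l1 lam / p.1 + X / e.
  rewrite -addrA ltr_pwDl// addr_ge0//; last by rewrite divr_ge0// ltW.
  by rewrite divr_ge0 ?(ltW p0)// mulr_ge0// l1_ge0.
have eps0 : 0 < eps by rewrite invr_gt0.
have l2 : l1 (fun i => eps * lam i) <= p.1 / 2.
  rewrite l1Z gtr0_norm// mulrC ler_pdivrMr//.
  have : 0 <= X / e by rewrite divr_ge0// ltW.
  have -> : p.1 / 2 * (1 + 2 * l1 lam / p.1 + X / e) =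
    p.1 / 2 * (1 + X / e) + l1 lam by field; rewrite !gt_eqF.
  by move=> Xe; rewrite lerDr mulr_ge0 ?addr_ge0// divr_ge0// ltW.
have [q q0 qE] := disp_surj p0 l2.
have {}HC y := HC q y q0; rewrite qE in HC; have {}HC y := HC y l2.
pose g y := (b * eps ^+ m)^-1 * (quad q y `^ (- s) -
   \sum_(j < m) bcoef s j * eps ^+ j * tterm s p lam j y).
exists (rcplx g).
  rewrite (_ : rcplx g = ((b * eps ^+ m)^-1)%:C%C *:
    (rcplx (fun y => quad q y `^ (- s)) -
     \sum_(j < m) (bcoef s j * eps ^+ j)%:C%C *: rcplx (tterm s p lam j))).
    apply: (l2closedZ cG); apply: (l2closedB cG); first exact: GK.
    by apply: l2closed_sum => // j _; apply: l2closedZ => //; exact: IH.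
  apply/funext => y; rewrite /rcplx !fctE fct_sumE /g rmorphM rmorphB rmorph_sum.
  by congr (_ * (_ - _)); apply: eq_bigr => j _; rewrite rmorphM.
have be0 : b * eps ^+ m != 0 by rewrite mulf_neq0// expf_neq0// gt_eqF.
rewrite -rcplxB.
have mg : measurable_fun setT (fun y => tterm s p lam m y - g y).
  apply: measurable_funB; first exact: measurable_tterm.
  apply: measurable_funM => //; apply: measurable_funB.
    exact: (sqint_quad_powR sigma0 q0).1.
  by apply: measurable_sum => j; apply: measurable_funM => //; exact: measurable_tterm.
pose D := `|b|^-1 * C * l1 lam ^+ m.+1 * eps.
have D0 : 0 <= D by rewrite !mulr_ge0 ?invr_ge0 ?exprn_ge0 ?l1_ge0// ltW.
have gb y : `|tterm s p lam m y - g y| <= D * quad p y `^ (- s).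
  rewrite (_ : _ - _ = - ((b * eps ^+ m)^-1 * (quad q y `^ (- s) -
      \sum_(j < m.+1) bcoef s j * tterm s p (fun i => eps * lam i) j y))).
    rewrite normrN normrM (le_trans (ler_wpM2l _ (HC y)))//.
    rewrite l1Z (gtr0_norm eps0) normfV normrM normrX (gtr0_norm eps0).
    rewrite exprMn /D le_eqVlt; apply/orP; left; apply/eqP.
    by rewrite exprS; field; rewrite normr_eq0 b0 expf_neq0// gt_eqF.
  rewrite big_ord_recr/= ttermZ.
  under eq_bigr do rewrite ttermZ mulrA.
  by rewrite /g -/b; field; rewrite b0 expf_neq0 ?gt_eqF.
have [_ hle] := hnorm_le_rcplx mg (sqint_quad_powR sigma0 p0) D0 gb.
rewrite (le_lt_trans hle)// -/B.
have -> : D * B = eps * X by rewrite /D /X; ring.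
rewrite /eps mulrC ltr_pdivrMr//.
have -> : e * (1 + 2 * l1 lam / p.1 + X / e) = e * (1 + 2 * l1 lam / p.1) + X.
  by field; rewrite !gt_eqF.
rewrite ltrDr mulr_gt0// ltr_pwDl// divr_ge0 ?mulr_ge0 ?l1_ge0//; exact: ltW.
Qed.

Let measurable_quadV p : 0 < p.1 -> measurable_fun setT (fun y => (quad p y)^-1).
Proof.
move=> p0; rewrite (_ : (fun y => (quad p y)^-1) = (fun y => quad p y `^ (-1))).
  by apply: (measurableT_comp (measurable_powR (-1))); exact: measurable_quad.
by apply/funext => y; rewrite powR_inv1// ltW// quad_gt0.
Qed.

(** Summing the exponential series. *)
Let Gexp_series (x W : 'rV[R]_n -> R) B : measurable_fun setT x ->
  (forall y, `|x y| <= B) -> sqint leb W -> (forall y, 0 <= W y) ->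
  (forall j, G (rcplx (fun y => x y ^+ j * W y))) ->
  G (rcplx (fun y => expR (x y) * W y)).
Proof.
move=> mx xB sW W0 Gx.
pose a_ N y := series (exp_coeff (x y)) N * W y.
have a_E N : a_ N = fun y => \sum_(0 <= j < N) (j`!%:R)^-1 * (x y ^+ j * W y).
  apply/funext => y; rewrite /a_ /series/= mulr_suml; apply: eq_bigr => j _.
  by rewrite /exp_coeff/=; ring.
apply: (@l2closed_dct _ _ G cG a_ _ (fun y => expR B * W y)).
- move=> N; rewrite a_E rcplx_sum; apply: l2closed_sum => // j _.
  rewrite (_ : rcplx _ = ((j`!%:R)^-1)%:C%C *: rcplx (fun y => x y ^+ j * W y)).
    exact: l2closedZ.
  by apply/funext => y; rewrite /rcplx !fctE rmorphM.
- move=> N; rewrite a_E; apply: measurable_sum => j; apply: measurable_funM => //.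
  by apply: measurable_funM; [exact: measurable_funX|exact: sW.1].
- by apply: measurable_funM; [exact: measurableT_comp|exact: sW.1].
- by move=> y; apply: cvgMl; exact: is_cvg_series_exp_coeff.
- move=> N y; rewrite normrM (ger0_norm (W0 y)) ler_wpM2r//.
  rewrite (@le_trans _ _ (series (exp_coeff `|x y|) N))//.
    rewrite /series/= (le_trans (ler_norm_sum _ _ _))//.
    by apply: ler_sum => j _; rewrite /exp_coeff/= normrM normfV normr_nat normrX.
  rewrite (@le_trans _ _ (expR `|x y|)) ?ler_expR//.
  apply: (@nondecreasing_cvgn_le _ (series (exp_coeff _)));
    last exact: is_cvg_series_exp_coeff.
  apply/nondecreasing_seqP => j; rewrite /series/= big_nat_recr//= lerDl.
  by rewrite exp_coeff_ge0.
- exact: sqintZ.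
Qed.

Variable p : R * 'rV[R]_n.
Hypothesis p0 : 0 < p.1.

(** The coordinates of [y] after inversion in a sphere; being bounded, they can
    be exponentiated. *)
Let z i y := dirf p i y / quad p y.

Let z_le i y : `|z i y| <= p.1^-1.
Proof.
have Q0 := quad_gt0 y p0; rewrite /z normrM normfV (gtr0_norm Q0) ler_pdivrMr//.
by rewrite mulrC norm_dirf_le.
Qed.

Let mquadV : measurable_fun setT (fun y => (quad p y)^-1).
Proof. exact: measurable_quadV. Qed.

Let mz i : measurable_fun setT (z i).
Proof. by apply: measurable_funM => //; exact: measurable_dirf. Qed.

Let E lam y := expR (lin p lam y / quad p y).

Let mE lam : measurable_fun setT (E lam).
Proof.
apply: measurableT_comp => //; apply: measurable_funM => //; exact: measurable_lin.
Qed.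

Let E_le lam y : E lam y <= expR (l1 lam / p.1).
Proof.
by rewrite ler_expR (le_trans (ler_norm _))// norm_ratio_le.
Qed.

(** A pi-system of half-space cylinders in the inverted coordinates. *)
Let cyl (l : seq (option 'I_n * R)) : set 'rV[R]_n :=
  [set y | all (fun c => z c.1 y < c.2) l].

Let mcyl l : measurable (cyl l).
Proof.
elim: l => [|c l IH].
  by rewrite (_ : cyl [::] = setT)//; apply/seteqP; split.
rewrite (_ : cyl (c :: l) = z c.1 @^-1` [set x | x < c.2] `&` cyl l).
  apply: measurableI => //; rewrite -[X in measurable X]setTI.
  by apply: mz => //; rewrite -set_itvNyo; exact: measurable_itv.
by apply/seteqP; split=> y /=; [move=> /andP[]|move=> [? ?]; apply/andP].
Qed.

(** These weights are exponential series in the exponentials of [x], and their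
    limit is the exact indicator, also where [x = a]. *)
Let step_cvg (x a : R) :
  expR (- (m%:R * expR (m%:R * (x - a)))) @[m --> \oo] --> ((x < a)%R%:R : R).
Proof.
have [xa|ax] := ltP x a.
  have d0 : 0 < a - x by rewrite subr_gt0.
  have H : m%:R * expR (m%:R * (x - a)) @[m --> \oo] --> (0 : R).
    apply: (@squeeze_cvgr _ _ _ _ (cst 0) (fun m : nat => 2 / (a - x) ^+ 2 * m%:R^-1)).
    - near=> m; have m0 : 0 < m%:R :> R by rewrite ltr0n; near: m; exact: nbhs_infty_gt.
      rewrite mulr_ge0 ?expR_ge0//=.
      rewrite -(opprB a x) mulrN expRN ler_pdivrMr ?expR_gt0//.
      have mx : 0 <= m%:R * (a - x) by rewrite mulr_ge0// ltW.
      have := expR_ge1Dxn 1 mx; rewrite (_ : 2`!%:R = 2 :> R)// => ge1.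
      have ge2 : (m%:R * (a - x)) ^+ 2 / 2 <= expR (m%:R * (a - x)) by lra.
      have c0 : 0 <= 2 / (a - x) ^+ 2 / m%:R.
        by rewrite !divr_ge0 ?sqr_ge0.
      apply: le_trans (ler_wpM2l c0 ge2); rewrite le_eqVlt; apply/orP; left; apply/eqP.
      by field; rewrite !gt_eqF.
    - exact: cvg_cst.
    - rewrite -[X in _ --> X](mulr0 (2 / (a - x) ^+ 2)); apply: cvgMr.
      by rewrite -cvg_shiftS; exact: cvg_harmonic.
  have := cvg_comp _ _ (cvgN H) (@continuous_expR R _); rewrite oppr0 expR0; exact.
apply: (@squeeze_cvgr _ _ _ _ (cst 0) (fun m : nat => expR (- m%:R))).
- near=> m; rewrite expR_ge0/= ler_expR lerN2 ler_peMr// -expR0 ler_expR.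
  by rewrite mulr_ge0// subr_ge0.
- exact: cvg_cst.
- exact: cvgn_expR.
Unshelve. all: by end_near. Qed.

(** One condition [z i y < a] at a time. The exponential factor with arbitrary
    [lam] makes the induction go through: expanding a weight for a further
    condition produces such factors. *)
Let Gcyl l lam : G (rcplx (fun y => E lam y * \1_(cyl l) y * quad p y `^ (- s))).
Proof.
have sK := sqint_quad_powR sigma0 p0.
elim: l lam => [|[i a] l IH] lam.
  rewrite (_ : (fun y => _) = fun y => E lam y * quad p y `^ (- s)).
    apply: (@Gexp_series _ _ (l1 lam / p.1)) => //.
    - by apply: measurable_funM => //; exact: measurable_lin.
    - by move=> y; exact: norm_ratio_le.
    - by move=> y; exact: powR_ge0.
    - by move=> j; exact: Gtterm.
  by apply/funext => y; rewrite indicE mem_set ?mulr1.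
pose w m y := expR (- (m%:R * expR (m%:R * (z i y - a)))).
have mw m : measurable_fun setT (w m).
  apply: measurableT_comp => //; apply: measurableT_comp => //.
  apply: measurable_funM => //; apply: measurableT_comp => //.
  by apply: measurable_funM => //; apply: measurable_funB.
have m1 : measurable_fun setT (\1_(cyl l) : _ -> R) by exact: measurable_indic.
have i01 (A : set 'rV[R]_n) y : 0 <= (\1_A y : R) <= 1.
  by rewrite indicE; case: (_ \in _); rewrite ?lexx ?ler01.
have Gw m : G (rcplx (fun y => E lam y * w m y * \1_(cyl l) y * quad p y `^ (- s))).
  pose x y := - (m%:R * expR (m%:R * (z i y - a))).
  pose B := m%:R * expR (m%:R * (p.1^-1 + `|a|)).
  have xB y : `|x y| <= B.
    rewrite normrN ger0_norm ?mulr_ge0 ?expR_ge0// ler_wpM2l// ler_expR ler_wpM2l//.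
    by rewrite (le_trans (ler_norm _))// (le_trans (ler_normB _ _))// lerD2r z_le.
  pose W y := E lam y * \1_(cyl l) y * quad p y `^ (- s).
  have W0 y : 0 <= W y.
    by rewrite !mulr_ge0 ?expR_ge0 ?powR_ge0//; have /andP[] := i01 (cyl l) y.
  have mW : measurable_fun setT W.
    by apply: measurable_funM; [exact: measurable_funM|exact: sK.1].
  have sW : sqint leb W.
    apply: (le_sqint mW (sqintZ (expR (l1 lam / p.1)) sK)) => y.
    rewrite (ger0_norm (W0 y)) ger0_norm ?mulr_ge0 ?expR_ge0 ?powR_ge0// /W.
    rewrite ler_wpM2r ?powR_ge0// -[leRHS]mulr1; have /andP[? ?] := i01 (cyl l) y.
    by apply: ler_pM; rewrite ?expR_ge0.
  rewrite (_ : (fun y => _) = fun y => expR (x y) * W y); last first.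
    by apply/funext => y; rewrite /w /W /x; ring.
  apply: (@Gexp_series _ _ B) => //.
    by apply: measurableT_comp => //; apply: measurable_funM => //;
      apply: measurableT_comp => //; apply: measurable_funM => //; exact: measurable_funB.
  (* a power of [x] shifts the coefficient of the sphere coordinate [i] *)
  move=> j; pose lam' i' := lam i' + (j * m)%:R * (i' == i)%:R.
  set c := (- m%:R) ^+ j * expR (- ((j * m)%:R * a)).
  rewrite (_ : (fun y => _) = fun y => c * (E lam' y * \1_(cyl l) y * quad p y `^ (- s))).
    rewrite (_ : rcplx _ = c%:C%C *:
        rcplx (fun y => E lam' y * \1_(cyl l) y * quad p y `^ (- s))).
      exact: (l2closedZ cG).
    by apply/funext => y; rewrite /rcplx !fctE rmorphM.
  apply/funext => y.
  rewrite /W /x -mulNr exprMn -expRM_natl /c.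
  have -> : E lam' y = E lam y * expR ((j * m)%:R * z i y).
    rewrite /E -expRD; congr expR; rewrite /lin /lam' /z.
    under eq_bigr do rewrite mulrDl.
    rewrite big_split/= mulrDl; congr (_ + _).
    rewrite (bigD1 i)//= eqxx big1 ?addr0 ?mulr1 ?mulrA// => i' /negbTE ->.
    by rewrite mulr0 mul0r.
  have -> : expR (j%:R * (m%:R * (z i y - a))) =
      expR (- ((j * m)%:R * a)) * expR ((j * m)%:R * z i y).
    by rewrite -expRD; congr expR; rewrite natrM; ring.
  by ring.
apply: (@l2closed_dct _ _ G cG
    (fun m y => E lam y * w m y * \1_(cyl l) y * quad p y `^ (- s)) _
    (fun y => expR (l1 lam / p.1) * quad p y `^ (- s))) => //.
- move=> m; apply: measurable_funM; last exact: sK.1.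
  by apply: measurable_funM => //; exact: measurable_funM.
- apply: measurable_funM; last exact: sK.1.
  by apply: measurable_funM => //; apply: measurable_indic.
- move=> y; apply: cvgMl.
  rewrite (_ : \1_(cyl ((i, a) :: l)) y = (z i y < a)%R%:R * \1_(cyl l) y :> R).
    by rewrite mulrA; apply: cvgMl; apply: cvgMr; exact: step_cvg.
  rewrite !indicE -natrM mulnb; congr (nat_of_bool _)%:R.
  apply/idP/andP => [/set_mem/= /andP[h1 h2]|[h1 /set_mem h2]].
    by split=> //; exact: mem_set.
  by apply: mem_set; apply/andP; split.
- move=> m y; rewrite normrM (ger0_norm (powR_ge0 _ _)) ler_wpM2r ?powR_ge0//.
  have /andP[? ?] := i01 (cyl l) y.
  rewrite ger0_norm ?mulr_ge0 ?expR_ge0//.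
  rewrite -[leRHS]mulr1 -[leRHS]mulr1; apply: ler_pM; rewrite ?mulr_ge0 ?expR_ge0//.
  apply: ler_pM; rewrite ?expR_ge0// ?E_le// -expR0 ler_expR oppr_le0.
  by rewrite mulr_ge0// expR_ge0.
- exact: sqintZ.
Qed.

Let cyls : set (set 'rV[R]_n) := [set A | exists l, A = cyl l].

(** The sphere coordinates determine [y], hence generate the Borel sets. *)
Let measurable_cyls : @measurable _ 'rV[R]_n = <<s cyls >>.
Proof.
apply/seteqP; split=> A; last first.
  apply: smallest_sub; first exact: sigma_algebra_measurable.
  by move=> _ [l ->]; exact: mcyl.
pose T := g_sigma_algebraType cyls.
have mzT i : measurable_fun [set: T] (z i : T -> R).
  move=> mT; apply: (measurability _ (RGenInftyO.measurableE R)) => //.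
  move=> _ [_ [a ->] <-]; rewrite setTI; apply: sub_gen_smallest.
  exists [:: (i, a)]; rewrite /cyl /=; apply/seteqP; split=> y /=.
    by rewrite in_itv/= andbT.
  by rewrite in_itv/= andbT.
have mid : measurable_fun [set: T] (fun y : T => y : 'rV[R]_n).
  apply: measurable_fun_rV => j.
  rewrite (_ : (fun t => _) = fun y : T => p.2 ord0 j - p.1 * (z (Some j) y / z None y)).
    apply: measurable_funB => //; apply: measurable_funM => //.
    apply: measurable_funM => //.
    rewrite (_ : (fun x => (z None x)^-1) = fun y : T => z None y `^ (-1)).
      by apply: (measurableT_comp (measurable_powR (-1))).
    apply/funext => y; rewrite powR_inv1// /z/= divr_ge0// ltW//.
    exact: quad_gt0.
  apply/funext => y; rewrite /z/=; have := quad_gt0 y p0 => /gt_eqF/negbT Q0.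
  by field; rewrite Q0 gt_eqF.
by move=> mA; have := mid measurableT A mA; rewrite setTI.
Qed.

Let Gset A : measurable A -> G (rcplx (fun y => quad p y `^ (- s) * \1_A y)).
Proof.
have sK := sqint_quad_powR sigma0 p0.
have Gc l : G (rcplx (fun y => quad p y `^ (- s) * \1_(cyl l) y)).
  have := Gcyl l (fun=> 0); congr (G (rcplx _)); apply/funext => y.
  rewrite /E (_ : lin _ _ _ = 0) ?mul0r ?expR0 ?mul1r 1?mulrC//.
  by rewrite /lin big1// => i _; rewrite mul0r.
have GT : G (rcplx (fun y => quad p y `^ (- s) * \1_setT y)).
  by rewrite (_ : setT = cyl [::]); [exact: Gc|apply/seteqP; split].
have mi A' : measurable A' ->
    measurable_fun setT (fun y => quad p y `^ (- s) * \1_A' y).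
  by move=> mA'; apply: measurable_funM; [exact: sK.1|exact: measurable_indic].
have bi A' y : `|quad p y `^ (- s) * \1_A' y| <= quad p y `^ (- s).
  rewrite normrM (ger0_norm (powR_ge0 _ _)) -[leRHS]mulr1 ler_wpM2l ?powR_ge0//.
  by rewrite indicE; case: (_ \in _); rewrite ?normr1 ?normr0.
move=> mA; have : <<s cyls >> A by rewrite -measurable_cyls.
move: A mA => A0 _; move: A0.
apply: (dynkin_induction measurable_cyls) => //.
- move=> _ _ [l1 ->] [l2 ->]; exists (l1 ++ l2); apply/seteqP; split=> y /=.
    by move=> [h1 h2]; rewrite /cyl/= all_cat; apply/andP.
  by rewrite /cyl/= all_cat => /andP.
- by move=> _ [l ->]; exact: Gc.
- move=> A mA GA; have := l2closedB cG GT GA; rewrite -rcplxB.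
  congr (G (rcplx _)); apply/funext => y; rewrite -mulrBr !indicE in_setT in_setC.
  by case: (y \in A); rewrite ?subrr ?subr0.
- move=> F mF tF GF.
  pose a_ N y := \sum_(0 <= k < N) quad p y `^ (- s) * \1_(F k) y.
  have a_E N : a_ N = fun y => quad p y `^ (- s) * \1_(\big[setU/set0]_(k < N) F k) y.
    apply/funext => y; rewrite /a_ -mulr_sumr big_mkord; congr (_ * _).
    elim: N => [|N IH]; first by rewrite !big_ord0 indic0.
    rewrite !big_ord_recr/= IH !indicE in_setU.
    have [yN|yN] := boolP (y \in F N); last by rewrite orbF addr0.
    rewrite orbT (_ : (_ \in _) = false) ?add0r//.
    apply/negbTE/negP => /set_mem; rewrite -bigcup_mkord => -[k /= kN Fk].
    move/trivIsetP : tF => /(_ k N I I); rewrite (ltn_eqF kN) => /(_ isT).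
    by apply/eqP/set0P; exists y; split => //; exact: set_mem.
  apply: (@l2closed_dct _ _ G cG a_ _ (fun y => quad p y `^ (- s))) => //.
  + by move=> N; rewrite /a_ rcplx_sum; apply: l2closed_sum.
  + by move=> N; rewrite a_E; apply: mi; exact: bigsetU_measurable.
  + by apply: mi; exact: bigcup_measurable.
  + move=> y; have [yF|yF] := boolP (y \in \bigcup_k F k); last first.
      rewrite indicE (negbTE yF) mulr0.
      apply: (@cvg_trans _ (nbhs (0 : R))) => //.
      rewrite (_ : a_ ^~ y = cst 0); first exact: cvg_cst.
      apply/funext => N; rewrite a_E indicE (_ : (_ \in _) = false) ?mulr0//.
      apply/negbTE; move: yF; apply: contraNN => /set_mem.
      by rewrite -bigcup_mkord => -[k _ Fk]; apply: mem_set; exists k.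
    have [k _ Fk] := set_mem yF.
    rewrite indicE yF mulr1; apply: cvg_near_cst; near=> N.
    rewrite a_E indicE mem_set ?mulr1//.
    rewrite -bigcup_mkord; exists k => //=; near: N; exact: nbhs_infty_gt.
  + by move=> N y; rewrite a_E; exact: bi.
Unshelve. all: by end_near. Qed.

Lemma poisson_dense_at f : is_L2 f -> G f.
Proof.
apply: (@l2closed_simple _ _ G cG (fun y => quad p y `^ (- s)) (fun=> setT)) => //.
- exact: (sqint_quad_powR sigma0 p0).1.
- by move=> y; rewrite powR_gt0// quad_gt0.
- by move=> y; exact: nearW.
- by move=> _ A mA _; exact: Gset.
Qed.

End closed.

(** A closed subspace with all kernels contains their Taylor terms at one point
    [p], which are the powers of the inverted coordinates times the kernel at
    [p]; hence exponentials, indicators of cylinders, and indicators of all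
    Borel sets times that kernel. *)
Theorem poisson_dense (G : fn -> Prop) : l2closed G ->
  (forall q, 0 < q.1 -> G (cpoisson sigma q)) -> forall f, is_L2 f -> G f.
Proof. by move=> cG GP; exact: (@poisson_dense_at G cG GP (1, 0) ltr01). Qed.

End Density.

(** * Families tending weakly to zero *)

Section Weak.
Context {R : realType} {n : nat}.
Local Notation leb := (lebesgue_rV R n).
Local Notation fn := ('rV[R]_n -> R[i]).
Local Notation normc := Normc.normc.
Implicit Types (f g : fn).

(** Upper bound only: for nonnegative functions this is convergence to 0. *)
Definition vanishes {I : Type} (F : set_system I) (phi : I -> R) :=
  forall e, 0 < e -> \forall i \near F, phi i < e.

Lemma vanishes_cvg {I : Type} (F : set_system I) {FF : Filter F} (phi : I -> R) :
  (\forall i \near F, 0 <= phi i) -> vanishes F phi -> phi i @[i --> F] --> (0 : R).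
Proof.
move=> phi0 v; apply/cvgrPdist_lt => e e0; have {}v := v e e0.
by apply: filterS2 phi0 v => i p0 pe; rewrite sub0r normrN ger0_norm.
Qed.

Lemma cvg_vanishes {I : Type} (F : set_system I) {FF : Filter F} (phi : I -> R) :
  phi i @[i --> F] --> (0 : R) -> vanishes F phi.
Proof.
move=> /cvgrPdist_lt cv e e0; apply: filterS (cv e e0) => i.
by rewrite sub0r normrN; apply: le_lt_trans; exact: ler_norm.
Qed.

Lemma vanishes_le {I : Type} (F : set_system I) {FF : Filter F} (phi psi : I -> R) k :
  0 <= k -> (\forall i \near F, phi i <= k * psi i) -> vanishes F psi -> vanishes F phi.
Proof.
move=> k0 le v e e0; have k1 : 0 < k + 1 by rewrite ltr_wpDl.
have {}v := v _ (divr_gt0 e0 k1).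
apply: filterS2 le v => i ile pe; apply: le_lt_trans ile _.
have [->|kn0] := eqVneq k 0; first by rewrite mul0r.
have kgt : 0 < k by rewrite lt_neqAle eq_sym kn0.
rewrite (@lt_trans _ _ (k * (e / (k + 1))))// ?ltr_pM2l//.
by rewrite mulrA ltr_pdivrMr// mulrC ltr_pM2l// ltrDl.
Qed.

Lemma vanishesD {I : Type} (F : set_system I) {FF : Filter F} (phi psi : I -> R) :
  vanishes F phi -> vanishes F psi -> vanishes F (fun i => phi i + psi i).
Proof.
move=> v1 v2 e e0; have e2 : 0 < e / 2 by rewrite divr_gt0.
by apply: filterS2 (v1 _ e2) (v2 _ e2) => i; lra.
Qed.

(** The vectors on which a bounded family tends weakly to zero form a closed
    subspace. *)
Lemma l2closed_weak {I : Type} (F : set_system I) {FF : Filter F} (r : I -> fn) M :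
  (\forall i \near F, is_L2 (r i)) -> (\forall i \near F, hnorm (r i) <= M) ->
  l2closed (fun g => is_L2 g /\ vanishes F (fun i => normc (l2dot (r i) g))).
Proof.
move=> r2 rM; split.
- split=> [|e e0]; first exact: is_L20.
  by apply: filterS r2 => i ri; rewrite l2dot0r// Normc.normc0.
- move=> c f g [f2 vf] [g2 vg]; split; first by apply: is_L2D => //; exact: is_L2Z.
  apply: (@vanishes_le _ _ _ _ (fun i => normc c * normc (l2dot (r i) f) +
     normc (l2dot (r i) g)) 1) => //.
    apply: filterS r2 => i ri; rewrite mul1r l2dotDr//; last exact: is_L2Z.
    by rewrite (le_trans (le_normcD _ _))// l2dotZr// Normc.normcM normcJ.
  apply: vanishesD => //.
  by apply: (vanishes_le _ _ vf (k := normc c)); [exact: normc_ge0|exact: nearW].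
- by move=> f [].
- move=> f f2 H; split=> // e e0.
  have M0 : 0 < `|M| + 1 by rewrite ltr_wpDl.
  have [g [g2 vg] fg] := H _ (divr_gt0 (divr_gt0 e0 (ltr0Sn R 1)) M0).
  have vg' := vg _ (divr_gt0 e0 (ltr0Sn R 1)).
  have r2M : \forall i \near F, is_L2 (r i) /\ hnorm (r i) <= M.
    by apply: filterS2 r2 rM.
  apply: filterS2 r2M vg' => i [ri rMi] vi.
  have -> : f = (f - g) + g by rewrite subrK.
  have fg2 := is_L2B f2 g2.
  rewrite l2dotDr// (le_lt_trans (le_normcD _ _))//.
  have := cauchy_schwarz ri fg2 => cs.
  have : hnorm (r i) * hnorm (f - g) <= e / 2.
    apply: (@le_trans _ _ ((`|M| + 1) * (e / 2 / (`|M| + 1)))); last first.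
      by rewrite mulrC divfK// gt_eqF.
    apply: ler_pM; rewrite ?hnorm_ge0 ?(ltW fg)// (le_trans rMi)//.
    by rewrite (le_trans (ler_norm _))// lerDl.
  lra.
Qed.

Variable sigma : R.
Hypothesis sigma0 : 0 < sigma.

(** By density, weak convergence of a bounded family is tested on the kernels. *)
Lemma weak_vanishes {I : Type} (F : set_system I) {FF : Filter F} (r : I -> fn) M :
  (\forall i \near F, is_L2 (r i)) -> (\forall i \near F, hnorm (r i) <= M) ->
  (forall q, 0 < q.1 -> vanishes F (fun i => normc (l2dot (r i) (cpoisson sigma q)))) ->
  forall f, is_L2 f -> vanishes F (fun i => normc (l2dot (r i) f)).
Proof.
move=> r2 rM rh f f2.
have cG := @l2closed_weak _ F FF r M r2 rM.
have [|_ //] := poisson_dense sigma0 cG _ f2.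
by move=> q q0; split; [exact: is_L2_cpoisson|exact: rh].
Qed.

(** A function orthogonal to all kernels is, by density, orthogonal to itself. *)
Lemma nullspace0 f : is_L2 f ->
  (forall q, 0 < q.1 -> l2dot f (cpoisson sigma q) = 0) -> hnorm f = 0.
Proof.
move=> f2 f0; apply/eqP; apply: contraT => fn0.
have v : vanishes \oo (fun _ : nat => normc (l2dot f f)).
  apply: (@weak_vanishes nat \oo _ (fun=> f) (hnorm f)) => //; try exact: nearW.
  by move=> q q0 e e0; apply: nearW => _; rewrite f0// Normc.normc0.
have e0 : 0 < hnorm f ^+ 2 by rewrite exprn_even_gt0.
have [N _ /(_ N (leqnn N)) H] := v _ e0.
have : normc (l2dot f f) < hnorm f ^+ 2 := H.
by rewrite l2dotff// normcR ger0_norm ?sqr_ge0// ltxx.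
Qed.

End Weak.

(** * The boundary vanishing condition *)

Section Cubes.
Context {R : realType} {n : nat}.
Local Notation leb := (lebesgue_rV R n).
Local Notation fn := ('rV[R]_n -> R[i]).
Local Notation normc := Normc.normc.

Definition cube (x : 'rV[R]_n) (r : R) : set 'rV[R]_n :=
  [set y | forall i, y ord0 i \in `[x ord0 i - r, x ord0 i + r]].

Lemma measurable_cube x r : measurable (cube x r).
Proof.
rewrite (_ : cube x r = \bigcap_(i in [set: 'I_n])
    ((fun y : 'rV[R]_n => y ord0 i) @^-1` `[x ord0 i - r, x ord0 i + r])).
  apply: fin_bigcap_measurable => // i _.
  by rewrite -[X in measurable X]setTI; apply: measurable_rV_coord => //; exact: measurable_itv.
by apply/seteqP; split=> [y Bx i _|y Bx i]; have := Bx i; rewrite ?inE/=; apply.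
Qed.

Lemma lebesgue_cube x r : 0 <= r -> leb (cube x r) = ((2 * r) ^+ n)%:E.
Proof.
move=> r0; etransitivity; first exact: (@lebesgue_rV_prod R n
  (fun i => `[x ord0 i - r, x ord0 i + r]%classic) (fun i => measurable_itv _)).
transitivity (\prod_(i < n) (2 * r)%:E)%E; last first.
  by rewrite prodEFin prodr_const card_ord.
apply: eq_bigr => i _.
rewrite lebesgue_measure_itv/= lte_fin.
have -> : x ord0 i - r < x ord0 i + r = (0 < r) by apply/idP/idP; lra.
case: ltP => rr; first by rewrite -EFinB; congr EFin; ring.
have -> : r = 0 by apply/eqP; rewrite eq_le rr.
by rewrite mulr0.
Qed.

Lemma sqint_indic (A : set 'rV[R]_n) : measurable A -> (leb A < +oo)%E ->
  sqint leb (\1_A : _ -> R) /\ hnorm (rcplx (\1_A : _ -> R)) ^+ 2 = fine (leb A).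
Proof.
move=> mA Afin.
have e y : (\1_A y : R) ^+ 2 = \1_A y.
  by rewrite indicE; case: (_ \in _); rewrite ?expr1n ?expr0n.
have sA : sqint leb (\1_A : _ -> R).
  split; first exact: measurable_indic.
  under eq_fun do rewrite e.
  apply/integrableP; split; first by apply/measurable_EFinP; exact: measurable_indic.
  rewrite (eq_integral (fun y => (\1_A y)%:E)) ?integral_indic ?setIT// => y _.
  by rewrite gee0_abs// lee_fin indicE; case: (_ \in _).
split=> //; rewrite hnorm_rcplx//.
under eq_Rintegral do rewrite e.
by rewrite /Rintegral integral_indic ?setIT.
Qed.

Lemma l2dot_rcplx (a b : 'rV[R]_n -> R) : sqint leb a -> sqint leb b ->
  l2dot (rcplx a) (rcplx b) = (\int[leb]_y (a y * b y))%:C%C.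
Proof.
move=> sa sb; rewrite l2dotE//=; [|exact: is_L2_rcplx..].
have z (c : 'rV[R]_n -> R) : (forall y, c y = 0) -> \int[leb]_y (c y) = 0.
  move=> c0; rewrite (_ : c = cst 0); last exact/funext.
  by rewrite /Rintegral integral0.
rewrite (z (fun=> 0 * 0)) ?(z (fun y => 0 * b y)) ?(z (fun y => a y * 0)).
- by rewrite addr0 subr0.
- by move=> y; rewrite mulr0.
- by move=> y; rewrite mul0r.
- by move=> y; rewrite mulr0.
Qed.

End Cubes.

Section BVC.
Context {R : realType} {n : nat}.
Local Notation leb := (lebesgue_rV R n).
Local Notation fn := ('rV[R]_n -> R[i]).
Local Notation normc := Normc.normc.
Implicit Types (q : R * 'rV[R]_n) (y : 'rV[R]_n).
Variable sigma : R.
Hypotheses (n1 : (1 <= n)%N) (sigma0 : 0 < sigma).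
Let s : R := (n%:R + sigma) / 2.
Let gam : R := n%:R / 2 + sigma.

Let s0 : 0 < s. Proof. by rewrite divr_gt0// ltr_wpDl. Qed.
Let gam0 : 0 < gam. Proof. by rewrite ltr_wpDl// divr_ge0. Qed.
Let n2 : 0 < n%:R / 2 :> R. Proof. by rewrite divr_gt0// ltr0n. Qed.

Let ker q : fn := rcplx (fun y => quad q y `^ (- s)).

Let ker2 q : 0 < q.1 -> sqint leb (fun y => quad q y `^ (- s)).
Proof. exact: sqint_quad_powR. Qed.

Lemma powR_small (g e : R) : 0 < g -> 0 < e ->
  exists2 a, 0 < a & forall t, 0 < t -> t <= a -> t `^ g <= e.
Proof.
move=> g0 e0; exists (e `^ g^-1); first exact: powR_gt0.
move=> t t0 ta; rewrite -[leRHS](powRr1 (ltW e0)) -(mulVf (lt0r_neq0 g0)) powRrM.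
by apply: ge0_ler_powR; rewrite ?nnegrE ?powR_ge0// ltW.
Qed.

(** On the cube of half-side [t] around [x] the kernel is at least
    [((1 + n) t ^+ 2) `^ (- s)], so that its norm is at least of the order
    [t `^ (n / 2 - 2 s)]. *)
Let hnorm_ker_ge : exists2 c, 0 < c &
  forall q, 0 < q.1 -> c * q.1 `^ (- gam) <= hnorm (ker q).
Proof.
exists ((1 + n%:R) `^ (- s) * 2 `^ (n%:R / 2)).
  by rewrite mulr_gt0// powR_gt0// ltr_wpDr.
move=> q q0; set t := q.1 in q0 *.
have fin : (leb (cube q.2 t) < +oo)%E by rewrite lebesgue_cube ?ltry// ltW.
have [sA hA] := sqint_indic (measurable_cube q.2 t) fin.
set k := ((1 + n%:R) * t ^+ 2) `^ (- s).
have mkA : measurable_fun setT (fun y => k * \1_(cube q.2 t) y).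
  by apply: measurable_funM => //; exact: sA.1.
have [|_] := @hnorm_le_rcplx R n _ _ 1 mkA (ker2 q0) ler01.
  move=> y; rewrite mul1r normrM (ger0_norm (powR_ge0 _ _)).
  have Q0 := quad_gt0 y q0.
  rewrite indicE; have [yA|yA] := boolP (y \in _); last first.
    by rewrite normr0 mulr0 powR_ge0.
  have {}yA i : y ord0 i \in `[q.2 ord0 i - t, q.2 ord0 i + t] by exact: (set_mem yA).
  rewrite normr1 mulr1 /k !powRN lef_pV2 ?posrE ?powR_gt0//; last first.
    by rewrite mulr_gt0 ?exprn_gt0// ltr_wpDr.
  apply: ge0_ler_powR; rewrite ?nnegrE ?(ltW s0) ?(ltW Q0)//.
    by rewrite mulr_ge0 ?addr_ge0// sqr_ge0.
  rewrite /quad mulrDl mul1r lerD2l /sqnorm mulr_natl -[leRHS](_ : \sum_(i < n) t ^+ 2 = _).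
    apply: ler_sum => i _; rewrite !mxE.
    have := yA i; rewrite in_itv/= => /andP[]; rewrite -/t; nra.
  by rewrite sumr_const card_ord.
rewrite mul1r; apply: le_trans.
rewrite (_ : rcplx _ = k%:C%C *: rcplx (\1_(cube q.2 t))); last first.
  by apply/funext => y; rewrite /rcplx !fctE rmorphM.
rewrite hnormZ; last exact: is_L2_rcplx.
rewrite normcR (ger0_norm (powR_ge0 _ _)).
have -> : hnorm (rcplx (\1_(cube q.2 t))) = (2 * t) `^ (n%:R / 2).
  apply/eqP; rewrite -(@eqrXn2 _ 2)// ?hnorm_ge0 ?powR_ge0// hA lebesgue_cube ?ltW//=.
  rewrite -powR_mulrn ?mulr_ge0// ?(ltW q0)// -powR_mulrn ?powR_ge0// -powRrM.
  by rewrite divfK.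
rewrite /k (@powRM _ (1 + n%:R) (t ^+ 2)) ?addr_ge0 ?sqr_ge0//.
rewrite (@powRM _ 2 t) ?(ltW q0)//.
rewrite -(powR_mulrn 2 (ltW q0)) -powRrM.
rewrite [leRHS](_ : _ = (1 + n%:R) `^ (- s) * 2 `^ (n%:R / 2) *
   (t `^ (2%:R * - s) * t `^ (n%:R / 2))); last by ring.
rewrite -powRD; last by apply/implyP => _; rewrite gt_eqF.
by rewrite le_eqVlt; apply/orP; left; apply/eqP; congr (_ * _ `^ _); rewrite /gam /s; field.
Qed.

(** Cauchy-Schwarz on the small cube of half-side [d] around the vertex, where the
    kernel may be large; the bound [k] for the kernel elsewhere. *)
Let dot_indic_le (A : set 'rV[R]_n) (m : nat) q d k : 0 < q.1 -> 0 <= d -> 0 <= k ->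
  measurable A -> A `<=` cube 0 m%:R ->
  (forall y, A y -> ~ cube q.2 d y -> quad q y `^ (- s) <= k) ->
  normc (l2dot (rcplx (\1_A)) (ker q)) <=
  (2 * d) `^ (n%:R / 2) * hnorm (ker q) + k * (2 * m%:R) ^+ n.
Proof.
move=> q0 d0 k0 mA Am Ak.
have fin B : measurable B -> B `<=` A -> (leb B < +oo)%E.
  move=> mB BA; apply: (@le_lt_trans _ _ (leb (cube 0 m%:R))).
    by apply: le_measure; rewrite ?inE//; [exact: measurable_cube|exact: subset_trans Am].
  by rewrite lebesgue_cube ?ltry.
pose B := cube q.2 d; have mB : measurable B := measurable_cube q.2 d.
have mAB : measurable (A `&` B) by exact: measurableI.
have mAD : measurable (A `\` B) by exact: measurableD.
have [s1 h1] := sqint_indic mAB (fin _ mAB (@subIsetl _ _ _)).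
have [s2 h2] := sqint_indic mAD (fin _ mAD (@subDsetl _ _ _)).
have finm : (leb (cube 0 m%:R) < +oo)%E by rewrite lebesgue_cube ?ltry.
have [sm hm] := sqint_indic (measurable_cube 0 m%:R) finm.
have sK := ker2 q0; have K2 := is_L2_rcplx sK.
have L1 := is_L2_rcplx s1; have L2 := is_L2_rcplx s2.
have -> : rcplx (\1_A) = rcplx (\1_(A `&` B)) + rcplx (\1_(A `\` B)) :> fn.
  apply/funext => y; rewrite /rcplx !fctE -rmorphD; congr (_%:C%C).
  rewrite !indicE in_setD in_setI.
  by case: (y \in A); case: (y \in B); rewrite ?addr0 ?add0r.
rewrite l2dotDl// (le_trans (le_normcD _ _))// lerD//.
  rewrite (le_trans (cauchy_schwarz L1 K2))// ler_wpM2r ?hnorm_ge0//.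
  rewrite -(@ler_pXn2r _ 2)// ?nnegrE ?hnorm_ge0 ?powR_ge0// h1.
  rewrite -powR_mulrn ?powR_ge0// -powRrM divfK// powR_mulrn ?mulr_ge0//.
  rewrite -lee_fin fineK; last by rewrite ge0_fin_numE// fin//; exact: subIsetl.
  rewrite -(lebesgue_cube q.2 d0); apply: le_measure; rewrite ?inE//.
rewrite l2dot_rcplx// normcR.
have -> : (2 * m%:R) ^+ n = \int[leb]_y ((\1_(cube 0 m%:R) y : R) * \1_(cube 0 m%:R) y).
  transitivity (hnorm (rcplx (\1_(cube 0 m%:R) : 'rV[R]_n -> R)) ^+ 2).
    by rewrite hm lebesgue_cube.
  by rewrite hnorm_rcplx//; apply: eq_Rintegral => y _; rewrite expr2.
rewrite -RintegralZl//; last exact: sqintM.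
rewrite ger0_norm; last first.
  by apply: Rintegral_ge0 => y _; rewrite mulr_ge0 ?powR_ge0// indicE.
apply: le_Rintegral => //.
- exact: sqintM.
- have := integrableZl measurableT k (sqintM sm sm).
  by apply: eq_integrable => // y _ /=; rewrite EFinM.
- move=> y _; rewrite !indicE; have [yAB|yAB] := boolP (y \in A `\` B); last first.
    by rewrite mul0r !mulr_ge0.
  have [yA yB] := set_mem yAB.
  by rewrite (mem_set (Am _ yA)) !mulr1 mul1r; exact: Ak.
Qed.

Let ker_le q y b : 0 < b -> b <= quad q y -> quad q y `^ (- s) <= b `^ (- s).
Proof.
move=> b0 bQ; have Q0 := lt_le_trans b0 bQ.
rewrite !powRN lef_pV2 ?posrE ?powR_gt0//.
by apply: ge0_ler_powR; rewrite ?nnegrE ?(ltW s0) ?(ltW b0) ?(ltW Q0).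
Qed.

(** Outside a compact subset of the half-space [t] is small, or [t] is large, or
    [t] is bounded and [x] is far from the bounded set [A]. In each regime the
    kernel is, off a small cube, small compared with the lower bound of its
    norm. *)
Let vanishes_indic (A : set 'rV[R]_n) (m : nat) : measurable A ->
  A `<=` cube 0 m%:R -> vanishes (to_boundary R n)
    (fun q => normc (l2dot (rcplx (\1_A)) (ker q)) / hnorm (ker q)).
Proof.
move=> mA Am e e0; have [c c0 Hc] := hnorm_ker_ge.
have e4 : 0 < e / 4 by rewrite divr_gt0.
have [d' d'0 Hd] := powR_small n2 e4.
pose d := d' / 2; have d0 : 0 < d by rewrite divr_gt0.
have d20 : 0 < d ^+ 2 by rewrite exprn_gt0.
pose V : R := (2 * m%:R) ^+ n; have V0 : 0 <= V by rewrite exprn_ge0// mulr_ge0.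
pose eta := e / 4 * c / (V + 1).
have eta0 : 0 < eta by rewrite divr_gt0 ?mulr_gt0// ltr_wpDl.
(* thresholds for the three regimes, in the same order *)
have [a1 a10 H1] := powR_small gam0 (mulr_gt0 eta0 (powR_gt0 s d20)).
have [a2 a20 H2] := powR_small n2 eta0.
pose b := a2^-1; have b0 : 0 < b by rewrite invr_gt0.
have [a3 a30 H3] := powR_small s0 (mulr_gt0 eta0 (powR_gt0 (- gam) b0)).
pose w := 1 + a3^-1; have w1 : 1 <= w by rewrite lerDl invr_ge0 ltW.
have w20 : 0 < w ^+ 2 by rewrite exprn_gt0// (lt_le_trans ltr01).
have final q k : 0 < q.1 -> 0 <= k -> k * q.1 `^ gam <= eta ->
    (forall y, A y -> ~ cube q.2 d y -> quad q y `^ (- s) <= k) ->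
    normc (l2dot (rcplx (\1_A)) (ker q)) / hnorm (ker q) < e.
  move=> q0 k0 kq Hk; have Hq := Hc q q0.
  have tg : 0 < q.1 `^ gam by rewrite powR_gt0.
  have N0 : 0 < hnorm (ker q).
    by apply: lt_le_trans Hq; rewrite mulr_gt0// powR_gt0.
  rewrite ltr_pdivrMr//.
  apply: le_lt_trans (dot_indic_le q0 (ltW d0) k0 mA Am Hk) _.
  rewrite (_ : 2 * d = d'); last by rewrite /d mulrC divfK.
  have := Hd _ d'0 (lexx _); rewrite -/V => dd.
  have kV : k * V <= e / 4 * hnorm (ker q).
    apply: (@le_trans _ _ (e / 4 * (c * q.1 `^ (- gam)))); last first.
      by rewrite ler_wpM2l// ltW.
    rewrite powRN mulrA ler_pdivlMr// mulrAC.
    apply: (@le_trans _ _ (eta * V)); first by rewrite ler_wpM2r.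
    rewrite /eta mulrAC ler_pdivrMr ?ltr_wpDl// ler_wpM2l ?lerDl//.
    by rewrite mulr_ge0// ltW.
  have := ler_wpM2r (ltW N0) dd; have := mulr_gt0 e0 N0; lra.
exists (`[a1, b] `*` [set x : 'rV[R]_n | forall i,
    `[- (m%:R + w), m%:R + w]%classic (x ord0 i)]).
  split.
    apply: compact_setX; first exact: segment_compact.
    by apply: (@rV_compact _ _ (fun=> `[- (m%:R + w), m%:R + w]%classic)) => i;
      exact: segment_compact.
  move=> q [/= + _]; rewrite in_itv/= => /andP[aq _]; exact: lt_le_trans aq.
move=> q [/= q0]; rewrite /halfspace/= in q0; move=> nK.
have [qa|aq] := leP q.1 a1.
  apply: (final q ((d ^+ 2) `^ (- s))) => //; first exact: powR_ge0.
    by rewrite powRN mulrC ler_pdivrMr ?powR_gt0// H1.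
  move=> y _ ny; apply: ker_le => //.
  have [i ] : exists i, ~ (y ord0 i \in `[q.2 ord0 i - d, q.2 ord0 i + d]).
    by apply/existsNP.
  move=> /negP ni; have := sqnorm_ge_coord (q.2 - y) i; rewrite !mxE /quad.
  have := sqr_ge0 q.1; move: ni; rewrite in_itv/= negb_and -!ltNge => /orP[]; nra.
have [qb|bq] := leP b q.1.
  apply: (final q ((q.1 ^+ 2) `^ (- s))) => //; first exact: powR_ge0.
    rewrite -(powR_mulrn 2 (ltW q0)) -powRrM -powRD; last first.
      by apply/implyP => _; rewrite gt_eqF.
    rewrite (_ : 2%:R * - s + gam = - (n%:R / 2)); last by rewrite /s /gam; field.
    rewrite powRN -powR_inv1 ?powR_ge0// -powRrM mulrC powRrM powR_inv1 ?(ltW q0)//.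
    by apply: H2; rewrite ?invr_gt0// -[leRHS]invrK lef_pV2 ?posrE.
  by move=> y _ _; apply: ker_le; [rewrite exprn_gt0|exact: quad_ge_sqr].
have [i ni] : exists i, ~ (`[- (m%:R + w), m%:R + w]%classic (q.2 ord0 i)).
  apply/existsNP => H; apply: nK; split=> //=.
  by rewrite in_itv/= (ltW aq) (ltW bq).
apply: (final q ((w ^+ 2) `^ (- s))) => //; first exact: powR_ge0.
  have h3 : (w ^+ 2) `^ (- s) <= eta * b `^ (- gam).
    rewrite powRN -powR_inv1 ?powR_ge0// -powRrM mulrC powRrM powR_inv1 ?(ltW w20)//.
    apply: H3; first by rewrite invr_gt0.
    rewrite -[leRHS]invrK lef_pV2 ?posrE ?invr_gt0//.
    have : a3^-1 <= w by rewrite /w lerDr.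
    by move: w1; rewrite expr2; nra.
  have h4 : q.1 `^ gam <= b `^ gam.
    by apply: ge0_ler_powR; rewrite ?nnegrE ?ltW.
  apply: le_trans (ler_pM (powR_ge0 _ _) (powR_ge0 _ _) h3 h4) _.
  by rewrite -mulrA powRN mulVf ?mulr1// gt_eqF// powR_gt0.
move=> y Ay _; apply: ker_le => //.
have := Am _ Ay i; rewrite !mxE in_itv/= => /andP[y1 y2].
have := sqnorm_ge_coord (q.2 - y) i; rewrite !mxE /quad.
have := sqr_ge0 q.1; move/negP: ni; rewrite /= in_itv/= negb_and -!ltNge.
by move=> /orP[]; nra.
Qed.

Lemma near_halfspace : \forall q \near to_boundary R n, 0 < q.1.
Proof.
exists set0; first by split; [exact: compact0|].
by move=> q [].
Qed.

Lemma hnorm_cpoisson_gt0 q : 0 < q.1 -> 0 < hnorm (cpoisson sigma q).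
Proof.
move=> q0; rewrite cpoissonE hnormZ; last exact/is_L2_rcplx/ker2.
rewrite normcR mulr_gt0 ?normr_gt0 ?gt_eqF ?poisson_coef_gt0//.
have [c c0 /(_ q q0)] := hnorm_ker_ge; apply: lt_le_trans.
by rewrite mulr_gt0// powR_gt0.
Qed.

(** The normalized kernels are bounded, so that the indicators of bounded sets,
    which generate L2, suffice. *)
Lemma bvc f : is_L2 f -> vanishes (to_boundary R n)
  (fun q => normc (l2dot f (cpoisson sigma q)) / hnorm (cpoisson sigma q)).
Proof.
pose r q : fn := ((hnorm (cpoisson sigma q))^-1)%:C%C *: cpoisson sigma q.
have r2 : \forall q \near to_boundary R n, is_L2 (r q).
  apply: filterS near_halfspace => q q0; apply: is_L2Z; exact: is_L2_cpoisson.
have r1 : \forall q \near to_boundary R n, hnorm (r q) <= 1.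
  apply: filterS near_halfspace => q q0.
  rewrite hnormZ; last exact: is_L2_cpoisson.
  rewrite normcR ger0_norm ?invr_ge0 ?hnorm_ge0// mulVf//.
  by rewrite gt_eqF// hnorm_cpoisson_gt0.
have nr g q : is_L2 g -> 0 < q.1 -> normc (l2dot (r q) g) =
    normc (l2dot g (cpoisson sigma q)) / hnorm (cpoisson sigma q).
  move=> g2 q0; have h2 := is_L2_cpoisson sigma0 q0.
  rewrite l2dotZl// Normc.normcM normcR ger0_norm ?invr_ge0 ?hnorm_ge0//.
  by rewrite mulrC (l2dotC g2 h2) normcJ.
have cG := @l2closed_weak _ _ _ _ (to_boundary_filter n) r 1 r2 r1.
move=> f2; have [] := @l2closed_simple _ _ _ cG (cst 1) (fun m => cube 0 m%:R)
  _ _ _ _ _ f f2.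
- exact: measurable_cst.
- by move=> y; exact: ltr01.
- by move=> m; exact: measurable_cube.
- move=> y; exists (\sum_(i < n) (Num.trunc `|y ord0 i|).+1)%N => // m /= Mm i.
  rewrite mxE sub0r add0r in_itv/= -ler_norml (le_trans (ltW (truncnS_gt _)))//.
  by rewrite ler_nat (leq_trans _ Mm)// (bigD1 i)//= leq_addr.
- move=> m A mA Am.
  rewrite (_ : (fun y => _) = \1_A); last by apply/funext => y; rewrite mul1r.
  have fin : (leb A < +oo)%E.
    apply: (@le_lt_trans _ _ (leb (cube 0 m%:R))).
      by apply: le_measure; rewrite ?inE//; exact: measurable_cube.
    by rewrite lebesgue_cube ?ltry.
  have [sA _] := sqint_indic mA fin; have A2 := is_L2_rcplx sA.
  split=> // e e0; apply: filterS2 near_halfspace (vanishes_indic mA Am e0) => q q0.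
  rewrite nr// cpoissonE hnormZ; last exact/is_L2_rcplx/ker2.
  rewrite l2dotZr//; last exact/is_L2_rcplx/ker2.
  rewrite Normc.normcM normcJ -mulf_div divff ?mul1r//.
  by rewrite normcR normr_eq0 gt_eqF// poisson_coef_gt0.
- move=> _ v e e0; apply: filterS2 near_halfspace (v e e0) => q q0.
  by rewrite nr.
Qed.

End BVC.

(** * Linear independence of kernels with distinct singularities *)

Section NoRelation.
Context {R : realType}.
Local Notation toC := (real_complex R).
Local Notation term := ({poly R} * R * {poly R})%type.
Implicit Types (p Q : {poly R}) (t : term) (b x : R) (L : seq term).

(** The triple [(Q, b, p)] stands for the function [p * Q `^ (- b)]. *)
Definition tval t x : R := t.2.[x] * t.1.1.[x] `^ (- t.1.2).

Lemma poly_eq0 p : (forall x : R, p.[x] = 0) -> p = 0.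
Proof.
move=> p0; apply/eqP; apply: contraT => pn0.
pose r := [seq (i%:R : R) | i <- iota 0 (size p)].
have : (size r < size p)%N.
  apply: max_poly_roots => //.
  - by apply/allP => x _; rewrite rootE p0.
  - by rewrite map_inj_uniq ?iota_uniq//; by move=> i j /eqP; rewrite eqr_nat => /eqP.
by rewrite size_map size_iota ltnn.
Qed.

Variable zeta : R[i].
Definition evC p : R[i] := (map_poly toC p).[zeta].

Lemma evCM p q : evC (p * q) = evC p * evC q.
Proof. by rewrite /evC rmorphM hornerM. Qed.
Lemma evCD p q : evC (p + q) = evC p + evC q.
Proof. by rewrite /evC rmorphD hornerD. Qed.
Lemma evCN p : evC (- p) = - evC p.
Proof. by rewrite /evC rmorphN hornerN. Qed.
Lemma evCC b : evC b%:P = toC b.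
Proof. by rewrite /evC map_polyC hornerC. Qed.

(** Such a [Q] does not vanish at [zeta], so that its term is regular there. *)
Definition good t := (forall x : R, 0 < t.1.1.[x]) /\ evC t.1.1 != 0.

Lemma is_derive_tval t x : (forall x : R, 0 < t.1.1.[x]) ->
  is_derive x 1 (tval t) (t.2^`().[x] * t.1.1.[x] `^ (- t.1.2) +
    t.2.[x] * (- t.1.2 * t.1.1.[x] `^ (- t.1.2 - 1) * t.1.1^`().[x])).
Proof.
move=> Q0; have d1 := is_derive_poly t.2 x; have d2 := is_derive_poly t.1.1 x.
have d3 := is_derive1_powR (- t.1.2) (Q0 x).
have d4 := is_derive1_comp d3 d2.
have := is_deriveM d1 d4; rewrite (_ : _ * _ = tval t); last exact/funext.
by move/is_derive_eq; apply; rewrite /GRing.scale/= addrC; congr (_ + _); rewrite mulrC.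
Qed.

(** One step of elimination: applying [Q1 d/dx + b1 Q1'] to a term. *)
Definition elim_step (Q1 : {poly R}) b1 t : term :=
  (t.1.1, t.1.2 + 1,
   t.2^`() * Q1 * t.1.1 + b1%:P * t.2 * Q1^`() * t.1.1
     - t.1.2%:P * t.2 * Q1 * t.1.1^`()).

Lemma elim_stepE Q1 b1 t x : (forall x : R, 0 < t.1.1.[x]) ->
  tval (elim_step Q1 b1 t) x =
  Q1.[x] * (t.2^`().[x] * t.1.1.[x] `^ (- t.1.2) +
    t.2.[x] * (- t.1.2 * t.1.1.[x] `^ (- t.1.2 - 1) * t.1.1^`().[x])) +
  b1 * Q1^`().[x] * tval t x.
Proof.
move=> Q0; rewrite /tval /elim_step/= !(hornerD, hornerN, hornerM, hornerC).
have e : t.1.1.[x] `^ (- t.1.2) = t.1.1.[x] * t.1.1.[x] `^ (- t.1.2 - 1).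
  rewrite -{2}(powRr1 (ltW (Q0 x))) -powRD; last by apply/implyP => _; rewrite gt_eqF.
  by congr (_ `^ _); ring.
by rewrite e opprD; ring.
Qed.

(** A term singular at [zeta] cannot cancel terms regular at [zeta]. Multiplying
    the relation by [Q1 `^ b1], for a regular term [p1 * Q1 `^ (- b1)], and
    differentiating lowers the degree of [p1]; the coefficient of the singular
    term stays nonzero at [zeta], its exponent increases. Once [p1] is zero that
    term is dropped. In the end the singular term alone would vanish. *)
Lemma no_relation (t0 : term) L : (forall x : R, 0 < t0.1.1.[x]) ->
  evC t0.1.1 = 0 -> evC t0.1.1^`() != 0 -> evC t0.2 != 0 -> 0 < t0.1.2 ->
  (forall i, (i < size L)%N -> good (nth t0 L i)) ->
  ~ (forall x : R, tval t0 x + \sum_(t <- L) tval t x = 0).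
Proof.
have [k] := ubnP (size L); elim: k => // k IHk in t0 L *.
case: L => [|t1 L] sL Q0 z0 z0' p0 b0 gL H.
  move: p0; rewrite (_ : t0.2 = 0) ?/evC ?rmorph0 ?horner0 ?eqxx//.
  apply: poly_eq0 => x; have := H x; rewrite big_nil addr0 /tval => /eqP.
  by rewrite mulf_eq0 (gt_eqF (powR_gt0 _ (Q0 x))) orbF => /eqP.
have [m] := ubnP (size t1.2).
elim: m => // m IHm in t0 t1 L sL Q0 z0 z0' p0 b0 gL H *.
have [p10|p1n0] := eqVneq t1.2 0.
  move=> _; apply: (IHk t0 L) => //.
    by move=> i iL; exact: (gL i.+1).
  move=> x; have := H x; rewrite big_cons {2}/tval p10 horner0 mul0r add0r.
  by [].
move=> sm.
have g1 : good t1 := gL 0%N isT.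
have gQ i : (i < size L)%N -> good (nth t0 L i) by move=> iL; exact: (gL i.+1).
pose D (t : term) x : R := t.2^`().[x] * t.1.1.[x] `^ (- t.1.2) +
    t.2.[x] * (- t.1.2 * t.1.1.[x] `^ (- t.1.2 - 1) * t.1.1^`().[x]).
have sumD L' : (forall i, (i < size L')%N -> good (nth t0 L' i)) -> forall x,
    is_derive x 1 (fun x => \sum_(t <- L') tval t x) (\sum_(t <- L') D t x).
  elim: L' => [_ x|t L' IH gL' x].
    rewrite big_nil (_ : (fun _ => _) = cst 0); first exact: is_derive_cst.
    by apply/funext => ?; rewrite big_nil.
  have gt : good t := gL' 0%N isT.
  have d1 := is_derive_tval x gt.1.
  have d2 := IH (fun i iL => gL' i.+1 iL) x.
  have := is_deriveD d1 d2; rewrite big_cons.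
  by rewrite (_ : _ + _ = fun x => \sum_(t <- t :: L') tval t x)//; apply/funext => ?;
    rewrite big_cons.
have HD x : D t0 x + (D t1 x + \sum_(t <- L) D t x) = 0.
  have d1 := is_derive_tval x Q0; have d2 := sumD _ gL x.
  have d3 := is_deriveD d1 d2; rewrite big_cons in d3.
  have <- := @derive_val _ _ _ _ _ _ _ d3.
  rewrite (_ : _ + _ = cst 0); first exact: derive_cst.
  by apply/funext => y; rewrite -[RHS](H y).
pose S := elim_step t1.1.1 t1.1.2.
pose t1' : term := (t1.1.1, t1.1.2 - 1, t1.2^`()).
have Snth i : (i < size L)%N -> (nth (S t0) (map S L) i).1.1 = (nth t0 L i).1.1.
  by move=> iL; rewrite (nth_map t0).
apply: (IHm (S t0) t1' (map S L)) => //.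
- by rewrite /= size_map.
- rewrite /S /elim_step/= !(evCD, evCN, evCM) z0 !mulr0 !add0r oppr_eq0.
  rewrite !mulf_neq0//; first by rewrite evCC fmorph_eq0 gt_eqF.
  exact: g1.2.
- by rewrite /= addr_gt0.
- move=> [|i] /=; first by [].
  by rewrite size_map ltnS => iL; rewrite /good !Snth//; exact: gQ.
- move=> x.
  have E : t1.1.1.[x] * (D t0 x + (D t1 x + \sum_(t <- L) D t x)) +
     t1.1.2 * t1.1.1^`().[x] * (tval t0 x + \sum_(t <- t1 :: L) tval t x) = 0.
    by rewrite HD H !mulr0 addr0.
  rewrite -[RHS]E !big_cons big_map elim_stepE//.
  have e1 : tval t1' x = t1.1.1.[x] * D t1 x + t1.1.2 * t1.1.1^`().[x] * tval t1 x.
    rewrite /tval /D /t1'/=.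
    have e : t1.1.1.[x] `^ (- t1.1.2) = t1.1.1.[x] * t1.1.1.[x] `^ (- t1.1.2 - 1).
      rewrite -{2}(powRr1 (ltW (g1.1 x))) -powRD; last first.
        by apply/implyP => _; rewrite gt_eqF// g1.1.
      by congr (_ `^ _); ring.
    have e' : t1.1.1.[x] `^ (- (t1.1.2 - 1)) = t1.1.1.[x] * t1.1.1.[x] `^ (- t1.1.2).
      rewrite -{2}(powRr1 (ltW (g1.1 x))) -powRD; last first.
        by apply/implyP => _; rewrite gt_eqF// g1.1.
      by congr (_ `^ _); ring.
    by rewrite e' e; ring.
  have e2 : \sum_(t <- L) tval (S t) x = t1.1.1.[x] * (\sum_(t <- L) D t x) +
      t1.1.2 * t1.1.1^`().[x] * (\sum_(t <- L) tval t x).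
    rewrite !mulr_sumr -big_split/= (big_nth t0) [RHS](big_nth t0) !big_mkord.
    by apply: eq_bigr => i _; rewrite elim_stepE//; exact: (gQ i (ltn_ord i)).1.
  by rewrite e1 e2 -/(D t0 x); ring.
- rewrite /=; apply: leq_trans (lt_size_deriv p1n0) _; exact: sm.
Qed.

End NoRelation.

Section Jets.
Context {R : realType} {n : nat}.
Local Notation leb := (lebesgue_rV R n).
Local Notation fn := ('rV[R]_n -> R[i]).
Local Notation normc := Normc.normc.
Local Notation toC := (real_complex R).
Implicit Types (p q : R * 'rV[R]_n) (y v : 'rV[R]_n) (l : seq (option 'I_n)).
Implicit Types (lam : option 'I_n -> R).

Variable s : R.

(** The functions spanning the parameter derivatives of the kernels at [p]. *)
Definition jetf p l y : R :=
  (\prod_(i <- l) dirf p i y) * quad p y `^ (- (s + (size l)%:R)).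

Let continuous_coordB p (j : 'I_n) : continuous (fun y : 'rV[R]_n => p.2 ord0 j - y ord0 j).
Proof.
move=> y; apply: (@cvgB _ _ _ (nbhs y) _ (cst (p.2 ord0 j)) (fun y : 'rV[R]_n => y ord0 j)).
  exact: cvg_cst.
exact: coord_continuous.
Qed.

Lemma continuous_dirf p i : continuous (dirf p i).
Proof. by case: i => [j|]; [exact: continuous_coordB|exact: cst_continuous]. Qed.

Lemma continuous_quad p : continuous (quad p).
Proof.
move=> y; apply: (@cvgD _ _ _ (nbhs y) _ (cst (p.1 ^+ 2)) (fun y => sqnorm (p.2 - y))).
  exact: cvg_cst.
apply: (@cvg_big R _ +%R 0 xpredT (@add_continuous _)) => i _.
rewrite (_ : (fun x : 'rV[R]_n => _) = fun x : 'rV[R]_n => (p.2 ord0 i - x ord0 i) ^+ 2).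
  rewrite !mxE; have H := @continuous_coordB p i y.
  by have := cvgM H H; apply.
by apply/funext => x; rewrite !mxE.
Qed.

Lemma continuous_quad_powR p b : 0 < p.1 -> continuous (fun y => quad p y `^ b).
Proof.
move=> p0 y; have Q0 := quad_gt0 y p0.
apply: (@continuous_comp _ _ _ (quad p) (fun x => x `^ b)); first exact: continuous_quad.
have [d _] := is_derive1_powR b Q0.
by move/derivable1_diffP : d => /differentiable_continuous.
Qed.

Lemma continuous_jetf p l : 0 < p.1 -> continuous (jetf p l).
Proof.
move=> p0 y; apply: (@cvgM _ _ (nbhs y) _ (fun y => \prod_(i <- l) dirf p i y)
  (fun y => quad p y `^ _)); last exact: continuous_quad_powR.
by apply: (@cvg_big R _ *%R 1 xpredT (@mul_continuous _)) => i _; exact: continuous_dirf.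
Qed.

Lemma continuous_lin p lam : continuous (lin p lam).
Proof.
move=> y; apply: (@cvg_big R _ +%R 0 xpredT (@add_continuous _)) => [|i _].
  exact: nbhs_filter.
apply: (@cvgM _ _ (nbhs y) _ (cst (lam i)) (dirf p i)); first exact: cvg_cst.
exact: continuous_dirf.
Qed.

(** A nonempty open set contains a cube, which has positive measure. *)
Lemma ae_eq0_continuous (a : 'rV[R]_n -> R) : continuous a ->
  {ae leb, forall y, a y = 0} -> forall y, a y = 0.
Proof.
move=> ca [N [mN N0 aN]] y; apply/eqP; apply: contraT => ay0.
have H0 : nbhs (a y) [set x : R | x != 0].
  by apply: open_nbhs_nbhs; split => //; exact: open_neq.
have /nbhs_ballP[e /= e0 He] := ca y _ H0.
have sub : cube y (e / 2) `<=` N.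
  move=> x xy; apply: aN => /= ax; have : a x != 0; last by rewrite ax eqxx.
  apply: He; split=> // i j; rewrite (ord1 i) /ball/=.
  have := xy j; rewrite in_itv/= => /andP[x1 x2].
  rewrite ltr_norml; apply/andP; split; have := e0; lra.
have e2 : 0 < e / 2 by rewrite divr_gt0.
have : (leb (cube y (e / 2)) <= leb N)%E.
  by apply: le_measure; rewrite ?inE//; exact: measurable_cube.
rewrite N0 lebesgue_cube ?(ltW e2)// lee_fin leNgt exprn_gt0// mulr_gt0//.
Qed.

(** ** Restriction to lines through the vertex of a kernel *)

Definition dotp (x v : 'rV[R]_n) := \sum_(j < n) x ord0 j * v ord0 j.

(** [quad q] and [dirf q i] along the line [p.2 + x *: v]. *)
Definition lquad p v q : {poly R} :=
  (q.1 ^+ 2 + sqnorm (q.2 - p.2))%:P - (2 * dotp (q.2 - p.2) v) *: 'X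
   + sqnorm v *: 'X^2.

Definition ldir p v q i : {poly R} :=
  if i is Some j then (q.2 ord0 j - p.2 ord0 j)%:P - v ord0 j *: 'X else q.1%:P.

Lemma lquadE p v q x : (lquad p v q).[x] = quad q (p.2 + x *: v).
Proof.
rewrite /lquad !(hornerD, hornerN, hornerZ, hornerC, hornerX, hornerXn) /quad.
suff : sqnorm (q.2 - (p.2 + x *: v)) = sqnorm (q.2 - p.2) -
    2 * dotp (q.2 - p.2) v * x + sqnorm v * x ^+ 2 by move=> ->; ring.
rewrite /sqnorm /dotp mulr_sumr !mulr_suml -sumrB -big_split/=.
by apply: eq_bigr => j _; rewrite !mxE; ring.
Qed.

Lemma ldirE p v q i x : (ldir p v q i).[x] = dirf q i (p.2 + x *: v).
Proof.
case: i => [j|] /=; last by rewrite hornerC.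
by rewrite !(hornerD, hornerN, hornerZ, hornerC, hornerX) !mxE; ring.
Qed.

(** Points on the moment curve avoid finitely many hyperplanes. *)
Lemma generic_direction (ds : seq 'rV[R]_n) : (1 <= n)%N ->
  exists v : 'rV[R]_n, 0 < sqnorm v /\
    forall d, d \in ds -> d != 0 -> dotp d v != 0.
Proof.
move=> n1; pose P (d : 'rV[R]_n) : {poly R} := \poly_(j < n) d ord0 (insubd (Ordinal n1) j).
have Pneq0 d : d != 0 -> P d != 0.
  apply: contra => /eqP Pd; apply/eqP/rowP => j; rewrite mxE.
  have := coef_poly n (fun j => d ord0 (insubd (Ordinal n1) j)) j.
  by rewrite -/(P d) Pd coef0 ltn_ord valKd.
have : \prod_(d <- ds | d != 0) P d != 0
  by rewrite prodf_seq_neq0; apply/allP => d _; apply/implyP; exact: Pneq0.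
move=> Pi0; have [a Pa] : exists a, (\prod_(d <- ds | d != 0) P d).[a] != 0.
  apply: contrapT => H; move/eqP : Pi0; apply; apply: poly_eq0 => x.
  by apply/eqP; apply: contraT => hx; exfalso; apply: H; exists x.
exists (\row_j a ^+ j); split.
  apply: (@lt_le_trans _ _ ((\row_(j < n) a ^+ j) ord0 (Ordinal n1) ^+ 2)).
    by rewrite mxE/= expr0 expr1n.
  exact: sqnorm_ge_coord.
move=> d dds d0; move: Pa; rewrite horner_prod; apply: contra => /eqP dv.
rewrite prodf_seq_eq0; apply/hasP; exists d => //; rewrite d0/=.
rewrite horner_poly; apply/eqP; rewrite -[RHS]dv; apply: eq_bigr => j _.
by rewrite mxE valKd.
Qed.

Section line.
Variables (p : R * 'rV[R]_n) (v : 'rV[R]_n).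
Hypotheses (p0 : 0 < p.1) (v0 : 0 < sqnorm v).

(** The singularity, on the complexified line, of the kernel at [p]. *)
Let zeta : R[i] := Complex 0 (p.1 / Num.sqrt (sqnorm v)).

Let evC_quadratic (a b c : R) : evC zeta (a%:P - b *: 'X + c *: 'X^2) =
  Complex (a - c * (p.1 ^+ 2 / sqnorm v)) (- (b * (p.1 / Num.sqrt (sqnorm v)))).
Proof.
have -> : c *: 'X^2 = (c *: 'X) * 'X :> {poly R} by rewrite expr2 scalerAl.
rewrite evCD evCD evCN evCM.
have eX k : evC zeta (k *: 'X) = real_complex R k * zeta.
  by rewrite /evC map_polyZ map_polyX hornerZ hornerX.
have [r [r0 rE nE]] : exists r, [/\ r != 0, Num.sqrt (sqnorm v) = r & sqnorm v = r ^+ 2].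
  exists (Num.sqrt (sqnorm v)); split => //; first by rewrite gt_eqF// sqrtr_gt0.
  by rewrite sqr_sqrtr// ltW.
rewrite evCC !eX /evC map_polyX hornerX /zeta rE nE; apply/eqP; rewrite eq_complex /=.
by apply/andP; split; apply/eqP; field.
Qed.

Let evC_lquad q : evC zeta (lquad p v q) =
  Complex (q.1 ^+ 2 + sqnorm (q.2 - p.2) - p.1 ^+ 2)
          (- (2 * dotp (q.2 - p.2) v * (p.1 / Num.sqrt (sqnorm v)))).
Proof. by rewrite /lquad evC_quadratic mulrC divfK// gt_eqF. Qed.

Let sqnorm00 : sqnorm (0 : 'rV[R]_n) = 0.
Proof. by rewrite /sqnorm big1// => j _; rewrite mxE expr0n. Qed.

Let dotp0 : dotp 0 v = 0.
Proof. by rewrite /dotp big1// => j _; rewrite mxE mul0r. Qed.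

Let evC_lquad_p : evC zeta (lquad p v p) = 0.
Proof.
rewrite evC_lquad subrr sqnorm00 dotp0 addr0 subrr.
by apply/eqP; rewrite eq_complex/= mulr0 mul0r oppr0 !eqxx.
Qed.

Let evC_lquad_deriv : evC zeta (lquad p v p)^`() != 0.
Proof.
rewrite /lquad subrr sqnorm00 dotp0 addr0 mulr0 scale0r subr0.
rewrite derivD derivC add0r derivZ derivXn expr1.
have -> : sqnorm v *: ('X *+ 2) = 0%:P - (- (sqnorm v * 2)) *: 'X + 0 *: 'X^2 :> {poly R}.
  by rewrite scale0r addr0 sub0r scaleNr opprK -scalerA -scaler_nat.
rewrite evC_quadratic eq_complex/= negb_and; apply/orP; right.
rewrite oppr_eq0 !mulf_neq0 ?oppr_eq0 ?invr_eq0 ?gt_eqF ?mulr_gt0// sqrtr_gt0//.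
Qed.

Let evC_lquad_neq0 q : q != p -> 0 < q.1 ->
  (q.2 - p.2 != 0 -> dotp (q.2 - p.2) v != 0) -> evC zeta (lquad p v q) != 0.
Proof.
move=> qp q0 H; rewrite evC_lquad eq_complex/= negb_and.
have [e|d0] := eqVneq (q.2 - p.2) 0; last first.
  apply/orP; right; rewrite oppr_eq0 mulf_neq0//; last first.
    by rewrite mulf_neq0 ?invr_eq0 ?gt_eqF// sqrtr_gt0.
  by rewrite mulf_neq0// H.
apply/orP; left; rewrite e sqnorm00 addr0 subr_eq0; apply: contra qp.
rewrite eqrXn2 ?(ltW q0) ?(ltW p0)// => /eqP q1.
apply/eqP; move: e q1; clear -q p; case: q p => [a x] [b y] /= /eqP.
by rewrite subr_eq0 => /eqP -> ->.
Qed.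

Definition jterm q l : {poly R} * R * {poly R} :=
  (lquad p v q, s + (size l)%:R, \prod_(i <- l) ldir p v q i).

Lemma tval_jterm q l x : tval (jterm q l) x = jetf q l (p.2 + x *: v).
Proof.
rewrite /tval /jterm/= lquadE /jetf; congr (_ * _).
by rewrite horner_prod; apply: eq_bigr => i _; rewrite ldirE.
Qed.

Variables (N : nat) (qs : seq (R * 'rV[R]_n)).
Hypothesis qs0 : forall q, q \in qs -> 0 < q.1.

Definition jetgen (g : fn) := exists q l,
  [/\ q \in qs, q = p -> (size l < N)%N & g = rcplx (jetf q l)].

(** Then the kernels at other points do not become singular at [zeta]. *)
Hypothesis vgen : forall q, q \in qs -> q.2 - p.2 != 0 -> dotp (q.2 - p.2) v != 0.

(** On the line, jets at other points become terms regular at [zeta], while jets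
    of order less than [N] at [p] acquire a factor [lquad p v p], which vanishes
    at [zeta], when written with the exponent [- (s + N)]. *)
Let lspan_line g : lspan jetgen g -> exists (r : {poly R}) L,
  (forall i, (i < size L)%N -> good zeta (nth (jterm p [::]) L i)) /\
  forall x, complex.Re (g (p.2 + x *: v)) =
    (r * lquad p v p).[x] * quad p (p.2 + x *: v) `^ (- (s + N%:R)) +
    \sum_(t <- L) tval t x.
Proof.
elim=> [|c f u [q [l [qqs ql ->]]] _ [r [L [gL HL]]]].
  by exists 0, [::]; split => // x; rewrite big_nil mul0r horner0 mul0r addr0.
have ReE y : complex.Re ((c *: rcplx (jetf q l) + u) y) =
    complex.Re c * jetf q l y + complex.Re (u y).
  by rewrite !fctE /rcplx; case: c (u y) => [a b] [a' b'] /=; rewrite mulr0 subr0.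
have [qp|qp] := eqVneq q p.
  have lN := ql qp; pose k := (N - size l).-1.
  have Nk : N%:R = (size l)%:R + k.+1%:R :> R.
    by rewrite -natrD prednK ?subn_gt0// subnKC// ltnW.
  exists (r + complex.Re c *: (\prod_(i <- l) ldir p v p i * lquad p v p ^+ k)), L.
  split=> // x; rewrite ReE HL qp addrA; congr (_ + _).
  have -> : jetf p l (p.2 + x *: v) = (\prod_(i <- l) ldir p v p i).[x] *
      (lquad p v p).[x] ^+ k.+1 * quad p (p.2 + x *: v) `^ (- (s + N%:R)).
    rewrite /jetf horner_prod lquadE; under [in RHS]eq_bigr do rewrite ldirE.
    have Q0 := quad_gt0 (p.2 + x *: v) p0; set Q := quad p _ in Q0 *.
    have -> : - (s + (size l)%:R) = k.+1%:R + - (s + N%:R) by rewrite Nk; ring.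
    rewrite powRD; last by apply/implyP => _; rewrite gt_eqF.
    by rewrite powR_mulrn ?(ltW Q0)// mulrA.
  by rewrite !(hornerM, hornerD, hornerZ, horner_exp) exprSr; ring.
exists r, ((lquad p v q, s + (size l)%:R, complex.Re c *: (jterm q l).2) :: L).
split=> [[|i] /= iL|x].
- split=> /= [x|]; first by rewrite lquadE quad_gt0 ?qs0.
  by apply: evC_lquad_neq0; [exact: qp|exact: qs0|exact: vgen].
- exact: gL.
- rewrite ReE HL big_cons addrCA; congr (_ + (_ + _)).
  by rewrite -tval_jterm /tval/= hornerZ mulrA.
Qed.

Let lspan_continuous g : lspan jetgen g -> continuous (fun y => complex.Re (g y)).
Proof.
elim=> [|c f u [q [l [qqs ql ->]]] _ IH].
  exact: cst_continuous.
rewrite (_ : (fun y => _) = fun y => complex.Re c * jetf q l y + complex.Re (u y)).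
  move=> y; apply: (@cvgD _ _ _ (nbhs y) _ (fun y => complex.Re c * jetf q l y)
    (fun y => complex.Re (u y))); last exact: IH.
  apply: (@cvgM _ _ (nbhs y) _ (cst (complex.Re c)) (jetf q l)); first exact: cvg_cst.
  by apply: continuous_jetf; exact: qs0.
apply/funext => y.
by rewrite !fctE /rcplx; case: c (u y) => [a b] [a' b'] /=; rewrite mulr0 subr0.
Qed.

Hypothesis s0 : 0 < s.
Variable lam : option 'I_n -> R.
Hypothesis lam0 : (N == 0)%N || (lam None != 0) || (dotp (\row_j lam (Some j)) v != 0).

Lemma jet_not_in_lspan g : lspan jetgen g ->
  ~ {ae leb, forall y,
      rcplx (fun y => lin p lam y ^+ N * quad p y `^ (- (s + N%:R))) y = g y}.
Proof.
move=> gs ae0; have [r [L [gL HL]]] := lspan_line (lspanZ (-1) gs).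
pose a y := lin p lam y ^+ N * quad p y `^ (- (s + N%:R)) - complex.Re (g y).
have ca : continuous a.
  move=> y; apply: (@cvgB _ _ _ (nbhs y) _
    (fun y => lin p lam y ^+ N * quad p y `^ (- (s + N%:R)))
    (fun y => complex.Re (g y))); last exact: lspan_continuous.
  apply: (@cvgM _ _ (nbhs y) _ (fun y => lin p lam y ^+ N)
    (fun y => quad p y `^ (- (s + N%:R)))); last exact: continuous_quad_powR.
  apply: (@continuous_comp _ _ _ (lin p lam) (fun x : R => x ^+ N)).
    exact: continuous_lin.
  exact: exprn_continuous.
have a0 : forall y, a y = 0.
  apply: ae_eq0_continuous => //; apply: filterS ae0 => y.
  by rewrite /a => <- /=; rewrite subrr.
pose ell : {poly R} := \sum_i lam i *: ldir p v p i.
have ellE x : ell.[x] = lin p lam (p.2 + x *: v).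
  by rewrite /ell horner_sum; apply: eq_bigr => i _; rewrite hornerZ ldirE.
pose t0 : {poly R} * R * {poly R} := (lquad p v p, s + N%:R, ell ^+ N + r * lquad p v p).
have evell : (N == 0)%N || (evC zeta ell != 0).
  have -> : ell = (lam None * p.1)%:P - dotp (\row_j lam (Some j)) v *: 'X + 0 *: 'X^2.
    rewrite scale0r addr0 /ell (bigD1 None)//= -mul_polyC -polyCM; congr (_ + _).
    rewrite (reindex_omap (fun j : 'I_n => Some j) id) => [|[j|]//].
    rewrite /dotp scaler_suml -sumrN; apply: eq_big => [j|j _]; first by rewrite eqxx.
    by rewrite /= subrr sub0r scalerN scalerA mxE.
  have r0 : Num.sqrt (sqnorm v) != 0 by rewrite gt_eqF// sqrtr_gt0.
  rewrite evC_quadratic eq_complex/= mul0r subr0 negb_and oppr_eq0.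
  case/orP: lam0 => [/orP[->//|l]|l]; apply/orP; right; apply/orP; [left|right].
    by rewrite mulf_neq0// gt_eqF.
  by rewrite !mulf_neq0 ?invr_eq0// gt_eqF.
apply: (@no_relation _ zeta t0 L) => //.
- by move=> x; rewrite lquadE quad_gt0.
- rewrite /= evCD evCM evC_lquad_p mulr0 addr0.
  have -> : evC zeta (ell ^+ N) = evC zeta ell ^+ N by rewrite /evC rmorphXn horner_exp.
  move: evell; case: (N) => [_|k /= e]; first by rewrite expr0 oner_neq0.
  by rewrite expf_neq0.
- by rewrite ltr_wpDr.
- by move=> i iL; rewrite (set_nth_default (jterm p [::]))//; exact: gL.
- move=> x; have := HL x.
  have -> : complex.Re ((-1 *: g) (p.2 + x *: v)) = - complex.Re (g (p.2 + x *: v)).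
    by rewrite scaleN1r !fctE; case: (g _).
  have -> : tval t0 x = lin p lam (p.2 + x *: v) ^+ N *
      quad p (p.2 + x *: v) `^ (- (s + N%:R)) +
      (r * lquad p v p).[x] * quad p (p.2 + x *: v) `^ (- (s + N%:R)).
    by rewrite /tval/= hornerD horner_exp ellE lquadE mulrDl.
  by have := a0 (p.2 + x *: v); rewrite /a => + E; rewrite -addrA -E.
Qed.

End line.

(** On a generic line through [p.2], with everything at [p] brought to the exponent
    [- (s + N)], the left-hand side is the only singular term whose coefficient
    does not vanish at the complex zero of [quad p]. *)
Theorem jets_independent (p : R * 'rV[R]_n) (N : nat) (qs : seq (R * 'rV[R]_n)) lam g :
  (1 <= n)%N -> 0 < s -> 0 < p.1 -> (forall q, q \in qs -> 0 < q.1) ->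
  (N = 0)%N \/ l1 lam != 0 -> lspan (jetgen p N qs) g ->
  ~ {ae leb, forall y,
      rcplx (fun y => lin p lam y ^+ N * quad p y `^ (- (s + N%:R))) y = g y}.
Proof.
move=> n1 s0 p0 qs0 lamN gs.
have [v [v0 vgen]] := generic_direction
  ((\row_j lam (Some j)) :: [seq q.2 - p.2 | q <- qs]) n1.
apply: (jet_not_in_lspan p0 v0 qs0) gs => //.
  by move=> q qqs; apply: vgen; rewrite inE; apply/orP; right; exact: map_f.
case: lamN => [->//|l0].
have [lN|_] := eqVneq (lam None) 0; last by rewrite orbT.
apply/orP; right; apply: vgen; first by rewrite inE eqxx.
apply: contra l0 => /eqP/rowP r0; rewrite /l1 big_option lN normr0 add0r.
by rewrite big1// => j _; have := r0 j; rewrite !mxE => ->; rewrite normr0.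
Qed.

End Jets.

(** * Parameter derivatives of the Poisson kernels *)

Section Derivatives.
Context {R : realType} {n : nat}.
Local Notation leb := (lebesgue_rV R n).
Local Notation fn := ('rV[R]_n -> R[i]).
Local Notation pt := (R * 'rV[R]_n)%type.
Local Notation dirs := (seq (option 'I_n)).
Implicit Types (p q : pt) (y v : 'rV[R]_n) (l : dirs) (i : option 'I_n).
Implicit Types (L : seq (R * R * dirs)).

(** Reduces partial derivatives to one variable. *)
Lemma derive_line (F : pt -> R) q (v : pt) : 'D_v F q = 'D_1 (fun h : R => F (q + h *: v)) 0.
Proof.
rewrite /derive.
have -> // : (fun h : R => h^-1 *:
    (((fun h0 : R => F (q + h0 *: v)) \o shift 0) (h *: (1 : R)) - F (q + 0 *: v))) =
  (fun h : R => h^-1 *: ((F \o shift q) (h *: v) - F q)).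
apply/funext => h /=.
have e : h *: (1 : R) = h by rewrite /GRing.scale/= mulr1.
by rewrite scale0r !addr0 e [q + _]addrC.
Qed.

Lemma param_dir_line1 q i (h : R) :
  (q + h *: param_dir i).1 = q.1 + h * (i == None)%:R.
Proof. by case: i => [j|] /=; rewrite /GRing.scale/= ?mulr0 ?mulr1. Qed.

Lemma dirf_line q i j (h : R) y :
  dirf (q + h *: param_dir i) j y = dirf q j y + h * (i == j)%:R.
Proof.
case: j => [j|]; last by rewrite -[LHS]/((q + h *: param_dir i).1) param_dir_line1.
case: i => [i|] /=; rewrite !mxE ?eqxx /=; last by ring.
by rewrite [Some i == _]/eq_op/= eq_sym; ring.
Qed.

Lemma quad_line q i (h : R) y :
  quad (q + h *: param_dir i) y = quad q y + 2 * h * dirf q i y + h ^+ 2.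
Proof.
have quadE r : quad r y = \sum_j dirf r j y ^+ 2.
  rewrite big_option /quad/=; congr (_ + _); apply: eq_bigr => j _.
  by rewrite !mxE.
rewrite !quadE; under eq_bigr do rewrite dirf_line.
rewrite (bigD1 i)//= [in RHS](bigD1 i)//= eqxx mulr1.
rewrite (eq_bigr (fun j => dirf q j y ^+ 2)); first by ring.
by move=> j /negbTE; rewrite eq_sym => ->; rewrite mulr0 addr0.
Qed.

Lemma near_line_pos q i : 0 < q.1 -> \forall h \near (0 : R), 0 < (q + h *: param_dir i).1.
Proof.
move=> q0; near=> h; rewrite param_dir_line1.
have : `|h| < q.1 by near: h; exact: (@nbhs0_lt _ R _ q0).
by rewrite ltr_norml => /andP[h1 h2]; case: (i == None); rewrite ?mulr1 ?mulr0; lra.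
Unshelve. all: by end_near. Qed.

Variable s : R.

(** A combination of jets with coefficients depending on the parameter only
    through powers of its first coordinate. *)
Definition jcomb L q y := \sum_(t <- L) t.1.1 * q.1 `^ t.1.2 * jetf s q t.2 y.

Definition jsize (k : nat) L := all (fun t : R * R * dirs => (size t.2 < k)%N) L.

Lemma jcomb_cat L L' q y : jcomb (L ++ L') q y = jcomb L q y + jcomb L' q y.
Proof. by rewrite /jcomb big_cat. Qed.

Lemma jsize_le k k' L : (k <= k')%N -> jsize k L -> jsize k' L.
Proof. by move=> kk'; apply: sub_all => t /leq_trans; exact. Qed.

Lemma jetf_cons q i l y : 0 < q.1 ->
  jetf s q (i :: l) y = dirf q i y / quad q y * jetf s q l y.
Proof.
move=> q0; have Q0 := quad_gt0 y q0; rewrite /jetf big_cons/=.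
have -> : - (s + (size l).+1%:R) = -1 + - (s + (size l)%:R) by rewrite -natr1; ring.
rewrite powRD; last by apply/implyP => _; rewrite gt_eqF.
by rewrite powR_inv1 ?(ltW Q0)//; ring.
Qed.

Lemma is_derive_line_quad q i y b : 0 < q.1 ->
  is_derive (0 : R) 1 (fun h : R => quad (q + h *: param_dir i) y `^ b)
    (2 * b * dirf q i y * quad q y `^ (b - 1)).
Proof.
move=> q0; have Q0 := quad_gt0 y q0.
pose P : {poly R} := (quad q y)%:P + (2 * dirf q i y) *: 'X + 'X^2.
have PE : (fun h : R => quad (q + h *: param_dir i) y) = horner P.
  apply/funext => h; rewrite quad_line /P !(hornerD, hornerZ, hornerC, hornerX, hornerXn).
  by ring.
have d1 := is_derive_poly P 0.
have P0 : P.[0] = quad q y.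
  by rewrite /P !(hornerD, hornerZ, hornerC, hornerX, hornerXn) mulr0 expr0n/= !addr0.
have P0' : P^`().[0] = 2 * dirf q i y.
  rewrite /P derivD derivD derivC derivZ derivX derivXn expr1.
  by rewrite !(hornerD, hornerZ, hornerC, hornerX, hornerMn); ring.
have P1 : 0 < P.[0] by rewrite P0.
have := is_derive1_comp (is_derive1_powR b P1) d1.
rewrite P0 P0' (_ : _ \o _ = fun h => quad (q + h *: param_dir i) y `^ b).
  by move/is_derive_eq; apply; ring.
by apply/funext => h /=; rewrite -PE.
Qed.

Lemma is_derive_line_dirf q i j y :
  is_derive (0 : R) 1 (fun h : R => dirf (q + h *: param_dir i) j y) (i == j)%:R.
Proof.
have := is_derive_poly ((dirf q j y)%:P + (i == j)%:R *: 'X) (0 : R).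
rewrite derivD derivC add0r derivZ derivX hornerZ hornerC mulr1.
rewrite (_ : horner _ = fun h : R => dirf (q + h *: param_dir i) j y)//.
apply/funext => h; rewrite !(hornerD, hornerZ, hornerC, hornerX) dirf_line.
by ring.
Qed.

Lemma is_derive_jetf i l : exists2 L, jsize (size l).+1 L & forall q y, 0 < q.1 ->
  is_derive (0 : R) 1 (fun h : R => jetf s (q + h *: param_dir i) l y)
    (- 2 * (s + (size l)%:R) * jetf s q (i :: l) y + jcomb L q y).
Proof.
elim: l => [|j l [L sL HL]].
  exists [::] => // q y q0; rewrite /jcomb big_nil addr0 /jetf.
  have := is_derive_line_quad i y (- (s + 0)) q0.
  rewrite (_ : (fun h : R => _) = fun h : R =>
    quad (q + h *: param_dir i) y `^ (- (s + 0))); last first.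
    by apply/funext => h; rewrite big_nil mul1r.
  move/is_derive_eq; apply; rewrite big_seq1/=.
  by rewrite (_ : - (s + 0) - 1 = - (s + 1)); ring.
pose L' := (if i == j then [:: ((1 : R), (-1 : R), None :: l)] else [::]) ++
  [seq (t.1, j :: t.2) | t <- L].
exists L'.
  rewrite /jsize /L' all_cat all_map; apply/andP; split; first by case: eqP => //=; rewrite ltnSn.
  by apply: sub_all sL => t /=; rewrite ltnS.
move=> q y q0; have Q0 := quad_gt0 y q0.
pose A h := dirf (q + h *: param_dir i) j y.
pose B h := quad (q + h *: param_dir i) y `^ (-1).
pose C h := jetf s (q + h *: param_dir i) l y.
have dA : is_derive (0 : R) 1 A (i == j)%:R := is_derive_line_dirf q i j y.
have dB := is_derive_line_quad i y (-1) q0.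
have dC := HL q y q0.
have dABC := is_deriveM (is_deriveM dA dB) dC.
have near_pos := near_line_pos i q0.
have := @near_eq_is_derive _ _ _ _ (fun h : R => jetf s (q + h *: param_dir i) (j :: l) y)
  _ _ _ _ dABC.
move/(_ _)/is_derive_eq; apply.
  near=> h; have qh : 0 < (q + h *: param_dir i).1 by near: h; exact: near_pos.
  rewrite jetf_cons// /A /B /C !fctE powR_inv1//.
  by apply/ltW/quad_gt0.
rewrite /A /B /C !fctE scale0r !addr0 /GRing.scale/= powR_inv1 ?(ltW Q0)//.
rewrite (_ : quad q y `^ (-1 - 1) = (quad q y)^-1 * (quad q y)^-1); last first.
  rewrite powRD; last by apply/implyP => _; rewrite gt_eqF.
  by rewrite powR_inv1// ltW.
rewrite jetf_cons// !(jetf_cons _ _ _ q0) /L' jcomb_cat.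
have -> : jcomb [seq (t.1, j :: t.2) | t <- L] q y = dirf q j y / quad q y * jcomb L q y.
  rewrite /jcomb big_map mulr_sumr; apply: eq_bigr => t _ /=.
  by rewrite jetf_cons//; ring.
have -> : jcomb (if i == j then [:: ((1 : R), (-1 : R), None :: l)] else [::]) q y =
    (i == j)%:R / quad q y * jetf s q l y.
  case: eqP => _; last by rewrite /jcomb big_nil !mul0r.
  rewrite /jcomb big_seq1/= jetf_cons// powR_inv1 ?(ltW q0)//=.
  by field; rewrite !gt_eqF.
by rewrite -natr1; ring.
Unshelve. all: by end_near. Qed.

Lemma is_derive_line_powR q i (e : R) : 0 < q.1 ->
  is_derive (0 : R) 1 (fun h : R => (q + h *: param_dir i).1 `^ e)
    (e * (i == None)%:R * q.1 `^ (e - 1)).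
Proof.
move=> q0; pose P : {poly R} := q.1%:P + (i == None)%:R *: 'X.
have PE : (fun h : R => (q + h *: param_dir i).1) = horner P.
  apply/funext => h; rewrite param_dir_line1 /P !(hornerD, hornerZ, hornerC, hornerX).
  by ring.
have P0 : P.[0] = q.1 by rewrite /P !(hornerD, hornerZ, hornerC, hornerX) mulr0 addr0.
have P0' : P^`().[0] = (i == None)%:R.
  by rewrite /P derivD derivC add0r derivZ derivX hornerZ hornerC mulr1.
have P1 : 0 < P.[0] by rewrite P0.
have := is_derive1_comp (is_derive1_powR e P1) (is_derive_poly P 0).
rewrite P0 P0' (_ : _ \o _ = fun h => (q + h *: param_dir i).1 `^ e).
  by move/is_derive_eq; apply; ring.
by apply/funext => h /=; rewrite -PE.
Qed.

Lemma is_derive_jterm i (a e : R) l : exists2 L, jsize (size l).+1 L &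
  forall q y, 0 < q.1 -> is_derive (0 : R) 1
    (fun h : R => a * (q + h *: param_dir i).1 `^ e * jetf s (q + h *: param_dir i) l y)
    (a * (- 2 * (s + (size l)%:R)) * q.1 `^ e * jetf s q (i :: l) y + jcomb L q y).
Proof.
have [L sL HL] := is_derive_jetf i l.
exists ((a * (e * (i == None)%:R), e - 1, l) :: [seq (a * t.1.1, e + t.1.2, t.2) | t <- L]).
  by rewrite /jsize /= ltnSn all_map.
move=> q y q0.
have := is_deriveZ a (is_deriveM (is_derive_line_powR i e q0) (HL q y q0)).
rewrite (_ : _ \*: _ = fun h : R =>
    a * (q + h *: param_dir i).1 `^ e * jetf s (q + h *: param_dir i) l y); last first.
  by apply/funext => h; rewrite !fctE -mulrA.
move/is_derive_eq; apply; rewrite scale0r addr0 /jcomb big_cons big_map /=.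
have -> : \sum_(t <- L) a * t.1.1 * q.1 `^ (e + t.1.2) * jetf s q t.2 y =
    a * q.1 `^ e * jcomb L q y.
  rewrite /jcomb mulr_sumr; apply: eq_bigr => t _.
  by rewrite powRD; [ring | apply/implyP => _; rewrite gt_eqF].
by rewrite /GRing.scale/= /jcomb; ring.
Qed.

Lemma is_derive_jcomb i L k : jsize k L -> exists2 L', jsize k.+1 L' &
  forall q y, 0 < q.1 -> is_derive (0 : R) 1
    (fun h : R => jcomb L (q + h *: param_dir i) y) (jcomb L' q y).
Proof.
elim: L => [_|[[a e] l] L IH /= /andP[lk sL]].
  exists [::] => // q y q0; rewrite /jcomb big_nil.
  under eq_fun do rewrite big_nil; exact: is_derive_cst.
have [L1 s1 H1] := is_derive_jterm i a e l; have [L2 s2 H2] := IH sL.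
exists ((a * (- 2 * (s + (size l)%:R)), e, i :: l) :: L1 ++ L2).
  rewrite /jsize /= ltnS lk all_cat /=; apply/andP; split; last exact: s2.
  by apply: jsize_le s1; rewrite ltnS ltnW.
move=> q y q0; have := is_deriveD (H1 q y q0) (H2 q y q0).
rewrite (_ : _ + _ = fun h : R =>
    jcomb ((a, e, l) :: L) (q + h *: param_dir i) y); last first.
  by apply/funext => h; rewrite !fctE /jcomb big_cons.
by move/is_derive_eq; apply; rewrite /jcomb big_cons big_cat/= addrA.
Qed.

(** Each derivation produces the jet with one more factor, with coefficient
    [- 2 (s + size l)], and jets of smaller order; the leading coefficient
    therefore never vanishes. *)
Lemma iter_partial_jets (c e : R) (F : pt -> 'rV[R]_n -> R) l : 0 < s -> c != 0 ->
  (forall q y, 0 < q.1 -> F q y = c * q.1 `^ e * jetf s q [::] y) ->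
  exists a L, [/\ a != 0, jsize (size l) L & forall q y, 0 < q.1 ->
    iter_partial l (F ^~ y) q = a * q.1 `^ e * jetf s q l y + jcomb L q y].
Proof.
move=> s0 c0 HF; elim: l => [|i l [a [L [a0 sL HL]]]].
  by exists c, [::]; split=> // q y q0; rewrite /= HF// /jcomb big_nil addr0.
have [L1 s1 H1] := is_derive_jterm i a e l; have [L2 s2 H2] := is_derive_jcomb i sL.
exists (a * (- 2 * (s + (size l)%:R))), (L1 ++ L2); split.
- have sl : s + (size l)%:R != 0 by rewrite gt_eqF// ltr_wpDr.
  by rewrite !mulf_eq0 negb_or a0 negb_or sl oppr_eq0 pnatr_eq0.
- by rewrite /jsize all_cat; apply/andP; split.
- move=> q y q0; rewrite /= derive_line.
  have := is_deriveD (H1 q y q0) (H2 q y q0) => dE.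
  rewrite jcomb_cat addrA -[RHS](@derive_val _ _ _ _ _ _ _ dE).
  apply: near_eq_derive; near=> h.
  have qh : 0 < (q + h *: param_dir i).1 by near: h; exact: near_line_pos.
  by rewrite HL.
Unshelve. all: by end_near. Qed.

End Derivatives.

(** ** Spans of jets and multiple kernels *)

Section JetSpans.
Context {R : realType} {n : nat}.
Local Notation leb := (lebesgue_rV R n).
Local Notation fn := ('rV[R]_n -> R[i]).
Local Notation pt := (R * 'rV[R]_n)%type.
Local Notation dirs := (seq (option 'I_n)).
Implicit Types (p q : pt) (y v : 'rV[R]_n) (l : dirs) (i : option 'I_n).
Implicit Types (P : nat -> Prop) (lam nu : option 'I_n -> R).

Definition jets s q P (g : fn) : Prop := exists2 l, P (size l) & g = rcplx (jetf s q l).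

Lemma jets_sub s q P P' g : (forall k, P k -> P' k) ->
  lspan (jets s q P) g -> lspan (jets s q P') g.
Proof.
move=> PP'; apply: lspan_sub => h [l Pl ->]; apply: lspan_gen.
by exists l => //; exact: PP'.
Qed.

Lemma jcomb_span s L q k : jsize k L -> lspan (jets s q (fun m => m < k)%N) (rcplx (jcomb s L q)).
Proof.
elim: L => [_|t L IH /= /andP[tk /IH {}IH]].
  rewrite (_ : rcplx _ = 0); first exact: lspan0.
  by apply/funext => y; rewrite /rcplx /jcomb big_nil.
rewrite (_ : rcplx _ = (t.1.1 * q.1 `^ t.1.2)%:C%C *: rcplx (jetf s q t.2) +
    rcplx (jcomb s L q)); last by rewrite -rcplxDZ; congr rcplx; apply/funext => y; rewrite /jcomb big_cons.
by apply: lspanDZ => //; exists t.2.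
Qed.

Lemma ratio_jetf s p lam l y : 0 < p.1 ->
  lin p lam y / quad p y * jetf s p l y = \sum_i lam i * jetf s p (i :: l) y.
Proof.
move=> p0; rewrite /lin !mulr_suml; apply: eq_bigr => i _.
by rewrite jetf_cons// !mulrA.
Qed.

Lemma tterm0 s p lam y : tterm s p lam 0 y = jetf s p [::] y.
Proof. by rewrite /tterm /jetf big_nil expr0 addr0. Qed.

Lemma ttermS s p lam m y :
  tterm s p lam m.+1 y = lin p lam y / quad p y * tterm s p lam m y.
Proof. by rewrite /tterm exprS mulrA. Qed.

(** Multiplication by [lin p lam / quad p] raises the order of jets by one. *)
Lemma tterm_span s p lam m : 0 < p.1 ->
  lspan (jets s p (fun k => k = m)) (rcplx (tterm s p lam m)).
Proof.
move=> p0; pose mulr (g : fn) : fn := fun y => (lin p lam y / quad p y)%:C%C * g y.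
have step k g : lspan (jets s p (fun j => j = k)) g ->
    lspan (jets s p (fun j => j = k.+1)) (mulr g).
  elim=> [|c h u [l lk ->] _ IH].
    rewrite (_ : mulr 0 = 0); first exact: lspan0.
    by apply/funext => y; rewrite /mulr mulr0.
  rewrite (_ : mulr _ = c *: (\sum_i (lam i)%:C%C *: rcplx (jetf s p (i :: l))) + mulr u).
    apply: lspanD => //; apply: lspanZ; apply: lspan_sum => i _; apply: lspanZ.
    by apply: lspan_gen; exists (i :: l) => //=; rewrite lk.
  apply/funext => y; rewrite /mulr !fctE mulrDr fct_sumE; congr (_ + _).
  rewrite mulrCA; congr (c * _).
  rewrite /rcplx -rmorphM/= ratio_jetf// rmorph_sum/=.
  by apply: eq_bigr => i _; rewrite fctE rmorphM.
elim: m => [|m IH].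
  by apply: lspan_gen; exists [::] => //; congr rcplx; apply/funext => y; rewrite tterm0.
rewrite (_ : rcplx _ = mulr (rcplx (tterm s p lam m))); first exact: step.
by apply/funext => y; rewrite /rcplx/mulr ttermS rmorphM.
Qed.

Lemma linB p lam nu y : lin p (fun i => lam i - nu i) y = lin p lam y - lin p nu y.
Proof.
by rewrite /lin -sumrB; apply: eq_bigr => i _; rewrite mulrBl.
Qed.

Lemma norm_ttermB_le s p lam nu m y : 0 < p.1 -> l1 lam <= 1 -> l1 nu <= 1 ->
  `|tterm s p lam m y - tterm s p nu m y| <=
  m%:R * (p.1^-1) ^+ m * l1 (fun i => lam i - nu i) * quad p y `^ (- s).
Proof.
move=> p0 l1le n1le; have ip0 : 0 <= p.1^-1 by rewrite invr_ge0 ltW.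
elim: m => [|m IH]; first by rewrite !tterm0 subrr normr0 !mul0r.
set d := l1 _ in IH *; set Q := _ `^ _ in IH *; have Q0 : 0 <= Q by exact: powR_ge0.
have d0 : 0 <= d by exact: l1_ge0.
rewrite !ttermS; set a := lin p lam y / _; set b := lin p nu y / _.
have dab : `|a - b| <= d / p.1.
  rewrite /a /b -mulrBl -linB; exact: norm_ratio_le.
have bb : `|b| <= p.1^-1.
  by apply: le_trans (norm_ratio_le nu y p0) _; rewrite ler_piMl.
have tl : `|tterm s p lam m y| <= (p.1^-1) ^+ m * Q.
  apply: le_trans (norm_tterm_le s lam m y p0) _; rewrite ler_wpM2r//.
  by apply: lerXn2r; rewrite ?nnegrE ?divr_ge0 ?l1_ge0 ?(ltW p0)// ler_piMl.
rewrite (_ : _ - _ = (a - b) * tterm s p lam m y +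
    b * (tterm s p lam m y - tterm s p nu m y)); last by ring.
rewrite (le_trans (ler_normD _ _))// (normrM (a - b)) (normrM b).
have -> : m.+1%:R * p.1^-1 ^+ m.+1 * d * Q =
   d / p.1 * (p.1^-1 ^+ m * Q) + p.1^-1 * (m%:R * p.1^-1 ^+ m * d * Q).
  by rewrite exprS -natr1; ring.
by apply: lerD; (apply: ler_pM; rewrite ?normr_ge0).
Qed.

Section poisson_jets.
Variables (sigma : R) (sigma0 : 0 < sigma).
Local Notation s := ((n%:R + sigma) / 2).

Let s0 : 0 < s. Proof. by rewrite divr_gt0// ltr_wpDl. Qed.

Lemma sqint_jetf q l : 0 < q.1 -> sqint leb (jetf s q l).
Proof.
move=> q0; have iq0 : 0 <= q.1^-1 by rewrite invr_ge0 ltW.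
have mj : measurable_fun setT (jetf s q l).
  elim: l => [|i l IH].
    rewrite (_ : jetf s q [::] = tterm s q (fun=> 0) 0); first exact: measurable_tterm.
    by apply/funext => y; rewrite tterm0.
  rewrite (_ : jetf s q (i :: l) = fun y => dirf q i y * quad q y `^ (-1) * jetf s q l y).
    apply: measurable_funM => //; apply: measurable_funM; first exact: measurable_dirf.
    by apply: (measurableT_comp (measurable_powR (- 1))); exact: measurable_quad.
  apply/funext => y; rewrite jetf_cons// powR_inv1//.
  exact/ltW/quad_gt0.
have [] := @hnorm_le_rcplx _ _ (jetf s q l) (fun y => quad q y `^ (- s)) (q.1^-1 ^+ size l) mj.
- exact: sqint_quad_powR.
- exact: exprn_ge0.
- move=> y; elim: l {mj} => [|i l IH].
    by rewrite /jetf big_nil/= mul1r addr0 expr0 mul1r ger0_norm// powR_ge0.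
  rewrite jetf_cons// normrM/= exprS -mulrA; apply: ler_pM => //.
  have Q0 := quad_gt0 y q0.
  rewrite normrM normfV (gtr0_norm Q0) ler_pdivrMr// mulrC.
  exact: norm_dirf_le.
- by [].
Qed.

Lemma jets_L2 q P g : 0 < q.1 -> lspan (jets s q P) g -> is_L2 g.
Proof.
move=> q0; elim=> [|c h u [l _ ->] _ u2]; first exact: is_L20.
by apply: is_L2D => //; apply: is_L2Z; apply: is_L2_rcplx; exact: sqint_jetf.
Qed.

Lemma cpoisson_span q : lspan (jets s q (fun k => k = 0)%N) (cpoisson sigma q).
Proof.
rewrite cpoissonE; apply: lspanZ; apply: lspan_gen; exists [::] => //.
by congr rcplx; apply/funext => y; rewrite /jetf big_nil mul1r addr0.
Qed.

Let partials q (g : fn) := exists l,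
  g = rcplx (fun y => iter_partial l (fun p => poisson sigma p y) q).

Let iter_partial_poisson l := @iter_partial_jets R n s (poisson_const n sigma) sigma
  (@poisson R n sigma) l s0.

Let iter_partialE l : exists a L, [/\ a != 0, jsize (size l) L & forall q, 0 < q.1 ->
    rcplx (fun y => iter_partial l (fun p => poisson sigma p y) q) =
    (a * q.1 `^ sigma)%:C%C *: rcplx (jetf s q l) + rcplx (jcomb s L q)].
Proof.
have [||a [L [a0 sL HL]]] := iter_partial_poisson l.
- by rewrite gt_eqF// poisson_const_gt0.
- by move=> q y _; rewrite poissonE /jetf big_nil mul1r/= addr0.
- exists a, L; split=> // q q0; rewrite -rcplxDZ; congr rcplx.
  by apply/funext => y; rewrite HL.
Qed.

Lemma iter_partial_span q l : 0 < q.1 -> lspan (jets s q (fun k => k <= size l)%N)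
  (rcplx (fun y => iter_partial l (fun p => poisson sigma p y) q)).
Proof.
move=> q0; have [a [L [a0 sL ->//]]] := iter_partialE l.
apply: lspanDZ; first by exists l.
by apply: jets_sub (jcomb_span s q sL) => k; exact: ltnW.
Qed.

(** Conversely each jet is a combination of derivatives of the kernel, by
    induction on its order: the leading coefficient above does not vanish. *)
Lemma jet_partials q l : 0 < q.1 -> lspan (partials q) (rcplx (jetf s q l)).
Proof.
move=> q0; have [k] := ubnP (size l); elim: k l => // k IH l lk.
have [a [L [a0 sL /(_ q q0) E]]] := iter_partialE l.
have b0 : (a * q.1 `^ sigma)%:C%C != 0.
  by rewrite -normc_eq0 normcR normr_eq0 mulf_neq0// gt_eqF// powR_gt0.
rewrite (_ : rcplx _ = ((a * q.1 `^ sigma)%:C%C)^-1 *: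
  (rcplx (fun y => iter_partial l (fun p => poisson sigma p y) q) - rcplx (jcomb s L q))).
  apply: lspanZ; apply: lspanB; first by apply: lspan_gen; exists l.
  apply: lspan_sub (jcomb_span s q sL) => g [l' l'l ->]; apply: IH.
  exact: leq_trans l'l lk.
by rewrite E addrK scalerA mulVf// scale1r.
Qed.

Lemma jets_multiple_kernel q P w : 0 < q.1 -> lspan (jets s q P) w ->
  multiple_kernel sigma q w.
Proof.
move=> q0 /(@lspan_sub _ _ _ (partials q)) H.
have {H} : lspan (partials q) w by apply: H => g [l _ ->]; exact: jet_partials.
elim=> [|c f g [l ->] _ [m [c' [s' ->]]]].
  exists 0%N, (fun=> 0), (fun=> [::]); apply/funext => y; by rewrite big_ord0.
exists m.+1, (fun j => if unlift ord0 j is Some k then c' k else c),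
  (fun j => if unlift ord0 j is Some k then s' k else l).
apply/funext => y; rewrite big_ord_recl unlift_none !fctE; congr (_ + _).
by apply: eq_bigr => k _; rewrite liftK.
Qed.

Lemma multiple_kernel_jets q w : 0 < q.1 -> multiple_kernel sigma q w ->
  exists k, lspan (jets s q (fun j => j <= k)%N) w.
Proof.
move=> q0 [m [c [s' ->]]]; exists (\max_j size (s' j)).
rewrite (_ : (fun _ => _) = \sum_(j < m) c j *:
    rcplx (fun y => iter_partial (s' j) (fun p => poisson sigma p y) q)).
  apply: lspan_sum => j _; apply: lspanZ; apply: jets_sub (iter_partial_span _ q0) => k kj.
  by rewrite (leq_trans kj)//; exact: leq_bigmax.
by apply/funext => y; rewrite fct_sumE.
Qed.

Lemma hnorm_ttermB p lam nu m : 0 < p.1 -> l1 lam <= 1 -> l1 nu <= 1 ->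
  hnorm (rcplx (tterm s p lam m) - rcplx (tterm s p nu m)) <=
  m%:R * (p.1^-1) ^+ m * l1 (fun i => lam i - nu i) *
    hnorm (rcplx (fun y => quad p y `^ (- s))).
Proof.
move=> p0 l1le n1le; rewrite -rcplxB.
have ip0 : 0 <= p.1^-1 by rewrite invr_ge0 ltW.
have [] := @hnorm_le_rcplx _ _ (fun y => tterm s p lam m y - tterm s p nu m y)
  (fun y => quad p y `^ (- s)) (m%:R * (p.1^-1) ^+ m * l1 (fun i => lam i - nu i)) => //.
- by apply: measurable_funB; exact: measurable_tterm.
- exact: sqint_quad_powR.
- by rewrite !mulr_ge0// ?exprn_ge0// l1_ge0.
- by move=> y; exact: norm_ttermB_le.
Qed.

End poisson_jets.
End JetSpans.

(** * Limits of normalized residuals *)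

Section Limits.
Context {R : realType} {n : nat}.
Local Notation leb := (lebesgue_rV R n).
Local Notation fn := ('rV[R]_n -> R[i]).
Local Notation normc := Normc.normc.
Implicit Types (f g w : fn) (s : seq fn) (P Q : fn -> Prop).

Lemma vanishes_sum {I : Type} (F : set_system I) {FF : Filter F} J (r : seq J)
    (phi : J -> I -> R) : (forall j, vanishes F (phi j)) ->
  vanishes F (fun i => \sum_(j <- r) phi j i).
Proof.
move=> v; elim: r => [|j r IH].
  by move=> e e0; apply: nearW => i; rewrite big_nil.
have vs := @vanishesD _ _ F FF _ _ (v j) IH => e e0.
by have {}vs := vs e e0; apply: filterS vs => i; rewrite big_cons.
Qed.

(** Compactness of an interval. *)
Lemma ultra_bounded {I : Type} (U : set_system I) (phi : I -> R) (b : R) :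
  UltraFilter U -> (\forall i \near U, `|phi i| <= b) ->
  exists a, vanishes U (fun i => `|phi i - a|).
Proof.
move=> ultraU pb; have UF := @ultra_proper _ _ ultraU.
have [|a [_ cla]] := @segment_compact R (- b) b (phi @ U) _.
  by apply: filterS pb => i; rewrite ler_norml /= in_itv/=.
exists a => e e0.
have [//|Un] := @in_ultra_setVsetC _ U [set i | `|phi i - a| < e] ultraU.
have FA : (phi @ U) [set z | ~ (`|z - a| < e)] by exact: Un.
have [z [zn /= za]] := cla _ _ FA (nbhsx_ballx a e e0).
by case: zn; rewrite distrC; exact: za.
Qed.

Lemma ultra_bounded_complex {I : Type} (U : set_system I) (phi : I -> R[i]) (b : R) :
  UltraFilter U -> (\forall i \near U, normc (phi i) <= b) ->
  exists a, vanishes U (fun i => normc (phi i - a)).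
Proof.
move=> ultraU pb; have UF := @ultra_proper _ _ ultraU.
have [|x vx] := @ultra_bounded _ U (fun i => complex.Re (phi i)) b ultraU.
  by apply: filterS pb => i; apply: le_trans; exact: Re_le_normc.
have [|y vy] := @ultra_bounded _ U (fun i => complex.Im (phi i)) b ultraU.
  by apply: filterS pb => i; apply: le_trans; exact: Im_le_normc.
exists (Complex x y).
apply: (@vanishes_le _ _ _ _ _ _ 1) (vanishesD vx vy) => //.
apply: nearW => i; rewrite mul1r; apply: le_trans (normc_ReIm _) _.
by case: (phi i).
Qed.

(** ** The normalized residual as a function of the vector *)

Section onb.
Variables (s : seq fn) (os : orthonormal s).

Lemma hnorm_nth i : (i < size s)%N -> hnorm (nth 0 s i) = 1.
Proof.
move=> il; have s2 := os.1 _ il; apply/eqP; rewrite -(@eqrXn2 _ 2)// ?hnorm_ge0//.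
by rewrite hnorm_sqr// os.2// eqxx expr1n.
Qed.

Lemma res0 : gs_residual s 0 = 0.
Proof.
by have := resZ os 0 is_L20; rewrite !scale0r.
Qed.

Lemma res_ins u : lspan (ins s) u -> gs_residual s u = 0.
Proof.
have L2 v : lspan (ins s) v -> is_L2 v.
  elim=> [|c h w [i il <-] _ w2]; first exact: is_L20.
  by apply: is_L2D => //; apply: is_L2Z; exact: os.1.
elim=> [|c h w [i il <-] ws IH]; first exact: res0.
rewrite resD//; [|by apply: is_L2Z; exact: os.1|exact: L2].
rewrite resZ//; last exact: os.1.
rewrite IH addr0 (_ : nth 0 s i = \sum_(j < size s) (j == Ordinal il)%:R *: nth 0 s j).
  by rewrite res_comb// scaler0.
rewrite (bigD1 (Ordinal il))//= eqxx scale1r big1 ?addr0// => j /negbTE ->.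
by rewrite scale0r.
Qed.

(** Linear combinations of functions lying, up to null sets, in the span of [s]. *)
Lemma res_lspan_eq0 P u : (forall g, P g -> is_L2 g /\ hnorm (gs_residual s g) = 0) ->
  lspan P u -> is_L2 u /\ hnorm (gs_residual s u) = 0.
Proof.
move=> P0; elim=> [|c g v /P0[g2 g0] _ [v2 v0]].
  by split; [exact: is_L20|rewrite res0 hnorm0].
have cg2 : is_L2 (c *: g) by exact: is_L2Z.
split; first exact: is_L2D.
have rg2 := res_L2 os g2; have rv2 := res_L2 os v2.
have crg2 : is_L2 (c *: gs_residual s g) by exact: is_L2Z.
rewrite resD// resZ//; apply/eqP; rewrite eq_le hnorm_ge0 andbT.
by rewrite (le_trans (hnormD crg2 rv2))// hnormZ// g0 v0 mulr0 addr0.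
Qed.

Lemma gs_stepZ k w : is_L2 w -> 0 < k -> gs_step s (k%:C%C *: w) = gs_step s w.
Proof.
move=> w2 k0; rewrite !gs_stepE resZ// hnormZ; last exact: res_L2.
rewrite normcR gtr0_norm// scalerA; congr (_ *: _).
by rewrite -rmorphM/= invfM mulrAC mulVf ?mul1r// gt_eqF.
Qed.

Lemma res_gs_step w : is_L2 w -> gs_residual s (gs_step s w) = gs_step s w.
Proof.
move=> w2; rewrite [LHS]gs_residualE /proj big1 ?subr0// => i _.
by rewrite dot_gs_step// scale0r.
Qed.

Lemma gs_step_id w : is_L2 w -> hnorm (gs_residual s w) != 0 ->
  gs_step s (gs_step s w) = gs_step s w.
Proof.
move=> w2 w0; rewrite [LHS]gs_stepE res_gs_step// hnorm_gs_step//.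
by rewrite invr1 rmorph1 scale1r.
Qed.

Lemma hnorm_resB a b : is_L2 a -> is_L2 b ->
  hnorm (gs_residual s a - gs_residual s b) <= hnorm (a - b).
Proof.
by move=> a2 b2; rewrite -resB//; apply: hnorm_res_le => //; exact: is_L2B.
Qed.

Let scaleB2 (x y : R[i]) (u v : fn) : x *: u - y *: v = x *: (u - v) + (x - y) *: v.
Proof. by rewrite scalerBl scalerBr addrA subrK. Qed.

(** The map [v |-> v / |v|] is Lipschitz away from 0, and taking residuals does
    not increase distances. *)
Lemma gs_step_dist a b : is_L2 a -> is_L2 b -> hnorm (gs_residual s a) != 0 ->
  hnorm (gs_step s a - gs_step s b) <= 2 * hnorm (a - b) / hnorm (gs_residual s a).
Proof.
move=> a2 b2 a0; rewrite !gs_stepE.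
set ra := gs_residual s a in a0 *; set rb := gs_residual s b.
have ra2 : is_L2 ra by exact: res_L2.
have rb2 : is_L2 rb by exact: res_L2.
set A := hnorm ra in a0 *; set B := hnorm rb.
have A0 : 0 < A by rewrite lt_neqAle eq_sym a0 hnorm_ge0.
have B0 : 0 <= B by exact: hnorm_ge0.
have d1 : hnorm (ra - rb) <= hnorm (a - b) by exact: hnorm_resB.
have d2 : `|A - B| <= hnorm (a - b) by apply: le_trans (hnorm_dist ra2 rb2) d1.
rewrite (_ : _ - _ = (A^-1)%:C%C *: (ra - rb) + (A^-1 - B^-1)%:C%C *: rb); last first.
  rewrite rmorphB/=; exact: scaleB2.
apply: (le_trans (hnormD _ _)).
- by apply: is_L2Z; exact: is_L2B.
- exact: is_L2Z.
rewrite !hnormZ//; last exact: is_L2B.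
rewrite !normcR (gtr0_norm (_ : 0 < A^-1)) ?invr_gt0// -/B.
have -> : 2 * hnorm (a - b) / A = A^-1 * hnorm (a - b) + hnorm (a - b) / A by ring.
apply: lerD; first by rewrite ler_pM2l// invr_gt0.
have [->|Bn] := eqVneq B 0; first by rewrite mulr0 divr_ge0 ?hnorm_ge0// ltW.
rewrite (_ : A^-1 - B^-1 = (B - A) / (A * B)); last by field; rewrite ?a0 ?Bn.
rewrite normrM distrC normfV normrM (gtr0_norm A0) (ger0_norm B0).
rewrite (_ : _ * B = `|A - B| / A); last by field; rewrite ?a0 ?Bn.
by rewrite ler_pM2r// invr_gt0.
Qed.

(** Bounded vectors of a finite-dimensional space converge along an ultrafilter,
    since their coefficients do. *)
Lemma ultra_finite_dim {I : Type} (U : set_system I) (E : I -> fn) : UltraFilter U ->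
  (\forall i \near U, [/\ is_L2 (E i), hnorm (E i) <= 1 & hnorm (gs_residual s (E i)) = 0]) ->
  exists alpha : 'I_(size s) -> R[i],
    vanishes U (fun i => hnorm (E i - \sum_j alpha j *: nth 0 s j)).
Proof.
move=> ultraU EU; have UF := @ultra_proper _ _ ultraU.
have al (j : 'I_(size s)) : exists a, vanishes U (fun i => normc (l2dot (E i) (nth 0 s j) - a)).
  apply: (@ultra_bounded_complex _ _ _ 1) => //; apply: filterS EU => i [E2 E1 _].
  rewrite (le_trans (cauchy_schwarz _ _))//; first exact: os.1.
  by rewrite hnorm_nth// mulr1.
have {al}[alpha al] := choice al; exists alpha.
apply: (@vanishes_le _ _ _ _ _ _ 1) (vanishes_sum (index_enum _) al) => //.
apply: filterS EU => i [E2 E1 E0]; rewrite mul1r.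
have s2 j : is_L2 (nth 0 s (nat_of_ord (j : 'I_(size s)))) by exact: os.1.
rewrite (_ : E i - _ = gs_residual s (E i) +
    \sum_(j < size s) (l2dot (E i) (nth 0 s j) - alpha j) *: nth 0 s j); last first.
  rewrite gs_residualE -addrA; congr (_ + _); rewrite /proj.
  by rewrite -sumrN -sumrN -big_split/=; apply: eq_bigr => j _; rewrite scalerBl addKr.
apply: (le_trans (hnormD _ _)).
- exact: res_L2.
- by apply: is_L2_sum => j _; exact: is_L2Z.
rewrite E0 add0r.
have := @hnorm_sum _ _ _ (index_enum 'I_(size s)) xpredT
  (fun j => (l2dot (E i) (nth 0 s j) - alpha j) *: nth 0 s j) (fun j _ => is_L2Z _ (s2 j)).
move/le_trans; apply.
by apply: ler_sum => j _; rewrite hnormZ// hnorm_nth// mulr1.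
Qed.

End onb.

Lemma lspanU P Q f : lspan (fun g => P g \/ Q g) f ->
  exists u v, [/\ lspan P u, lspan Q v & f = u + v].
Proof.
elim=> [|c g h PQg _ [u [v [Pu Qv ->]]]].
  by exists 0, 0; rewrite addr0; split=> //; exact: lspan0.
case: PQg => [Pg|Qg]; [exists (c *: g + u), v|exists u, (c *: g + v)].
  by split=> //; [exact: lspanDZ|rewrite addrA].
by split=> //; [exact: lspanDZ|rewrite addrCA].
Qed.

End Limits.

(** * Limits of the normalized orthogonal component of the kernel *)

Section KernelLimits.
Context {R : realType} {n : nat}.
Local Notation leb := (lebesgue_rV R n).
Local Notation fn := ('rV[R]_n -> R[i]).
Local Notation pt := (R * 'rV[R]_n)%type.
Local Notation dirs := (seq (option 'I_n)).
Implicit Types (p q : pt) (qs : seq pt) (es : seq fn) (y v : 'rV[R]_n) (l : dirs).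

Lemma disp_eq0 p q : 0 < p.1 -> 0 < q.1 -> l1 (disp p q) = 0 -> q = p.
Proof.
move=> p0 q0 l0; have d0 i : disp p q i = 0.
  by apply/eqP; rewrite -normr_le0 -l0; exact: norm_coef_le.
have q2 : q.2 = p.2.
  apply/rowP => j; have /= := d0 (Some j); lra.
have := d0 None; rewrite /= q2 subrr /sqnorm big1 ?addr0.
  move=> /eqP; rewrite mulf_eq0 invr_eq0 (gt_eqF p0) orbF subr_eq0 eqrXn2 ?ltW//.
  by case: p q {p0 q0 l0 d0} q2 => [a b] [c d] /= -> /eqP ->.
by move=> j _; rewrite mxE expr0n.
Qed.

Lemma disp_vanishes p : vanishes (nbhs p) (fun q => l1 (disp p q)).
Proof.
apply: vanishes_sum => i; apply: cvg_vanishes.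
have c2 (j : 'I_n) : (fun q : pt => q.2 ord0 j - p.2 ord0 j) @ p --> (0 : R).
  rewrite -(subrr (p.2 ord0 j)).
  apply: (@cvgB _ _ _ (nbhs p) _ (fun q : pt => q.2 ord0 j) (cst (p.2 ord0 j))).
    apply: (@cvg_comp _ _ _ (@snd R 'rV[R]_n) (fun x : 'rV[R]_n => x ord0 j)); first exact: cvg_snd.
    exact: coord_continuous.
  exact: cvg_cst.
rewrite -(normr0 R); apply: (@cvg_norm _ R^o _ (nbhs p)).
case: i => [j|].
  rewrite -[X in _ --> X](mulr0 2).
  by apply: (@cvgM _ _ (nbhs p) _ (cst 2)); [exact: cvg_cst|exact: c2].
rewrite -[X in _ --> X](mul0r p.1^-1).
apply: (@cvgM _ _ (nbhs p) _ (fun q : pt => q.1 ^+ 2 - p.1 ^+ 2 + sqnorm (q.2 - p.2))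
  (cst p.1^-1)); last exact: cvg_cst.
rewrite -[X in _ --> X](addr0 0).
apply: (@cvgD _ _ _ (nbhs p) _ (fun q : pt => q.1 ^+ 2 - p.1 ^+ 2)
  (fun q : pt => sqnorm (q.2 - p.2))).
  rewrite -(subrr (p.1 ^+ 2)).
  apply: (@cvgB _ _ _ (nbhs p) _ (fun q : pt => q.1 ^+ 2) (cst (p.1 ^+ 2))); last exact: cvg_cst.
  apply: (@cvg_comp _ _ _ (@fst R 'rV[R]_n) (fun x : R => x ^+ 2)); first exact: cvg_fst.
  exact: exprn_continuous.
rewrite (_ : (fun q : pt => _) = fun q : pt => \sum_j (q.2 ord0 j - p.2 ord0 j) ^+ 2); last first.
  by apply/funext => q; apply: eq_bigr => j _; rewrite !mxE.
apply: vanishes_cvg; first by apply: nearW => q; apply: sumr_ge0 => j _; exact: sqr_ge0.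
apply: vanishes_sum => j; apply: cvg_vanishes.
rewrite -[X in _ --> X](expr0n R 2).
apply: (@cvg_comp _ _ _ (fun q : pt => q.2 ord0 j - p.2 ord0 j) (fun x : R => x ^+ 2)).
  exact: c2.
exact: exprn_continuous.
Qed.

Section with_sigma.
Variables (n1 : (1 <= n)%N) (sigma : R) (sigma0 : 0 < sigma).
Local Notation s := ((n%:R + sigma) / 2).
Local Notation kern q := (rcplx (fun y => quad q y `^ (- s))).

Let s0 : 0 < s. Proof. by rewrite divr_gt0// ltr_wpDl. Qed.

Let kern2 q : 0 < q.1 -> is_L2 (kern q).
Proof. by move=> q0; apply: is_L2_rcplx; exact: sqint_quad_powR. Qed.

Lemma kernel_taylor_hnorm N p : 0 < p.1 -> exists2 C, 0 <= C &
  forall q, 0 < q.1 -> l1 (disp p q) <= p.1 / 2 ->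
  hnorm (kern q - \sum_(m < N) (bcoef s m)%:C%C *: rcplx (tterm s p (disp p q) m)) <=
  C * l1 (disp p q) ^+ N.
Proof.
move=> p0; have [C C0 HC] := kernel_taylor s0 N p0.
exists (C * hnorm (kern p)); first by rewrite mulr_ge0// hnorm_ge0.
move=> q q0 l2.
rewrite (_ : \sum_(m < N) _ =
    rcplx (fun y => \sum_(m < N) bcoef s m * tterm s p (disp p q) m y)); last first.
  apply/funext => y; rewrite fct_sumE /rcplx rmorph_sum/=; apply: eq_bigr => m _.
  by rewrite fctE [RHS]rmorphM.
rewrite -rcplxB mulrAC.
have [] := @hnorm_le_rcplx _ _ (fun y => quad q y `^ (- s) -
    \sum_(m < N) bcoef s m * tterm s p (disp p q) m y)
  (fun y => quad p y `^ (- s)) (C * l1 (disp p q) ^+ N) => //.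
- apply: measurable_funB; first exact: (sqint_quad_powR sigma0 q0).1.
  by apply: measurable_sum => m; apply: measurable_funM => //; exact: measurable_tterm.
- exact: sqint_quad_powR.
- by rewrite mulr_ge0// exprn_ge0// l1_ge0.
- by move=> y; exact: HC.
Qed.

(** Positive factors do not matter for the normalized component, so that [kern q]
    can replace the kernel. *)
Lemma gs_step_cpoisson es q : orthonormal es -> 0 < q.1 ->
  gs_step es (cpoisson sigma q) = gs_step es (kern q).
Proof.
move=> os q0; rewrite cpoissonE gs_stepZ//; first exact: kern2.
exact: poisson_coef_gt0.
Qed.

(** ** The state of the algorithm *)

Definition jetsat qs M (g : fn) :=
  exists q l, [/\ q \in qs, (size l <= M)%N & g = rcplx (jetf s q l)].

(** What the choice of the next point needs to know of the previous ones: the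
    orthonormal functions are combinations of jets, of some bounded order, at
    the selected points. *)
Record poafd_state qs es M := PoafdState {
  state_orthonormal : orthonormal es;
  state_pos : forall q, q \in qs -> 0 < q.1;
  state_jets : forall e, ins es e -> lspan (jetsat qs M) e }.

Lemma res_tterm_neq0 qs es p N lam : orthonormal es -> 0 < p.1 ->
  (forall q, q \in qs -> 0 < q.1) -> (N = 0)%N \/ l1 lam != 0 ->
  (forall e, ins es e -> lspan (jetgen s p N qs) e) ->
  hnorm (gs_residual es (rcplx (tterm s p lam N))) != 0.
Proof.
move=> os p0 qs0 lamN esJ; apply/eqP.
move=> /(res_in_span os (is_L2_rcplx (sqint_tterm sigma0 lam N p0)))[c cE].
apply: (@jets_independent _ _ s p N qs lam (\sum_(i < size es) c i *: nth 0 es i)) => //.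
  by apply: lspan_sum => i _; apply: lspanZ; apply: esJ; exists i.
apply: filterS cE => y; rewrite fct_sumE /rcplx /tterm => <-.
have Q0 := quad_gt0 y p0.
congr (Complex _ _); rewrite expr_div_n -mulrA; congr (_ * _).
rewrite opprD powRD; last by apply/implyP => _; rewrite gt_eqF.
by rewrite mulrC; congr (_ * _); rewrite powRN powR_mulrn// ltW.
Qed.

Lemma res_kernel_neq0 qs es M q : poafd_state qs es M -> 0 < q.1 -> q \notin qs ->
  hnorm (gs_residual es (kern q)) != 0.
Proof.
move=> [os qs0 esJ] q0 qn.
rewrite (_ : kern q = rcplx (tterm s q (fun=> 0) 0)); last first.
  by congr rcplx; apply/funext => y; rewrite /tterm expr0 mul1r.
apply: (@res_tterm_neq0 qs) => //; first by left.
move=> e /esJ; apply: lspan_sub => g [q' [l [qq' _ ->]]]; apply: lspan_gen.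
by exists q', l; split=> // qq; rewrite qq (negbTE qn) in qq'.
Qed.

(** A Taylor bound of order 1 is the continuity of the kernel, whose residual at
    a new point does not vanish. *)
Lemma gs_step_kernel_cvg qs es M p (U : set_system pt) {FU : ProperFilter U} :
  poafd_state qs es M -> 0 < p.1 -> p \notin qs -> U --> p ->
  (\forall q \near U, 0 < q.1) ->
  vanishes U (fun q => hnorm (gs_step es (cpoisson sigma q) - gs_step es (cpoisson sigma p))).
Proof.
move=> st p0 pn Up Upos; have [os _ _] := st.
have [C C0 HC] := kernel_taylor_hnorm 1 p0.
have r0 := res_kernel_neq0 st p0 pn.
have vd : vanishes U (fun q => l1 (disp p q)) by move=> e e0; exact: Up (disp_vanishes p e0).
have p2 : 0 < p.1 / 2 by rewrite divr_gt0.
set r := hnorm _ in r0.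
have r1 : 0 < r by rewrite lt_neqAle eq_sym r0 hnorm_ge0.
have near2 := vd _ p2.
apply: (@vanishes_le _ _ _ _ _ _ (2 * C / r)) vd.
  by rewrite divr_ge0 ?mulr_ge0// ltW.
apply: filterS2 Upos near2 => q q0 lq.
rewrite !gs_step_cpoisson// hnormBC; try (by apply: gs_step_L2 => //; exact: kern2).
apply: le_trans (gs_step_dist os (kern2 p0) (kern2 q0) r0) _.
rewrite -/r [leRHS]mulrAC ler_pM2r ?invr_gt0// -[leRHS]mulrA ler_pM2l//.
rewrite hnormBC; [|exact: kern2|exact: kern2].
have := HC q q0 (ltW lq); rewrite big_ord1/= expr1 scale1r.
suff -> : rcplx (tterm s p (disp p q) 0) = kern p by [].
by congr rcplx; apply/funext => y; rewrite /tterm expr0 mul1r.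
Qed.

(** The jets of bounded order at a point are finitely many, so that Gram-Schmidt
    absorbs them. *)
Lemma extend_by_jets es p k : orthonormal es -> 0 < p.1 -> exists es',
  [/\ orthonormal (es ++ es'),
   forall l, (size l <= k)%N -> hnorm (gs_residual (es ++ es') (rcplx (jetf s p l))) = 0 &
   forall e, ins es' e ->
     lspan (fun g => ins es g \/ jets s p (fun m => m <= k)%N g) e].
Proof.
move=> os p0; have [ls lsE] : exists ls : seq dirs, forall l, (l \in ls) = (size l <= k)%N.
  elim: k => [|k [ls lsE]].
    by exists [:: [::]] => l; rewrite inE leqn0 size_eq0.
  exists ([::] :: [seq i :: l | i <- enum {: option 'I_n}, l <- ls]) => -[|i l]; rewrite inE//=.
  rewrite ltnS -lsE; apply/allpairsP/idP => [[[j l'] /= [_ l'ls [_ ->]]]//|lls].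
  by exists (i, l); rewrite mem_enum.
have [|es' [oes' res0 spn]] := @orthonormal_extend _ _ es
    [seq rcplx (jetf s p l) | l <- ls] os.
  move=> b [i ]; rewrite size_map => il <-; rewrite (nth_map [::])//.
  by apply: is_L2_rcplx; exact: sqint_jetf.
exists es'; split=> //.
  move=> l lk; apply: res0; exists (index l ls); first by rewrite size_map index_mem lsE.
  by rewrite (nth_map [::]) ?index_mem ?lsE// nth_index// lsE.
move=> e /spn; apply: lspan_sub => g [gs|[i ]]; first by apply: lspan_gen; left.
rewrite size_map => il <-; apply: lspan_gen; right; rewrite (nth_map [::])//.
by exists (nth [::] ls i) => //; rewrite -lsE mem_nth.
Qed.

End with_sigma.
End KernelLimits.

(** ** Approaching a selected point

    The residual of the kernel tends to 0 when [q] tends to a selected point [p],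
    and the limit of the normalized residual comes from the Taylor expansion at
    [p]: for [M] bounding the order of the jets used so far, the expansion up to
    order [M.+1] has a residual bounded below by a multiple of the displacement
    to the power [M.+1], while the error is of order [M.+2]. The normalized residuals of the Taylor
    polynomials live in a finite-dimensional space of jets at [p], where they
    converge along an ultrafilter; the limit comes from a multiple kernel. *)

Section RepeatedPoint.
Context {R : realType} {n : nat}.
Local Notation leb := (lebesgue_rV R n).
Local Notation fn := ('rV[R]_n -> R[i]).
Local Notation pt := (R * 'rV[R]_n)%type.
Variables (n1 : (1 <= n)%N) (sigma : R) (sigma0 : 0 < sigma).
Local Notation s := ((n%:R + sigma) / 2).
Local Notation kern q := (rcplx (fun y => quad q y `^ (- s))).

Let s0 : 0 < s. Proof. by rewrite divr_gt0// ltr_wpDl. Qed.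

Let kern2 (q : pt) : 0 < q.1 -> is_L2 (kern q).
Proof. by move=> q0; apply: is_L2_rcplx; exact: sqint_quad_powR. Qed.

Variables (qs : seq pt) (es : seq fn) (M : nat) (p : pt) (U : set_system pt).
Hypotheses (st : poafd_state sigma qs es M) (pqs : p \in qs) (ultraU : UltraFilter U)
  (Up : U --> p) (Upos : \forall q \near U, 0 < q.1 /\ q \notin qs).

Let os : orthonormal es. Proof. by case: st. Qed.
Let p0 : 0 < p.1. Proof. by case: st => _ + _; exact. Qed.
Let UF : ProperFilter U := @ultra_proper _ _ ultraU.

Let L q := l1 (disp p q).
Let nuq q i := (L q)^-1 * disp p q i.

Let vL : vanishes U L.
Proof. by move=> e e0; exact: Up (disp_vanishes p e0). Qed.

Let L_gt0 : \forall q \near U, 0 < L q.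
Proof.
apply: filterS Upos => q [q0 qn]; rewrite lt_neqAle l1_ge0 andbT eq_sym.
by apply/eqP => /disp_eq0 qp; rewrite qp// pqs in qn.
Qed.

Let nuq1 : \forall q \near U, l1 (nuq q) = 1.
Proof.
apply: filterS L_gt0 => q Lq; rewrite l1Z -/(L q) gtr0_norm ?invr_gt0//.
by rewrite mulVf// gt_eqF.
Qed.

Let limit_direction : exists nu, l1 nu = 1 /\
  vanishes U (fun q => l1 (fun i => nuq q i - nu i)).
Proof.
have lim i : exists a, vanishes U (fun q => `|nuq q i - a|).
  apply: (@ultra_bounded _ _ _ _ 1) => //; apply: filterS nuq1 => q <-.
  exact: norm_coef_le.
have [nu {}lim] := choice lim.
have v : vanishes U (fun q => l1 (fun i => nuq q i - nu i)) by exact: vanishes_sum.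
exists nu; split=> //; apply/eqP; rewrite -subr_eq0 -normr_le0.
apply/ler_addgt0Pr => e e0; rewrite add0r.
have ve := v e e0; have [q [q1 qe]] := @filter_ex _ U _ _ (filterI nuq1 ve).
apply: ltW; apply: (le_lt_trans _ qe); rewrite -[X in _ - X]q1 distrC /l1 -sumrB.
apply: (le_trans (ler_norm_sum _ _ _)); apply: ler_sum => i _.
exact: ler_dist_dist.
Qed.

Let T q : fn :=
  \sum_(m < M.+2) (bcoef s m)%:C%C *: rcplx (tterm s p (disp p q) m).

Let tterm2 (lam : option 'I_n -> R) (m : nat) : is_L2 (rcplx (tterm s p lam m) : fn).
Proof. by apply: is_L2_rcplx; exact: sqint_tterm. Qed.

Let T2 q : is_L2 (T q).
Proof. by apply: is_L2_sum => m _; exact: is_L2Z. Qed.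

Let T_jets q : lspan (jets s p (fun k => k <= M.+1)%N) (T q).
Proof.
apply: lspan_sum => m _; apply: lspanZ; apply: jets_sub (tterm_span s (disp p q) m p0).
by move=> k ->; rewrite -ltnS.
Qed.

(** The homogeneous jet of order [M.+1] in the limit direction is
    independent of the selected functions and of all lower jets at [p]. *)
Let res_T : exists2 c, 0 < c & \forall q \near U, c * L q ^+ M.+1 <= hnorm (gs_residual es (T q)).
Proof.
have [nu [nu1 vnu]] := limit_direction.
have [es' [os3 res3 jets3]] := extend_by_jets sigma0 M os p0.
set es3 := es ++ es' in os3 res3.
pose tt lam := rcplx (tterm s p lam M.+1).
pose k2 := hnorm (gs_residual es3 (tt nu)).
have jetsat_jetgen g : jetsat sigma qs M g -> lspan (jetgen s p M.+1 qs) g.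
  move=> [q [l [qqs lM ->]]]; apply: lspan_gen.
  by exists q, l; split=> // _; rewrite ltnS.
have k20 : 0 < k2.
  rewrite lt_neqAle eq_sym hnorm_ge0 andbT.
  apply: (@res_tterm_neq0 _ _ n1 _ sigma0 qs) => //; first by case: st.
    by right; rewrite nu1 oner_eq0.
  have esJ e : ins es e -> lspan (jetgen s p M.+1 qs) e.
    by case: st => _ _ /[apply]; exact: lspan_sub.
  move=> e [i ]; rewrite size_cat nth_cat; case: ifP => [ies _ <-|]; first by apply: esJ; exists i.
  move=> /negbT; rewrite -leqNgt => esi il ei.
  have /jets3 : ins es' e by exists (i - size es)%N => //; rewrite ltn_subLR.
  apply: lspan_sub => g [/esJ//|[l lM ->]]; apply: lspan_gen.
  by exists p, l; split.
pose K := M.+1%:R * p.1^-1 ^+ M.+1 * hnorm (kern p).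
have K0 : 0 <= K by rewrite !mulr_ge0// ?hnorm_ge0// exprn_ge0// invr_ge0 ltW.
have vK : vanishes U (fun q => hnorm (tt (nuq q) - tt nu)).
  apply: (@vanishes_le _ _ _ _ _ _ K) vnu => //; apply: filterS nuq1 => q q1.
  apply: le_trans (hnorm_ttermB sigma0 _ p0 _ _) _; rewrite ?q1 ?nu1//.
  by rewrite /K mulrAC.
have b0 : 0 < `|bcoef s M.+1| by rewrite normr_gt0 bcoef_neq0.
exists (`|bcoef s M.+1| * (k2 / 2)); first by rewrite mulr_gt0// divr_gt0.
have k22 : 0 < k2 / 2 by rewrite divr_gt0.
near=> q.
have Lq : 0 < L q by near: q; exact: L_gt0.
have dq : hnorm (tt (nuq q) - tt nu) < k2 / 2 by near: q; exact: vK.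
apply: le_trans (hnorm_res_cat os3 (T2 q)).
(* the part of the Taylor polynomial made of lower jets, invisible modulo [es3] *)
pose A : fn := \sum_(m < M.+1) (bcoef s m)%:C%C *: rcplx (tterm s p (disp p q) m).
have [A2 A0] : is_L2 A /\ hnorm (gs_residual es3 A) = 0.
  apply: (@res_lspan_eq0 _ _ es3 os3 (jets s p (fun k => k <= M)%N)).
    move=> g [l lM ->]; split; last exact: res3.
    by apply: is_L2_rcplx; exact: sqint_jetf.
  apply: lspan_sum => m _; apply: lspanZ; apply: jets_sub (tterm_span s (disp p q) m p0).
  by move=> k ->; rewrite -ltnS.
have TE : T q - A = (bcoef s M.+1)%:C%C *: ((L q ^+ M.+1)%:C%C *: tt (nuq q)).
  rewrite /T big_ord_recr/= -/A addrC addrK; congr (_ *: _).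
  rewrite (_ : disp p q = fun i => L q * nuq q i); last first.
    by apply/funext => i; rewrite /nuq mulVKf// gt_eqF.
  apply/funext => y; rewrite fctE /tt /rcplx ttermZ; exact: rmorphM.
have ttq2 : is_L2 (tt (nuq q)) by exact: tterm2.
have : hnorm (gs_residual es3 (T q - A)) <= hnorm (gs_residual es3 (T q)).
  rewrite resB//; apply: (le_trans (hnormB _ _)); rewrite ?A0 ?addr0//; exact: res_L2.
apply: le_trans; rewrite TE !resZ//; last exact: is_L2Z.
have r2 := res_L2 os3 ttq2.
rewrite !hnormZ//; last exact: is_L2Z.
rewrite !normcR -mulrA ler_pM2l// [leRHS]mulrC.
rewrite ger0_norm ?exprn_ge0 ?(ltW Lq)// ler_pM2r ?exprn_gt0//.
have half (a b d : R) : `|a - b| <= d -> d < b / 2 -> b / 2 <= a.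
  by rewrite ler_norml => /andP[+ _]; lra.
apply: half dq.
exact: le_trans (hnorm_dist r2 (res_L2 os3 (tterm2 nu M.+1)))
  (hnorm_resB os3 ttq2 (tterm2 nu M.+1)).
Unshelve. all: by end_near. Qed.

Let E q := gs_step es (T q).

Let kern_E : vanishes U (fun q => hnorm (gs_step es (cpoisson sigma q) - E q)).
Proof.
have [c c0 resT] := res_T.
have [C C0 HC] := kernel_taylor_hnorm sigma0 M.+2 p0.
have p2 : 0 < p.1 / 2 by rewrite divr_gt0.
apply: (@vanishes_le _ _ _ _ _ _ (2 * C / c)) vL.
  by rewrite divr_ge0 ?mulr_ge0// ltW.
near=> q.
have [q0 _] : 0 < q.1 /\ q \notin qs by near: q; exact: Upos.
have Lq : 0 < L q by near: q; exact: L_gt0.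
have Lp : L q < p.1 / 2 by near: q; exact: vL.
have rT : c * L q ^+ M.+1 <= hnorm (gs_residual es (T q)) by near: q; exact: resT.
have r0 : 0 < hnorm (gs_residual es (T q)).
  by apply: lt_le_trans rT; rewrite mulr_gt0// exprn_gt0.
rewrite (gs_step_cpoisson sigma0 os q0) hnormBC; [|by apply: gs_step_L2 => //; exact: kern2|exact: gs_step_L2].
apply: le_trans (gs_step_dist os (T2 q) (kern2 q0) _) _; first by rewrite gt_eqF.
rewrite ler_pdivrMr//.
apply: (@le_trans _ _ (2 * (C * L q ^+ M.+2))).
  by rewrite ler_pM2l// hnormBC//; [exact: HC (ltW Lp)|exact: kern2].
apply: (@le_trans _ _ (2 * C / c * L q * (c * L q ^+ M.+1))).
  rewrite [leRHS](_ : _ = 2 * (C * L q ^+ M.+2))// [in RHS]exprS.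
  by field; rewrite gt_eqF.
by rewrite ler_wpM2l// mulr_ge0 ?(ltW Lq)// divr_ge0 ?mulr_ge0// ltW.
Unshelve. all: by end_near. Qed.

Lemma gs_step_repeat_cvg : exists w,
  [/\ lspan (jets s p (fun k => k <= M.+1)%N) w, hnorm (gs_residual es w) != 0 &
   vanishes U (fun q => hnorm (gs_step es (cpoisson sigma q) - gs_step es w))].
Proof.
have [es' [os4 res4 jets4]] := extend_by_jets sigma0 M.+1 os p0.
set es4 := es ++ es' in os4 res4.
have [c c0 resT] := res_T.
have resT0 : \forall q \near U, hnorm (gs_residual es (T q)) != 0.
  apply: filterS2 L_gt0 resT => q Lq rT; rewrite gt_eqF//.
  by apply: lt_le_trans rT; rewrite mulr_gt0// exprn_gt0.
have E2 q : is_L2 (E q) by exact: gs_step_L2.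
have E_fin : \forall q \near U,
    [/\ is_L2 (E q), hnorm (E q) <= 1 & hnorm (gs_residual es4 (E q)) = 0].
  apply: nearW => q; split=> //; first exact: hnorm_gs_step_le.
  have : lspan (fun g => ins es g \/ jets s p (fun k => k <= M.+1)%N g) (E q).
    apply: lspan_gs_step => [e ie|]; first by apply: lspan_gen; left.
    by apply: lspan_sub (T_jets q) => g jg; apply: lspan_gen; right.
  move=> /(res_lspan_eq0 os4 _)[|//] g [ige|[l lM ->]]; last first.
    by split; [apply: is_L2_rcplx; exact: sqint_jetf|exact: res4].
  case: ige => i il <-; split; first exact: (os.1).
  rewrite res_ins ?hnorm0//; apply: lspan_gen; exists i; last by rewrite nth_cat il.
  by rewrite size_cat ltn_addr.
have [alpha v] := ultra_finite_dim os4 ultraU E_fin.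
set w' := \sum_j _ in v.
have w'2 : is_L2 w' by apply: is_L2_sum => j _; apply: is_L2Z; exact: os4.1.
have : lspan (fun g => ins es g \/ jets s p (fun k => k <= M.+1)%N g) w'.
  apply: lspan_sum => j _; apply: lspanZ; rewrite nth_cat; case: ifP => jes.
    by apply: lspan_gen; left; exists j.
  apply: jets4; exists (j - size es)%N => //.
  have esj : (size es <= j)%N by rewrite leqNgt jes.
  by rewrite ltn_subLR// -size_cat; exact: ltn_ord.
move=> /lspanU[u [w [eu ew w'E]]].
have w2 : is_L2 w := jets_L2 sigma0 p0 ew.
have u2 : is_L2 u.
  by have -> : u = w' - w by [rewrite w'E addrK]; exact: is_L2B.
have resw : gs_residual es w' = gs_residual es w.
  by rewrite w'E resD// (res_ins os eu) add0r.
have stepw : gs_step es w' = gs_step es w by rewrite !gs_stepE resw.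
have resw0 : hnorm (gs_residual es w) != 0.
  have h2 : 0 < 2^-1 :> R by rewrite invr_gt0.
  have v2 := v _ h2.
  have [q [r0 d]] := @filter_ex _ U _ _ (filterI resT0 v2).
  have := le_trans (hnorm_dist (res_L2 os (E2 q)) (res_L2 os w'2)) (hnorm_resB os (E2 q) w'2).
  rewrite /E res_gs_step// hnorm_gs_step// resw => d'.
  apply/eqP => rw0; move: (le_lt_trans d' d); rewrite rw0 subr0 normr1; lra.
exists w; split=> //.
have vE : vanishes U (fun q => hnorm (E q - gs_step es w)).
  apply: (@vanishes_le _ _ _ _ _ _ 2) v => //; apply: filterS resT0 => q r0.
  have EE : gs_step es (E q) = E q by exact: gs_step_id.
  have rE : hnorm (gs_residual es (E q)) = 1 by rewrite res_gs_step// hnorm_gs_step.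
  have rE0 : hnorm (gs_residual es (E q)) != 0 by rewrite rE oner_eq0.
  have := gs_step_dist os (E2 q) w'2 rE0.
  by rewrite EE stepw rE divr1.
apply: (@vanishes_le _ _ _ _ _ _ 1) (vanishesD kern_E vE) => //.
apply: filterS Upos => q [q0 _]; rewrite mul1r; apply: hnorm_tri => //.
- by apply: gs_step_L2 => //; exact: is_L2_cpoisson.
- exact: gs_step_L2.
Qed.

End RepeatedPoint.

(** * Existence of maximal selections *)

Section Existence.
Context {R : realType} {n : nat}.
Local Notation leb := (lebesgue_rV R n).
Local Notation fn := ('rV[R]_n -> R[i]).
Local Notation pt := (R * 'rV[R]_n)%type.
Local Notation normc := Normc.normc.
Variables (n1 : (1 <= n)%N) (sigma : R) (sigma0 : 0 < sigma).
Local Notation s := ((n%:R + sigma) / 2).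
Local Notation h := (cpoisson sigma).
Implicit Types (q p : pt) (qs : seq pt) (es : seq fn) (w f : fn).

Lemma poafd_state_nil : poafd_state sigma ([::] : seq pt) [::] 0.
Proof. by split=> [//|//|e [i ]]. Qed.

Lemma res_cpoisson_neq0 qs es M q : poafd_state sigma qs es M -> 0 < q.1 -> q \notin qs ->
  hnorm (gs_residual es (h q)) != 0.
Proof.
move=> st q0 qn; have [os _ _] := st.
have k2 : is_L2 (rcplx (fun y => quad q y `^ (- s))).
  by apply: is_L2_rcplx; exact: sqint_quad_powR.
rewrite cpoissonE resZ// hnormZ; last exact: res_L2.
rewrite normcR mulf_neq0//; last exact: res_kernel_neq0 st q0 qn.
by rewrite normr_eq0 gt_eqF// poisson_coef_gt0.
Qed.

Lemma admissible_jets qs es q w : 0 < q.1 -> admissible_kernel sigma qs es q w ->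
  exists k, lspan (jets s q (fun j => j <= k)%N) w.
Proof.
rewrite /admissible_kernel => q0; case: ifP => [_ ->|_ [mk _ _]].
  by exists 0%N; apply: jets_sub (cpoisson_span sigma q) => k ->.
exact: multiple_kernel_jets.
Qed.

Lemma admissible_L2 qs es q w : 0 < q.1 -> admissible_kernel sigma qs es q w -> is_L2 w.
Proof. by move=> q0 /(admissible_jets q0)[k]; exact: jets_L2. Qed.

Lemma admissible_res_neq0 qs es M q w : poafd_state sigma qs es M -> 0 < q.1 ->
  admissible_kernel sigma qs es q w -> hnorm (gs_residual es w) != 0.
Proof.
move=> st q0 aw; have w2 := admissible_L2 q0 aw; have [os _ _] := st.
move: aw; rewrite /admissible_kernel; case: ifP => [qn ->|_ [_ nin _]].
  exact: res_cpoisson_neq0 st q0 qn.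
by apply/eqP => /(res_in_span os w2).
Qed.

Lemma poafd_state_rcons qs es M q w : poafd_state sigma qs es M -> 0 < q.1 ->
  admissible_kernel sigma qs es q w ->
  exists M', poafd_state sigma (rcons qs q) (rcons es (gs_step es w)) M'.
Proof.
move=> st q0 aw; have w2 := admissible_L2 q0 aw.
have r0 := admissible_res_neq0 st q0 aw.
have [k wk] := admissible_jets q0 aw; have [os qs0 esJ] := st.
have sub g : lspan (jetsat sigma qs M) g -> lspan (jetsat sigma (rcons qs q) (maxn M k)) g.
  apply: lspan_sub => _ [q' [l [qq' lM ->]]]; apply: lspan_gen; exists q', l.
  by rewrite mem_rcons inE qq' orbT leq_max lM.
exists (maxn M k); split.
- exact: orthonormal_rcons.
- by move=> q'; rewrite mem_rcons inE => /orP[/eqP ->//|/qs0].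
- move=> e [i ]; rewrite size_rcons ltnS nth_rcons; case: ltngtP => // il _ <-.
    by apply/sub/esJ; exists i.
  apply: lspan_gs_step => [e' /esJ/sub//|].
  apply: lspan_sub wk => _ [l lk ->]; apply: lspan_gen; exists q, l.
  by rewrite mem_rcons inE eqxx leq_max lk orbT.
Qed.

(** Far from the selected points the kernel is almost orthogonal to them, so
    the boundary vanishing condition passes to the orthogonal component. *)
Lemma gs_step_boundary es f : orthonormal es -> is_L2 f ->
  vanishes (to_boundary R n) (fun q => normc (l2dot f (gs_step es (h q)))).
Proof.
move=> os f2; have FF := to_boundary_filter n.
pose r g q := normc (l2dot g (h q)) / hnorm (h q).
have vr g : is_L2 g -> vanishes (to_boundary R n) (r g) by exact: bvc.
have rf2 := res_L2 os f2.
have vs : vanishes (to_boundary R n) (fun q => \sum_(i < size es) r (nth 0 es i) q).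
  by apply: vanishes_sum => i; apply: vr; exact: os.1.
have h2 : 0 < 2^-1 :> R by rewrite invr_gt0.
have {}vs := vs _ h2.
apply: (@vanishes_le _ _ _ _ _ _ 2) (vr _ rf2) => //.
apply: filterS2 (@near_halfspace R n) vs => q q0 sq.
have hq2 := is_L2_cpoisson sigma0 q0.
have N0 := hnorm_cpoisson_gt0 sigma0 q0.
have P2 : is_L2 (proj es (h q)) by exact: proj_L2.
have r2 := res_L2 os hq2.
have Ple : hnorm (proj es (h q)) <= hnorm (h q) / 2.
  have := @hnorm_sum _ _ _ (index_enum 'I_(size es)) xpredT
    (fun j => l2dot (h q) (nth 0 es j) *: nth 0 es j) (fun j _ => is_L2Z _ (os.1 _ (ltn_ord j))).
  move/le_trans; apply; rewrite -ler_pdivrMl// mulr_sumr; apply: ltW; apply: le_lt_trans sq.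
  apply: ler_sum => i _; rewrite hnormZ; last exact: os.1.
  by rewrite hnorm_nth// mulr1 mulrC /r (l2dotC (os.1 _ (ltn_ord i)) hq2) normcJ.
have rge : hnorm (h q) / 2 <= hnorm (gs_residual es (h q)).
  have := hnormD r2 P2; rewrite {1}gs_residualE subrK; move: Ple.
  set a := hnorm (h q); set b := hnorm (proj _ _); set c := hnorm (gs_residual _ _); lra.
have r0 : 0 < hnorm (gs_residual es (h q)) by apply: lt_le_trans rge; rewrite divr_gt0.
rewrite gs_stepE l2dotZr// Normc.normcM normcJ normcR gtr0_norm ?invr_gt0//.
rewrite -dot_resC// /r mulrCA [leRHS]mulrC ler_wpM2r ?normc_ge0//.
by rewrite -[leRHS]invrK invf_div lef_pV2// posrE divr_gt0.
Qed.

Lemma new_point qs : exists q, 0 < q.1 /\ q \notin qs.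
Proof.
have nn : 0 <= \sum_(p <- qs) `|p.1| by exact: sumr_ge0.
pose q : pt := (1 + \sum_(p <- qs) `|p.1|, 0).
exists q; split; first by rewrite /= ltr_pwDl.
apply/negP => qin.
have : `|q.1| <= \sum_(p <- qs) `|p.1|.
  by rewrite (big_rem q)//= lerDl sumr_ge0.
by rewrite /= ger0_norm ?addr_ge0//; lra.
Qed.

Lemma gs_step_le es f w : orthonormal es -> is_L2 f -> is_L2 w ->
  normc (l2dot f (gs_step es w)) <= hnorm f.
Proof.
move=> os f2 w2; apply: le_trans (cauchy_schwarz f2 (gs_step_L2 os w2)) _.
by rewrite ler_piMr ?hnorm_ge0// hnorm_gs_step_le.
Qed.

Let near_le_half (a b c e : R) : c - e / 2 < a -> `|a - b| < e / 2 -> c <= b + e.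
Proof. by rewrite ltr_norml => ? /andP[]; lra. Qed.

Let near_le (a b c e : R) : a <= b -> `|c - a| < e -> c <= b + e.
Proof. by rewrite ltr_norml => ? /andP[]; lra. Qed.

Let near0_half (a c e : R) : c - e / 2 < a -> a < e / 2 -> c <= e.
Proof. lra. Qed.

Let l2norm_cvg0 (a : fn) (b : nat -> fn) : is_L2 a -> (forall j, is_L2 (b j)) ->
  (forall j, hnorm (b j - a) < j.+1%:R^-1) ->
  (fun j => l2norm (a \- b j)) @ \oo --> 0%E.
Proof.
move=> a2 b2 ba; rewrite (_ : (fun j => _) = EFin \o (fun j => hnorm (a - b j))).
  apply/cvg_EFin; first exact: nearW.
  apply: vanishes_cvg; first by apply: nearW => j; exact: hnorm_ge0.
  move=> e e0; near=> j; rewrite /= hnormBC//; apply: lt_trans (ba j) _.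
  by near: j; exact: near_infty_natSinv_lt (PosNum e0).
by apply/funext => j; rewrite /= -l2norm_fin//; exact: is_L2B.
Unshelve. all: by end_near. Qed.

Section selection.
Variables (f : fn) (f2 : is_L2 f) (qs : seq pt) (es : seq fn) (M : nat).
Hypothesis st : poafd_state sigma qs es M.

Let os : orthonormal es. Proof. by case: st. Qed.
Let D q := 0 < q.1 /\ q \notin qs.
Let Phi q := normc (l2dot f (gs_step es (h q))).

(** A limit of normalized components along points that nearly attain the
    supremum attains it. *)
Let limit_maximal (U : set_system pt) (UF : ProperFilter U) w : is_L2 w ->
  U [set q | D q] ->
  (forall q', D q' -> forall e, 0 < e -> \forall q \near U, Phi q' - e < Phi q) ->
  vanishes U (fun q => hnorm (gs_step es (h q) - gs_step es w)) ->
  forall q', D q' -> Phi q' <= normc (l2dot f (gs_step es w)).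
Proof.
move=> w2 UD UPhi v q' q'D; apply/ler_addgt0Pr => e e0.
have e2 : 0 < e / 2 by rewrite divr_gt0.
have vf : vanishes U (fun q => hnorm f * hnorm (gs_step es (h q) - gs_step es w)).
  apply: (@vanishes_le _ _ _ _ _ _ (hnorm f)) v; first exact: hnorm_ge0.
  by apply: nearW => q.
have [q [[[q0 qn] P1] d1]] := @filter_ex _ U _ _
  (filterI (filterI UD (UPhi q' q'D _ e2)) (vf _ e2)).
have hq2 := is_L2_cpoisson sigma0 q0.
apply: near_le_half P1 _.
exact: le_lt_trans (l2dot_dist (gs_step_L2 os hq2) (gs_step_L2 os w2) f2) d1.
Qed.

(** Take an ultrafilter of points along which the supremum is approached. If it
    contained no compact subset of the half-space it would tend to the boundary,
    and the supremum would be 0; otherwise it converges to a point, selected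
    before or not. *)
Let exists_best : exists q w, [/\ 0 < q.1, admissible_kernel sigma qs es q w &
  forall q', D q' -> Phi q' <= normc (l2dot f (gs_step es w))].
Proof.
have [qn Dqn] := new_point qs.
pose S := sup [set Phi q | q in D].
have supA : has_sup [set Phi q | q in D].
  split; first by exists (Phi qn), qn.
  by exists (hnorm f) => _ [q [q0 _] <-]; apply: gs_step_le => //; exact: is_L2_cpoisson.
have leS q : D q -> Phi q <= S.
  by move=> Dq; apply: ub_le_sup; [exact: supA.2|exists q].
pose F := filter_from [set e : R | 0 < e] (fun e => [set q | D q /\ S - e < Phi q]).
have FF : ProperFilter F.
  apply: filter_from_proper.
    apply: filter_from_filter; first by exists 1 => /=.
    move=> a b a0 b0; exists (Num.min a b); first by rewrite /= lt_min a0 b0.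
    move=> q [Dq]; rewrite ltrBlDr; case: (leP a b) => ab qS; split; split=> //; lra.
  move=> e e0; have [_ [q Dq <-] qS] := sup_adherent e0 supA.
  by exists q.
have [U [ultraU FU]] := ultraFilterLemma FF.
have UF := @ultra_proper _ _ ultraU.
have US e : 0 < e -> U [set q | D q /\ S - e < Phi q].
  by move=> e0; apply: FU; exists e.
have UD : U [set q | D q] by apply: filterS (US 1 ltr01) => q [].
have UPhi q' : D q' -> forall e, 0 < e -> \forall q \near U, Phi q' - e < Phi q.
  move=> /leS q'S e e0; apply: filterS (US e e0) => q [_]; apply: le_lt_trans.
  by rewrite lerD2r.
have [[K [cK KH UK]]|noK] := pselect (exists K, [/\ compact K, K `<=` halfspace n & U K]).
  have [p [Kp /= Up]] : K `&` [set p | U --> p] !=set0.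
    by move: cK; rewrite compact_ultra; exact.
  have p0 : 0 < p.1 := KH _ Kp.
  have [pqs|pn] := boolP (p \in qs); last first.
    exists p, (h p); split; [exact: p0|by rewrite /admissible_kernel pn|].
    apply: (limit_maximal UF (is_L2_cpoisson sigma0 p0) UD UPhi).
    apply: (gs_step_kernel_cvg n1 sigma0 st p0 pn Up).
    by apply: filterS UD => q [].
  have [w [wj w0 v]] := gs_step_repeat_cvg n1 sigma0 st pqs ultraU Up UD.
  have w2 : is_L2 w := jets_L2 sigma0 p0 wj.
  exists p, w; split; [exact: p0| |]; last first.
    apply: (limit_maximal UF w2 UD UPhi); exact: v.
  rewrite /admissible_kernel pqs/=; split.
  - exact: jets_multiple_kernel wj.
  - by move=> /(res_in_span os w2)/eqP; rewrite (negbTE w0).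
  have seqP (j : nat) : exists q, [/\ D q, ball p j.+1%:R^-1 q &
      hnorm (gs_step es (h q) - gs_step es w) < j.+1%:R^-1].
    have j0 : 0 < j.+1%:R^-1 :> R by rewrite invr_gt0.
    have [q [[Dq qb] qv]] := @filter_ex _ U _ _
      (filterI (filterI UD (Up _ (nbhsx_ballx p _ j0))) (v _ j0)).
    by exists q.
  have [pj pjP] := choice seqP; exists pj; split.
  - by move=> j; have [[]] := pjP j.
  - apply/cvg_ballP => e e0; near=> j; have [_ + _] := pjP j; apply: le_ball.
    by apply: ltW; near: j; exact: near_infty_natSinv_lt (PosNum e0).
  - apply: l2norm_cvg0; first exact: gs_step_L2.
    + by move=> j; have [[q0 _] _ _] := pjP j; apply: gs_step_L2 => //; exact: is_L2_cpoisson.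
    + by move=> j; have [] := pjP j.
exists qn, (h qn); split; [exact: Dqn.1|by rewrite /admissible_kernel Dqn.2|].
have UB : to_boundary R n `<=` U.
  move=> A [K [cK KH] KA].
  have UnK : U (~` K).
    by have [UK|//] := in_ultra_setVsetC K ultraU; case: noK; exists K.
  by apply: filterS2 UD UnK => q [q0 _] nK; apply: KA; split.
have S0 : S <= 0.
  apply/ler_addgt0Pr => e e0; rewrite add0r; have e2 : 0 < e / 2 by rewrite divr_gt0.
  have [q [[_ P1] P2]] := @filter_ex _ U _ _
    (filterI (US _ e2) (UB _ (gs_step_boundary os f2 e2))).
  have {}P1 : S - e / 2 < Phi q by exact: P1.
  have {}P2 : Phi q < e / 2 by exact: P2.
  exact: near0_half P1 P2.
move=> q' /leS; move/le_trans; apply; apply: le_trans S0 _; exact: normc_ge0.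
Unshelve. all: by end_near. Qed.

(** At a selected point an admissible kernel is a limit of kernels at new points,
    so that the best value over new points bounds its value too. *)
Theorem exists_maximal_selection : exists q w, is_maximal_selection sigma f qs es q w.
Proof.
have [q [w [q0 aw best]]] := exists_best; exists q, w; split=> //.
apply/eqP; rewrite eq_le; apply/andP; split.
  by apply: ereal_sup_ubound; exists q, w.
apply: ge_ereal_sup => _ [q' [w' [q'0 aw' ->]]]; rewrite lee_fin.
have w'2 := admissible_L2 q'0 aw'.
move: aw'; rewrite /admissible_kernel; case: ifP => [qn ->|_ [_ _ [p [pD _ pv]]]].
  exact: best.
have D2 j : is_L2 (gs_step es w' \- gs_step es (h (p j))).
  have [q0' _] := pD j; apply: is_L2B; apply: gs_step_L2 => //.
  exact: is_L2_cpoisson.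
have v : vanishes \oo (fun j => hnorm f * hnorm (gs_step es w' \- gs_step es (h (p j)))).
  apply: (@vanishes_le _ _ _ _ _ (fun j => hnorm (gs_step es w' \- gs_step es (h (p j))))
    (hnorm f)); first exact: hnorm_ge0; first exact: nearW.
  by apply: cvg_vanishes; move/fine_cvgP : pv => [].
apply/ler_addgt0Pr => e e0; have [j /= dj] := @filter_ex _ \oo _ _ (v e e0).
have [q0' qn'] := pD j; have hq2 := is_L2_cpoisson sigma0 q0'.
apply: near_le (best (p j) (conj q0' qn')) _.
exact: le_lt_trans (l2dot_dist (gs_step_L2 os w'2) (gs_step_L2 os hq2) f2) dj.
Qed.

End selection.
End Existence.

(** * Convergence of the algorithm *)

Section Convergence.
Context {R : realType} {n : nat}.
Local Notation leb := (lebesgue_rV R n).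
Local Notation fn := ('rV[R]_n -> R[i]).
Local Notation pt := (R * 'rV[R]_n)%type.
Local Notation normc := Normc.normc.
Variables (n1 : (1 <= n)%N) (sigma : R) (sigma0 : 0 < sigma).
Local Notation h := (cpoisson sigma).

Lemma summable_vanishes (a : nat -> R) b : (forall k, 0 <= a k) ->
  (forall N, \sum_(k < N) a k <= b) -> vanishes \oo a.
Proof.
move=> a0 ab; apply: cvg_vanishes; apply: cvg_series_cvg_0.
apply: nondecreasing_is_cvgn.
  by apply: nondecreasing_series => k _ _; exact: a0.
by exists b => _ [N _ <-]; rewrite /series/= big_mkord.
Qed.

Lemma size_gram_schmidt (w : nat -> fn) k : size (gram_schmidt w k) = k.
Proof. by elim: k => //= k IH; rewrite size_rcons IH. Qed.

Lemma nth_gram_schmidt (w : nat -> fn) k i : (i < k)%N ->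
  nth 0 (gram_schmidt w k) i = poafd_system w i.
Proof.
elim: k => // k IH; rewrite ltnS leq_eqVlt /= nth_rcons size_gram_schmidt.
by case: ltngtP => //= [ik _|-> _]; [exact: IH|].
Qed.

Let le_ereal_sup_fin (a b : R) (A : set (\bar R)) : b%:E = ereal_sup A -> A a%:E -> a <= b.
Proof. by move=> bA Aa; rewrite -lee_fin bA; exact: ereal_sup_ubound. Qed.

Section run.
Variables (f : fn) (f2 : is_L2 f) (q : nat -> pt) (w : nat -> fn).

Lemma poafd_state_run k : (forall i, (i < k)%N -> maximal_at sigma f q w i) ->
  exists M, poafd_state sigma (mkseq q k) (gram_schmidt w k) M.
Proof.
elim: k => [|k IH] mx; first by exists 0%N; exact: poafd_state_nil.
have [|M st] := IH; first by move=> i ik; apply: mx; exact: ltnW.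
have [qk adm _] := mx k (leqnn _).
have [M' st'] := poafd_state_rcons n1 sigma0 st qk adm.
by exists M'; rewrite mkseqS.
Qed.

Hypothesis mx : forall k, maximal_at sigma f q w k.

Let os k : orthonormal (gram_schmidt w k).
Proof. by have [|M []] := @poafd_state_run k. Qed.

Let pos k : 0 < (q k).1. Proof. by have [] := mx k. Qed.

Let w2 k : is_L2 (w k).
Proof. by have [_ adm _] := mx k; exact: admissible_L2 (pos k) adm. Qed.

Lemma poafd_orthonormal i j :
  l2dot (poafd_system w i) (poafd_system w j) = (i == j)%:R.
Proof.
have il : (i < (maxn i j).+1)%N by rewrite ltnS leq_maxl.
have jl : (j < (maxn i j).+1)%N by rewrite ltnS leq_maxr.
rewrite -(nth_gram_schmidt w il) -(nth_gram_schmidt w jl).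
by apply: (os _).2; rewrite size_gram_schmidt.
Qed.

Let rest N := gs_residual (gram_schmidt w N) f.

Let rest2 N : is_L2 (rest N). Proof. exact: res_L2. Qed.

Let coef_vanishes : vanishes \oo (fun k => normc (l2dot f (poafd_system w k))).
Proof.
have v : vanishes \oo (fun k => normc (l2dot f (poafd_system w k)) ^+ 2).
  apply: (@summable_vanishes _ (hnorm f ^+ 2)) => [k|N]; first exact: sqr_ge0.
  rewrite (hnorm_res (os N) f2) -[X in X <= _]add0r; apply: lerD; first exact: sqr_ge0.
  rewrite -(big_mkord xpredT (fun k => normc (l2dot f (poafd_system w k)) ^+ 2)).
  rewrite -(big_mkord xpredT
    (fun k => normc (l2dot f (nth 0 (gram_schmidt w N) k)) ^+ 2)) size_gram_schmidt.
  by apply/ler_sum_nat => k /andP[_ kN]; rewrite nth_gram_schmidt.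
move=> e e0; have := v (e ^+ 2) (exprn_gt0 _ e0); apply: filterS => k.
by rewrite ltr_pXn2r// nnegrE ?normc_ge0 ?ltW.
Qed.

Let w_span i N : (i < N)%N -> lspan (ins (gram_schmidt w N)) (w i).
Proof.
move=> iN; have insg j : (j < N)%N -> ins (gram_schmidt w N) (poafd_system w j).
  by move=> jN; exists j; [rewrite size_gram_schmidt|exact: nth_gram_schmidt].
set es := gram_schmidt w i.
have r0 : hnorm (gs_residual es (w i)) != 0.
  have [|M st] := @poafd_state_run i; first by [].
  by have [_ adm _] := mx i; exact: (admissible_res_neq0 n1 sigma0 st (pos i) adm).
have -> : w i = proj es (w i) + (hnorm (gs_residual es (w i)))%:C%C *: poafd_system w i.
  rewrite /poafd_system gs_stepE -/es scalerA -rmorphM/= mulfV// rmorph1 scale1r.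
  by rewrite gs_residualE addrC subrK.
apply: lspanD.
  apply: lspan_sum => -[j /= jl] _; apply: lspanZ; apply: lspan_gen.
  rewrite size_gram_schmidt in jl; rewrite nth_gram_schmidt//; apply: insg.
  exact: ltn_trans jl iN.
by apply: lspanZ; apply: lspan_gen; exact: insg.
Qed.

(** The residual becomes weakly orthogonal to every kernel: a kernel that is
    never selected competed in vain at every step, and a selected one lies in
    the span from then on. *)
Let rest_kernel p : 0 < p.1 -> vanishes \oo (fun N => normc (l2dot (rest N) (h p))).
Proof.
move=> p0; have hp2 := is_L2_cpoisson sigma0 p0.
have [|nsel] := pselect (exists i, q i == p).
  move=> selp; pose i := ex_minn selp.
  have [qi imin] : q i = p /\ forall j, q j = p -> (i <= j)%N.
    by rewrite /i; case: ex_minnP => j /eqP ? jmin; split=> // k /eqP; exact: jmin.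
  have wi : w i = h p.
    have [_ + _] := mx i; rewrite /admissible_kernel qi ifT//.
    apply/negP => /mapP[j]; rewrite mem_iota add0n => /andP[_ ji] /esym/imin.
    by rewrite leqNgt ji.
  have z N : (i < N)%N -> l2dot (rest N) (h p) = 0.
    move=> iN; rewrite -wi /rest (dot_resC (os N) f2 (w2 i)).
    by rewrite (res_ins (os N) (w_span iN)) l2dot0r.
  move=> e e0; exists i.+1; first by [].
  by move=> N iN; apply: le_lt_trans e0; rewrite (z N iN) Normc.normc0.
apply: (@vanishes_le _ _ _ _ _ _ (hnorm (h p))) coef_vanishes; first exact: hnorm_ge0.
apply: nearW => N; rewrite /rest (dot_resC (os N) f2 hp2).
have pn : p \notin mkseq q N.
  by apply/negP => /mapP[j _ pj]; apply: nsel; exists j; rewrite pj.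
have [|M st] := @poafd_state_run N; first by [].
have r0 := res_cpoisson_neq0 n1 sigma0 st p0 pn.
have : normc (l2dot f (gs_step (gram_schmidt w N) (h p))) <=
    normc (l2dot f (poafd_system w N)).
  have [_ _ E] := mx N; apply: le_ereal_sup_fin E _.
  by exists p, (h p); split=> //; rewrite /admissible_kernel pn.
rewrite gs_stepE l2dotZr//; last exact: res_L2.
rewrite Normc.normcM normcJ normcR ger0_norm ?invr_ge0 ?hnorm_ge0//.
rewrite ler_pdivrMl; last by rewrite lt_neqAle eq_sym r0 hnorm_ge0.
move/le_trans; apply; rewrite ler_wpM2r ?normc_ge0//.
exact: hnorm_res_le.
Qed.

Let rest_vanishes : vanishes \oo (fun N => hnorm (rest N)).
Proof.
have v : vanishes \oo (fun N => normc (l2dot (rest N) f)).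
  apply: (@weak_vanishes _ _ sigma sigma0 nat \oo _ rest (hnorm f)) => //.
  - exact: nearW.
  - by apply: nearW => N; exact: hnorm_res_le.
move=> e e0; have := v (e ^+ 2) (exprn_gt0 _ e0); apply: filterS => N.
have -> : l2dot (rest N) f = (hnorm (rest N) ^+ 2)%:C%C.
  by rewrite -l2dotff// /rest dot_resl.
rewrite normcR ger0_norm ?sqr_ge0//.
by rewrite ltr_pXn2r// nnegrE ?hnorm_ge0 ?ltW.
Qed.

Theorem poafd_converges :
  l2norm (fun y => f y - \sum_(k < N) l2dot f (poafd_system w k) * poafd_system w k y)
    @[N --> \oo] --> (0 : \bar R)%E.
Proof.
rewrite (_ : (fun N => _) = EFin \o (fun N => hnorm (rest N))).
  apply/cvg_EFin; first exact: nearW.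
  by apply: vanishes_cvg => //; apply: nearW => N; exact: hnorm_ge0.
apply/funext => N; rewrite /= -l2norm_fin//; congr l2norm.
apply/funext => y; rewrite /rest gs_residualE /proj !fctE fct_sumE; congr (_ - _).
rewrite -(big_mkord xpredT (fun k => l2dot f (poafd_system w k) * poafd_system w k y)).
rewrite -(big_mkord xpredT (fun k => (l2dot f (nth 0 (gram_schmidt w N) k) *:
  nth 0 (gram_schmidt w N) k) y)) size_gram_schmidt.
by apply: eq_big_nat => k /andP[_ kN]; rewrite nth_gram_schmidt.
Qed.

End run.
End Convergence.

(** * The reproducing kernel space and the theorem *)

Section HKSpace.
Context {R : realType} {n : nat}.
Local Notation fn := ('rV[R]_n -> R[i]).
Local Notation pt := (R * 'rV[R]_n)%type.
Local Notation normc := Normc.normc.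
Variables (n1 : (1 <= n)%N) (sigma : R) (sigma0 : 0 < sigma).
Local Notation h := (cpoisson sigma).
Implicit Types (f g : fn) (u v : pt -> R[i]) (q : pt).

Lemma l2dot_eql f f' g : is_L2 f -> is_L2 f' -> is_L2 g -> hnorm (f - f') = 0 ->
  l2dot f g = l2dot f' g.
Proof.
move=> f2 f'2 g2 d0; apply/eqP; rewrite -subr_eq0 -l2dotBl// -normc_eq0.
rewrite eq_le normc_ge0 andbT.
apply: le_trans (cauchy_schwarz _ g2) _; first exact: is_L2B.
by rewrite d0 mul0r.
Qed.

Lemma represents_eq f g u : represents sigma f u -> represents sigma g u ->
  hnorm (f - g) = 0.
Proof.
move=> [f2 fu] [g2 gu]; apply: (nullspace0 sigma0); first exact: is_L2B.
move=> q q0; have hq2 := is_L2_cpoisson sigma0 q0.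
by rewrite l2dotBl// -[l2dot f _]/(poisson_op sigma f q) fu// -gu// subrr.
Qed.

Lemma in_nullspace_eq0 f : in_nullspace sigma f -> hnorm f = 0.
Proof. by move=> [f2 f0]; apply: (nullspace0 sigma0). Qed.

(** As the null space is trivial, every representative is its own projection. *)
Lemma plus_part_represents f u : represents sigma f u ->
  is_L2 (plus_part sigma u) /\ hnorm (plus_part sigma u - f) = 0.
Proof.
move=> fu; have [f2 _] := fu.
have ff : is_plus_part sigma f f.
  split; split=> //.
  - move=> g gn; have [g2 _] := gn; apply/eqP; rewrite -normc_eq0 eq_le normc_ge0 andbT.
    by apply: le_trans (cauchy_schwarz f2 g2) _; rewrite (in_nullspace_eq0 gn) mulr0.
  - exact: is_L2B.
  - move=> q q0; have hq2 := is_L2_cpoisson sigma0 q0.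
    by rewrite /poisson_op -[f \- f]/(f - f) subrr l2dot0l.
have : [set g | exists2 f, represents sigma f u & is_plus_part sigma f g] (plus_part sigma u).
  by apply: xgetPex; exists f, f.
move: (plus_part sigma u) => g [f' f'u [[g2 _] ns]]; split=> //.
have [f'2 _] := f'u; have d1 := represents_eq f'u fu.
have d2 : hnorm (f' - g) = 0 := in_nullspace_eq0 ns.
apply/eqP; rewrite eq_le hnorm_ge0 andbT.
apply: le_trans (hnorm_tri g2 f'2 f2) _; rewrite d1 addr0 hnormBC// d2.
exact: lexx.
Qed.

Lemma HKdot_represents f g u v : represents sigma f u -> represents sigma g v ->
  HKdot sigma u v = l2dot f g.
Proof.
move=> fu gv; have [f2 _] := fu; have [g2 _] := gv.
have [u2 du] := plus_part_represents fu; have [v2 dv] := plus_part_represents gv.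
rewrite /HKdot (l2dot_eql u2 f2 v2 du) (l2dotC v2 f2) (l2dot_eql v2 g2 f2 dv).
by rewrite -l2dotC.
Qed.

Lemma HKnorm_rkernel q : 0 < q.1 -> HKnorm sigma (rkernel sigma q) = hnorm (h q).
Proof.
move=> q0; have hq2 := is_L2_cpoisson sigma0 q0.
have [g2 d0] : is_L2 (plus_part sigma (rkernel sigma q)) /\
    hnorm (plus_part sigma (rkernel sigma q) - h q) = 0.
  by apply: plus_part_represents; split.
have := hnorm_dist g2 hq2; rewrite d0 normr_le0 subr_eq0 => /eqP <-.
by [].
Qed.

Lemma represents_normalized_kernel q : 0 < q.1 ->
  represents sigma (((hnorm (h q))^-1)%:C%C *: h q) (normalized_kernel sigma q).
Proof.
move=> q0; have hq2 := is_L2_cpoisson sigma0 q0; split; first exact: is_L2Z.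
move=> p p0; have hp2 := is_L2_cpoisson sigma0 p0.
by rewrite /poisson_op l2dotZl// /normalized_kernel HKnorm_rkernel.
Qed.

Lemma HK_bvc u : in_HK sigma u ->
  normc (HKdot sigma u (normalized_kernel sigma q)) @[q --> to_boundary R n] --> (0 : R).
Proof.
move=> [f fu]; have [f2 _] := fu; have FF := to_boundary_filter (R := R) n.
apply: vanishes_cvg; first by apply: nearW => q; exact: normc_ge0.
apply: (@vanishes_le _ _ _ _ _ _ 1) (bvc n1 sigma0 f2) => //.
apply: filterS (@near_halfspace R n) => q q0; have hq2 := is_L2_cpoisson sigma0 q0.
rewrite (HKdot_represents fu (represents_normalized_kernel q0)) l2dotZr//.
rewrite Normc.normcM normcJ normcR ger0_norm ?invr_ge0 ?hnorm_ge0//.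
by rewrite mul1r mulrC.
Qed.

End HKSpace.

Theorem theorem4p1 (R : realType) (n : nat) (sigma : R)
    (n_ge1 : (1 <= n)%N) (sigma_gt0 : 0 < sigma) :
  (forall u : R * 'rV[R]_n -> R[i], in_HK sigma u ->
     Normc.normc (HKdot sigma u (normalized_kernel sigma q))
       @[q --> to_boundary R n] --> (0 : R))
  /\
  forall f : 'rV[R]_n -> R[i], is_L2 f ->
    (forall (k : nat) (q : nat -> R * 'rV[R]_n) (w : nat -> 'rV[R]_n -> R[i]),
       (forall i : nat, (i < k)%N -> maximal_at sigma f q w i) ->
       exists (qk : R * 'rV[R]_n) (wk : 'rV[R]_n -> R[i]),
         is_maximal_selection sigma f (mkseq q k) (gram_schmidt w k) qk wk)
    /\
    (forall (q : nat -> R * 'rV[R]_n) (w : nat -> 'rV[R]_n -> R[i]),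
       (forall k : nat, maximal_at sigma f q w k) ->
       (forall i j : nat,
          l2dot (poafd_system w i) (poafd_system w j) = (i == j)%:R) /\
       l2norm (fun y => f y -
           \sum_(k < N) l2dot f (poafd_system w k) * poafd_system w k y)
         @[N --> \oo] --> (0 : \bar R)%E).
Proof.
split; first by move=> u; exact: HK_bvc.
move=> f f2; split=> [k q w mx|q w mx].
  have [M st] := poafd_state_run n_ge1 sigma_gt0 mx.
  exact: (exists_maximal_selection n_ge1 sigma_gt0 f2 st).
split; first exact: (poafd_orthonormal n_ge1 sigma_gt0 mx).
exact: (poafd_converges n_ge1 sigma_gt0 f2 mx).
Qed.
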